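(* Let $G$ be a discrete group, $\underline{\pi}$ an $\mathcal{O}_G$-group, and $\mathcal{M}$ an equivariant local coefficient system on $K_G(\underline{\pi},1)$ given by a $\underline{\pi}$-module $(M,\underline{\phi})$. Let $X$ be a $G$-space over $K_G(\underline{\pi},1)$ with structure map $p\colon X\to K_G(\underline{\pi},1)$. Then for every $n$ $$H^n_G\big(S_{K_G(\underline{\pi},1)}(X);S(p)^*\mathcal{M}\big)\;\cong\;H^{n-1}_G(X;p^*\mathcal{M})\oplus H^n_G\big(K_G(\underline{\pi},1);\mathcal{M}\big).$$
   Context: **Orbit category.** $\mathcal{O}_G$ has objects $G/H$ ($H\le G$) and morphisms the $G$-maps; $a\in G$ with $a^{-1}Ha\subseteq K$ gives $\hat a\colon G/H\to G/K$, $eH\mapsto aK$, and all morphisms are of this form. An (abelian) $\mathcal{O}_G$-group is a functor from $\mathcal{O}_G^{op}$ to (abelian) groups. A $\underline{\pi}$-module $(M,\underline{\phi})$ is an abelian $\mathcal{O}_G$-group $M$ with a natural transformation $\underline{\phi}\colon\underline{\pi}\times M\to M$ making each $M(G/H)$ a $\underline{\pi}(G/H)$-module. For a $G$-space $X$, $\Phi X(G/H)=X^H$ and $\Phi X(\hat a)(x)=ax$. $K_G(\underline{\pi},1)$ is an equivariant Eilenberg–Mac Lane space: a $G$-connected (all fixed point sets path-connected) pointed $G$-space, $G$-homotopy equivalent to a $G$-CW complex, with $\pi_1(K_G(\underline{\pi},1)^H)=\underline{\pi}(G/H)$ naturally in $G/H$ and all other homotopy groups of fixed point sets zero. **Bredon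 cohomology with local coefficients.** A local coefficient system on a space $Y$ is a contravariant functor $\mathcal{A}$ from the fundamental groupoid of $Y$ to abelian groups. $C^n(Y;\mathcal{A})$ is the group of functions $f$ on singular simplices $\sigma\colon\Delta^n\to Y$ with $f(\sigma)\in\mathcal{A}(\sigma(0))$, and $\delta f(\sigma)=\mathcal{A}(\sigma|_{[0,1]})f(\sigma^{(0)})+\sum_{j=1}^n(-1)^jf(\sigma^{(j)})$ for $f\in C^{n-1}(Y;\mathcal{A})$, where $\sigma^{(j)}$ is the $j$-th face. An equivariant local coefficient system $\mathcal{N}$ on a $G$-space $X$ consists of a local coefficient system $\mathcal{N}(G/H)$ on $X^H$ for each $H\le G$ and (functorially) for each $\hat a\colon G/H\to G/K$ a natural transformation $\mathcal{N}(\hat a)\colon\mathcal{N}(G/K)\to\Phi X(\hat a)^*\mathcal{N}(G/H)$. $C^n_G(X;\mathcal{N})$ is the group of arrays $f=(f(G/H))\in\prod_{H\le G}C^n(X^H;\mathcal{N}(G/H))$ such that $f(G/H)(a\sigma)=\mathcal{N}(\hat a)(\sigma(0))f(G/K)(\sigma)$ whenever $a^{-1}Ha\subseteq K$ and $\sigma\colon\Delta^n\to X^K$, with componentwise coboundary; $H^n_G(X;\mathcal{N})$ is its $n$-th cohomology (zero for $n<0$). On the $G$-connected space $K_G(\underline{\pi},1)$ a $\underline{\pi}$-module is the same as an equivariant local coefficient system; such systems pull back along $G$-maps. **Suspension.** Fix a base point $\ast\in S^1$. For $p\colon X\to K_G(\underline{\pi},1)$, $$S_{K_G(\underline{\pi},1)}(X)=\big((X\times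 S^1)\sqcup K_G(\underline{\pi},1)\big)/\big((x,\ast)\sim p(x)\big),$$ with $G$ acting trivially on $S^1$; $S(p)\colon S_{K_G(\underline{\pi},1)}(X)\to K_G(\underline{\pi},1)$ is $(x,t)\mapsto p(x)$ on $X\times S^1$ and the identity on $K_G(\underline{\pi},1)$. *)

(* Defs.v *)
From HB Require Import structures.
From Stdlib Require Import Relation_Operators.
From mathcomp Require Import all_boot all_order all_algebra generic_quotient.
From mathcomp Require Import ring_quotient.
From mathcomp Require Import all_classical all_reals topology normedtype.
From mathcomp Require Import homotopy.

Set Implicit Arguments.
Unset Strict Implicit.
Unset Printing Implicit Defensive.

Import Order.TTheory GRing.Theory Num.Theory numFieldNormedType.Exports.

Local Open Scope classical_set_scope.
Local Open Scope ring_scope.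
Local Open Scope quotient_scope.

Lemma paste_continuous (T U : topologicalType) (A B : set T) (f g h : T -> U) :
  closed A -> closed B -> (forall x, A x \/ B x) ->
  continuous f -> continuous g ->
  (forall x, A x -> h x = f x) -> (forall x, B x -> h x = g x) ->
  continuous h.
Proof.
move=> cA cB AB cf cg hf hg; apply/continuous_closedP => C cC.
have -> : h @^-1` C = (A `&` f @^-1` C) `|` (B `&` g @^-1` C).
  apply/seteqP; split => x /=.
    case: (AB x) => [Ax|Bx]; rewrite ?(hf _ Ax) ?(hg _ Bx) => Cx; [by left|by right].
  by case=> -[Dx]; rewrite ?(hf _ Dx) ?(hg _ Dx).
by apply: closedU; apply: closedI => //; exact: (continuous_closedP _).1.
Qed.

Lemma pair_continuous (T U V : topologicalType) (f : T -> U) (g : T -> V) :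
  continuous f -> continuous g -> continuous (fun x => (f x, g x)).
Proof. by move=> cf cg x; apply: cvg_pair; [exact: cf|exact: cg]. Qed.

Lemma comp_continuous (T U V : topologicalType) (f : T -> U) (g : U -> V) :
  continuous f -> continuous g -> continuous (fun x => g (f x)).
Proof. by move=> cf cg x; apply: continuous_comp; [exact: cf|exact: cg]. Qed.

Lemma val_continuous (T : topologicalType) (A : set T) :
  continuous (fun x : A => val x).
Proof. exact: initial_continuous. Qed.

Lemma subtype_continuous (T U : topologicalType) (B : set U) (f : T -> B) :
  continuous (fun x => val (f x)) -> continuous f.
Proof. by move=> cf; exact: continuous_comp_initial. Qed.

Lemma mx_continuous (T U : topologicalType) m n (f : T -> 'M[U]_(m, n)) :
  (forall i j, continuous (fun x => f x i j)) -> continuous f.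
Proof.
move=> cf x A [P Px PA]; rewrite /nbhs /=.
have : \forall y \near x, forall i j, P i j (f y i j).
  apply: filter_forall => i; apply: filter_forall => j.
  exact: cf.
by apply: filterS => y Py; exact: PA.
Qed.

Arguments comp_continuous {T U V f g} _ _ x.
Arguments pair_continuous {T U V f g} _ _ x.
Arguments val_continuous {T A} x.

(* Continuous maps between subspaces are taken between the types `set_type A`
   with the topology of the inclusion. *)
Definition restr (T U : topologicalType) (A : set T) (B : set U)
    (f : continuousType T U) (fAB : forall x, A x -> B (f x)) : A -> B :=
  fun x => exist _ (f (val x)) (mem_set (fAB _ (set_mem (valP x)))).

Lemma restr_continuous (T U : topologicalType) (A : set T) (B : set U)
    (f : continuousType T U) (fAB : forall x, A x -> B (f x)) :
  continuous (restr fAB).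
Proof.
apply: subtype_continuous.
exact: (comp_continuous (val_continuous) (@cts_fun _ _ f)).
Qed.

HB.instance Definition _ (T U : topologicalType) (A : set T) (B : set U)
    (f : continuousType T U) (fAB : forall x, A x -> B (f x)) :=
  @isContinuous.Build A B (restr fAB)
    (@restr_continuous _ _ _ _ _ fAB).

Section interval.
Context (R : realType).

Definition interval01 : Type := (`[0, 1]%classic : set R).
HB.instance Definition _ := Topological.on interval01.

Lemma interval01_mk (x : R) : 0 <= x <= 1 -> x \in (`[0, 1]%classic : set R).
Proof. by move=> x01; apply/mem_set; rewrite /= in_itv. Qed.

Definition interval01_of (x : R) (x01 : 0 <= x <= 1) : interval01 :=
  exist (fun t : R => t \in (`[0, 1]%classic : set R)) x (interval01_mk x01).

Lemma itv01_0 : 0 <= (0 : R) <= 1. Proof. by rewrite lexx ler01. Qed.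
Lemma itv01_1 : 0 <= (1 : R) <= 1. Proof. by rewrite lexx ler01. Qed.

Definition itv01_zero := interval01_of itv01_0.
Definition itv01_one := interval01_of itv01_1.

Lemma itv01_neq : itv01_zero != itv01_one.
Proof. by apply/eqP => /(congr1 val)/eqP; rewrite eq_sym oner_eq0. Qed.

HB.instance Definition _ := isBiPointed.Build interval01 itv01_neq.
End interval.

Section homotopy.
Context (R : realType).
Local Notation I := (interval01 R).

(* Homotopy relative to `A`, from `f` (at time zero) to `g` (at time one). *)
Definition homotopic_rel (T U : topologicalType) (A : set T) (f g : T -> U) :=
  exists h : continuousType (T * I)%type U,
    [/\ forall x, h (x, zero) = f x, forall x, h (x, one) = g x &
        forall x t, A x -> h (x, t) = f x].

Lemma clamp_subproof (x : R) : 0 <= Num.max 0 (Num.min 1 x) <= 1.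
Proof. by rewrite le_max lexx ge_max ler01 ge_min lexx. Qed.

Definition clamp (x : R) : I := interval01_of (clamp_subproof x).

Lemma clamp_continuous : continuous clamp.
Proof.
apply: subtype_continuous => x.
apply: continuous_max; first exact: cst_continuous.
by apply: continuous_min => //; exact: cst_continuous.
Qed.

Lemma clampK (t : I) : clamp (val t) = t.
Proof.
apply/val_inj => /=; case: t => t /=; rewrite inE /= in_itv /= => /andP[t0 t1].
by rewrite min_r // max_r.
Qed.

Definition dbl0 (t : I) : I := clamp (2 * val t).
Definition dbl1 (t : I) : I := clamp (2 * val t - 1).
Definition rev01 (t : I) : I := clamp (1 - val t).

Lemma dbl0_continuous : continuous dbl0.
Proof.
have c : continuous (fun t : R => clamp (2 * t)).
  refine (comp_continuous (f := fun t : R => 2 * t) _ (@clamp_continuous)).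
  exact: mulrl_continuous.
exact (comp_continuous (val_continuous) c).
Qed.

Lemma dbl1_continuous : continuous dbl1.
Proof.
have c : continuous (fun t : R => clamp (2 * t - 1)).
  refine (comp_continuous (f := fun t : R => 2 * t - 1) _ (@clamp_continuous)); move => t.
  by apply: cvgB; [exact: mulrl_continuous|exact: cvg_cst].
exact (comp_continuous (val_continuous) c).
Qed.

Lemma rev01_continuous : continuous rev01.
Proof.
have c : continuous (fun t : R => clamp (1 - t)).
  refine (comp_continuous (f := fun t : R => 1 - t) _ (@clamp_continuous)); move => t.
  by apply: cvgB; [exact: cvg_cst|exact: cvg_id].
exact (comp_continuous (val_continuous) c).
Qed.

Arguments clamp_continuous : clear implicits.
Arguments dbl0_continuous : clear implicits.
Arguments dbl1_continuous : clear implicits.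
Arguments rev01_continuous : clear implicits.

Lemma rev01_zero : rev01 zero = one.
Proof. by rewrite /rev01 subr0; apply: (clampK one). Qed.

Lemma rev01_one : rev01 one = zero.
Proof. by rewrite /rev01 subrr; apply: (clampK zero). Qed.

Lemma dbl0_zero : dbl0 zero = zero.
Proof. by rewrite /dbl0 mulr0; apply: (clampK zero). Qed.

Lemma dbl1_one : dbl1 one = one.
Proof.
rewrite /dbl1 mulr1 (_ : 2 - 1 = 1 :> R) ?[X in X - 1]mulr2n ?addrK //.
exact: (clampK one).
Qed.

Lemma dbl_half (t : I) : val t = 2^-1 -> dbl0 t = one /\ dbl1 t = zero.
Proof.
rewrite /dbl0 /dbl1 => ->; rewrite divff ?pnatr_eq0 // subrr.
by split; [exact: (clampK one)|exact: (clampK zero)].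
Qed.

Lemma zero_le_half : (val (zero : I) <= 2^-1 :> R) = true.
Proof. by rewrite /= invr_ge0 ler0n. Qed.

Lemma one_le_half : (val (one : I) <= 2^-1 :> R) = false.
Proof. by apply/negbTE; rewrite -ltNge /= invf_lt1 ?ltr1n // ltr0n. Qed.

Lemma closed_half (T : topologicalType) (f : T -> I) : continuous f ->
  closed [set x | val (f x) <= 2^-1] /\ closed [set x | 2^-1 <= val (f x)].
Proof.
move=> cf; split.
  apply: (continuous_closedP (fun x => val (f x))).1 (@closed_le _ (2^-1)).
  exact (comp_continuous cf (val_continuous)).
apply: (continuous_closedP (fun x => val (f x))).1 (@closed_ge _ (2^-1)).
exact (comp_continuous cf (val_continuous)).
Qed.

Section homotopic_equivalence.
Context (T U : topologicalType) (A : set T).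
Implicit Types f g h : continuousType T U.

Lemma homotopic_rel_refl f : homotopic_rel A f f.
Proof.
have cf : continuous (fun x : T * I => f x.1).
  refine (comp_continuous (f := fst) _ (@cts_fun _ _ f)); move => x; exact: cvg_fst.
by exists (mkcts cf).
Qed.

Lemma homotopic_rel_sym f g : homotopic_rel A f g -> homotopic_rel A g f.
Proof.
case=> k [k0 k1 kA].
have ck : continuous (fun x : T * I => k (x.1, rev01 x.2)).
  refine (comp_continuous (f := fun x : T * I => (x.1, rev01 x.2)) _ (@cts_fun _ _ k)).
  apply: pair_continuous; first by move=> x; exact: cvg_fst.
  by refine (comp_continuous (f := snd) _ rev01_continuous); move => x; exact: cvg_snd.
exists (mkcts ck); split => [x|x|x t Ax].
- by rewrite -[LHS]/(k (x, rev01 zero)) rev01_zero.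
- by rewrite -[LHS]/(k (x, rev01 one)) rev01_one.
- by rewrite -[LHS]/(k (x, rev01 t)) kA// -k1 kA.
Qed.

Lemma homotopic_rel_trans f g h :
  homotopic_rel A f g -> homotopic_rel A g h -> homotopic_rel A f h.
Proof.
case=> k [k0 k1 kA] [l [l0 l1 lA]].
pose m (x : T * I) :=
  if val x.2 <= 2^-1 then k (x.1, dbl0 x.2) else l (x.1, dbl1 x.2).
have c1 : continuous (fst : T * I -> T) by move=> x; exact: cvg_fst.
have c2 : continuous (snd : T * I -> I) by move=> x; exact: cvg_snd.
have cm : continuous m.
  have [cA cB] := closed_half c2.
  apply: (paste_continuous (f := fun x => k (x.1, dbl0 x.2))
     (g := fun x => l (x.1, dbl1 x.2)) cA cB).
  - by move=> x /=; case: (lerP (val x.2) 2^-1) => ?; [left|right; exact: ltW].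
  - refine (comp_continuous (f := fun x : T * I => (x.1, dbl0 x.2)) _ (@cts_fun _ _ k)).
    exact (pair_continuous c1 (comp_continuous c2 dbl0_continuous)).
  - refine (comp_continuous (f := fun x : T * I => (x.1, dbl1 x.2)) _ (@cts_fun _ _ l)).
    exact (pair_continuous c1 (comp_continuous c2 dbl1_continuous)).
  - by move=> x /= xh; rewrite /m xh.
  - move=> x /= xh; rewrite /m; case: ifP => // xh'.
    have /dbl_half[-> ->] : val x.2 = 2^-1 by apply/eqP; rewrite eq_le xh xh'.
    by rewrite k1 l0.
exists (mkcts cm); split => [x|x|x t Ax].
- by rewrite -[LHS]/(m (x, zero)) /m zero_le_half dbl0_zero k0.
- by rewrite -[LHS]/(m (x, one)) /m one_le_half dbl1_one l1.
- rewrite -[LHS]/(m (x, t)) /m; case: ifP => _; first by rewrite kA.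
  by rewrite lA // -k1 kA.
Qed.
End homotopic_equivalence.

End homotopy.

Arguments dbl0_continuous {R} x.
Arguments dbl1_continuous {R} x.

Section fundamental_groupoid.
Context (R : realType).
Local Notation I := (interval01 R).

(* The two halves of the interval, mapped onto the two intervals of the wedge
   on which the library's `chain_path` is defined. *)
Local Notation wlift b := (@wedge_lift bool _ (bpwedge_shared_pt I I) b).

Definition halves (t : I) : bpwedge I I :=
  if val t <= 2^-1 then wlift true (dbl0 t)
  else wlift false (dbl1 t).

Lemma halves_continuous : continuous halves.
Proof.
have [cA cB] := closed_half (fun x : I => cvg_id).
apply: (paste_continuous (f := fun t => wlift true (dbl0 t))
    (g := fun t => wlift false (dbl1 t)) cA cB).
- by move=> x /=; case: (lerP (val x) 2^-1) => ?; [left|right; exact: ltW].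
- exact (comp_continuous dbl0_continuous
    (@wedge_lift_continuous _ _ (bpwedge_shared_pt I I) true)).
- exact (comp_continuous dbl1_continuous
    (@wedge_lift_continuous _ _ (bpwedge_shared_pt I I) false)).
- by move=> x /= xh; rewrite /halves xh.
- move=> x /= xh; rewrite /halves; case: ifP => // xh'.
  have /dbl_half[-> ->] : val x = 2^-1 by apply/eqP; rewrite eq_le xh xh'.
  exact: (@wedge_liftE _ _ (bpwedge_shared_pt I I) false zero true one).
Qed.

Lemma halves_zero : halves zero = zero.
Proof. by rewrite /halves zero_le_half dbl0_zero. Qed.

Lemma halves_one : halves one = one.
Proof. by rewrite /halves one_le_half dbl1_one. Qed.

Definition halves_path : {path I from zero to one in bpwedge I I} :=
  mk_path halves_continuous halves_zero halves_one.

Context (Y : topologicalType).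
Implicit Types x y z : Y.

Definition path_homotopic x y (p q : {path I from x to y in Y}) : bool :=
  `[< homotopic_rel R [set zero; one] p q >].

Lemma path_homotopic_refl x y : reflexive (@path_homotopic x y).
Proof. by move=> p; apply/asboolP; exact: homotopic_rel_refl. Qed.

Lemma path_homotopic_sym x y : symmetric (@path_homotopic x y).
Proof. by move=> p q; apply: asbool_equiv_eq; split; exact: homotopic_rel_sym. Qed.

Lemma path_homotopic_trans x y : transitive (@path_homotopic x y).
Proof.
by move=> q p r /asboolP pq /asboolP qr; apply/asboolP; exact: homotopic_rel_trans pq qr.
Qed.

Canonical path_homotopic_equiv x y := EquivRel (@path_homotopic x y)
  (@path_homotopic_refl x y) (@path_homotopic_sym x y) (@path_homotopic_trans x y).

(* `path_class x y` is the set of morphisms from `x` to `y` in the fundamental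
   groupoid; the composite `path_comp c d` runs through `c` first. *)
Definition path_class x y := {eq_quot (@path_homotopic x y)}.
HB.instance Definition _ x y := Choice.on (path_class x y).
HB.instance Definition _ x y := Quotient.on (path_class x y).

Definition pclass x y (p : {path I from x to y in Y}) : path_class x y := \pi p.

Lemma pclassP x y (p q : {path I from x to y in Y}) :
  reflect (homotopic_rel R [set zero; one] p q) (pclass p == pclass q).
Proof. by rewrite /pclass eqmodE; exact: asboolP. Qed.

Definition path_id x : path_class x x := pclass (cst x).

Definition concat x y z (p : {path I from x to y in Y}) (q : {path I from y to z in Y}) :
  {path I from x to z in Y} := reparameterize (chain_path p q) halves_path.

Lemma concatE x y z (p : {path I from x to y in Y}) (q : {path I from y to z in Y}) t :
  concat p q t = if val t <= 2^-1 then p (dbl0 t) else q (dbl1 t).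
Proof.
rewrite /concat /reparameterize /= /mk_path /halves /chain_path.
by case: ifP => _ /=; rewrite wedge_lift_funE //;
  case=> [] [] //=; rewrite ?path_one ?path_zero.
Qed.

Definition path_comp x y z (c : path_class x y) (d : path_class y z) :
  path_class x z := pclass (concat (repr c) (repr d)).

Lemma concat_homotopic x y z (p p' : {path I from x to y in Y})
    (q q' : {path I from y to z in Y}) :
  homotopic_rel R [set zero; one] p p' -> homotopic_rel R [set zero; one] q q' ->
  homotopic_rel R [set zero; one] (concat p q) (concat p' q').
Proof.
case=> k [k0 k1 kA] [l [l0 l1 lA]].
pose m (s : I * I) :=
  if val s.1 <= 2^-1 then k (dbl0 s.1, s.2) else l (dbl1 s.1, s.2).
have c1 : continuous (fst : I * I -> I) by move=> s; exact: cvg_fst.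
have c2 : continuous (snd : I * I -> I) by move=> s; exact: cvg_snd.
have cm : continuous m.
  have [cA cB] := closed_half c1.
  apply: (paste_continuous (f := fun s => k (dbl0 s.1, s.2))
     (g := fun s => l (dbl1 s.1, s.2)) cA cB).
  - by move=> s /=; case: (lerP (val s.1) 2^-1) => ?; [left|right; exact: ltW].
  - refine (comp_continuous (f := fun s : I * I => (dbl0 s.1, s.2)) _ (@cts_fun _ _ k)).
    exact (pair_continuous (comp_continuous c1 dbl0_continuous) c2).
  - refine (comp_continuous (f := fun s : I * I => (dbl1 s.1, s.2)) _ (@cts_fun _ _ l)).
    exact (pair_continuous (comp_continuous c1 dbl1_continuous) c2).
  - by move=> s /= sh; rewrite /m sh.
  - move=> s /= sh; rewrite /m; case: ifP => // sh'.
    have /dbl_half[-> ->] : val s.1 = 2^-1 by apply/eqP; rewrite eq_le sh sh'.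
    by rewrite kA ?lA ?path_one ?path_zero//; [left|right].
exists (mkcts cm); split => [s|s|s t].
- by rewrite -[LHS]/(m (s, zero)) /m concatE k0 l0.
- by rewrite -[LHS]/(m (s, one)) /m concatE k1 l1.
- rewrite -[LHS]/(m (s, t)) /m concatE => -[->|->] /=.
    by rewrite zero_le_half dbl0_zero kA //; left.
  by rewrite one_le_half dbl1_one lA //; right.
Qed.

Lemma pclassK x y (p : {path I from x to y in Y}) :
  homotopic_rel R [set zero; one] (repr (pclass p)) p.
Proof. by apply/pclassP; rewrite /pclass reprK. Qed.

Lemma path_comp_pclass x y z (p : {path I from x to y in Y})
    (q : {path I from y to z in Y}) :
  path_comp (pclass p) (pclass q) = pclass (concat p q).
Proof. by apply/eqP/pclassP/concat_homotopic; exact: pclassK. Qed.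

End fundamental_groupoid.

Section path_map.
Context (R : realType) (Y Z : topologicalType) (f : continuousType Y Z).
Local Notation I := (interval01 R).

Lemma comp_homotopic (x y : Y) (p q : {path I from x to y in Y}) :
  homotopic_rel R [set zero; one] p q ->
  homotopic_rel R [set zero; one] (f \o p) (f \o q).
Proof.
case=> k [k0 k1 kA]; exists (f \o k).
by split => [s|s|s t As] /=; [rewrite k0|rewrite k1|rewrite kA].
Qed.

Definition path_map (x y : Y) (c : path_class R x y) : path_class R (f x) (f y) :=
  pclass (f \o repr c).

Lemma path_map_pclass (x y : Y) (p : {path I from x to y in Y}) :
  path_map (pclass p) = pclass (f \o p).
Proof. by apply/eqP/pclassP/comp_homotopic/pclassK. Qed.

Lemma path_map_id (x : Y) : path_map (path_id R x) = path_id R (f x).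
Proof. by rewrite /path_id path_map_pclass; congr pclass; exact/path_eqP. Qed.

Lemma path_map_comp (x y z : Y) (c : path_class R x y) (d : path_class R y z) :
  path_map (path_comp c d) = path_comp (path_map c) (path_map d).
Proof.
rewrite path_map_pclass path_comp_pclass; congr pclass; apply/path_eqP => t.
rewrite -[LHS]/(f (concat (repr c) (repr d) t)) !concatE.
by case: ifP.
Qed.
End path_map.

Section dependent_functions.
Context (I : Type) (V : I -> zmodType).

Definition prodz : Type := forall i, V i.
HB.instance Definition _ := gen_eqMixin prodz.
HB.instance Definition _ := gen_choiceMixin prodz.

Definition prodz_add (f g : prodz) : prodz := fun i => f i + g i.
Definition prodz_opp (f : prodz) : prodz := fun i => - f i.
Definition prodz_zero : prodz := fun i => 0.

Lemma prodz_addA : associative prodz_add.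
Proof. by move=> f g h; apply: functional_extensionality_dep => i; exact: addrA. Qed.
Lemma prodz_addC : commutative prodz_add.
Proof. by move=> f g; apply: functional_extensionality_dep => i; exact: addrC. Qed.
Lemma prodz_add0 : left_id prodz_zero prodz_add.
Proof. by move=> f; apply: functional_extensionality_dep => i; exact: add0r. Qed.
Lemma prodz_addN : left_inverse prodz_zero prodz_opp prodz_add.
Proof. by move=> f; apply: functional_extensionality_dep => i; exact: addNr. Qed.

HB.instance Definition _ :=
  GRing.isZmodule.Build prodz prodz_addA prodz_addC prodz_add0 prodz_addN.

Lemma prodzB (f g : prodz) i : (f - g) i = f i - g i. Proof. by []. Qed.
Lemma prodz0 i : (0 : prodz) i = 0. Proof. by []. Qed.
End dependent_functions.

Section subgroups.
Context (V : zmodType) (S : zmodClosed V).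

Definition subz : Type := {x : V | x \in S}.
HB.instance Definition _ := SubChoice.on subz.
HB.instance Definition _ := [SubChoice_isSubZmodule of subz by <:].
End subgroups.

Section cohomology.

(* The identity d \o d = 0 is not a field. It holds for the complexes built
   below; `cohomology` is cocycles modulo those cocycles that are
   coboundaries, which is ker / im for a complex starting in degree 0. *)
Record cochains := Cochains {
  cochain_group :> nat -> zmodType;
  cochain_diff : forall n, {additive cochain_group n -> cochain_group n.+1} }.

Context (C : cochains).

Definition cocycle n : {pred C n} := [pred z | cochain_diff C n z == 0].

Lemma cocycle_closed n : zmod_closed (@cocycle n).
Proof.
split=> [|x y]; rewrite !inE ?raddf0 // => /eqP x0 /eqP y0.
by rewrite raddfB x0 y0 subr0.
Qed.
HB.instance Definition _ n := GRing.isZmodClosed.Build (C n)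
  (@cocycle n) (@cocycle_closed n).

Definition is_coboundary n : set (C n) :=
  match n with
  | 0%N => [set 0]
  | m.+1 => range (cochain_diff C m)
  end.

Definition coboundary n : {pred subz (@cocycle n)} :=
  [pred z | `[< is_coboundary (val z) >]].

Lemma coboundary_closed n : zmod_closed (@coboundary n).
Proof.
split=> [|x y].
  apply/asboolP; rewrite raddf0; case: n => [|n] //=.
  by exists 0 => //; rewrite raddf0.
move=> /asboolP xB /asboolP yB; apply/asboolP; rewrite raddfB.
move: xB yB; case: n x y => [|n] x y /=; first by move=> -> ->; rewrite subr0.
move=> [u _ <-] [v _ <-]; exists (u - v) => //.
by rewrite raddfB.
Qed.
HB.instance Definition _ n :=
  GRing.isZmodClosed.Build _ (@coboundary n) (@coboundary_closed n).

Definition cohomology (n : int) : zmodType :=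
  match n with
  | Posz m => Quotient.quot (@coboundary m)
  | Negz _ => 'rV[int]_0
  end.
End cohomology.

Section simplices.
Context (R : realType).
Local Notation I := (interval01 R).

Definition simplex_set n : set 'rV[R]_n.+1 :=
  [set t | (forall i, 0 <= t ord0 i) /\ \sum_i t ord0 i = 1].
Definition simplex n : Type := @simplex_set n.
HB.instance Definition _ n := Topological.copy (simplex n) (set_type (@simplex_set n)).

Definition simplex_of n (t : 'rV[R]_n.+1) (tP : simplex_set t) : simplex n :=
  exist (fun x => x \in @simplex_set n) t (mem_set tP).

Lemma vtx0_subproof n : simplex_set (delta_mx ord0 ord0 : 'rV[R]_n.+1).
Proof.
split=> [i|]; first by rewrite mxE ler0n.
rewrite (bigD1 ord0) //= mxE !eqxx big1 ?addr0 // => i /negPf i0.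
by rewrite mxE i0 andbF.
Qed.
(* The vertex 0, the j-th face inclusion and the edge [0, 1]. *)
Definition vtx0 n : simplex n := simplex_of (@vtx0_subproof n).

Definition face_row n (j : 'I_n.+2) (t : 'rV[R]_n.+1) : 'rV[R]_n.+2 :=
  \row_i (if unlift j i is Some k then t ord0 k else 0).

Lemma face_subproof n (j : 'I_n.+2) (t : 'rV[R]_n.+1) :
  simplex_set t -> simplex_set (face_row j t).
Proof.
case=> t0 t1; split=> [i|]; first by rewrite mxE; case: unlift.
rewrite (bigD1_ord j) //= mxE unlift_none add0r -t1.
by apply: eq_bigr => i _; rewrite mxE liftK.
Qed.

Lemma face_row_continuous n (j : 'I_n.+2) : continuous (@face_row n j).
Proof.
apply: mx_continuous => a i.
under eq_fun do rewrite mxE.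
by case: unlift => [k|]; [exact: coord_continuous|exact: cst_continuous].
Qed.

Definition face n (j : 'I_n.+2) : continuousType (simplex n) (simplex n.+1) :=
  restr (f := mkcts (@face_row_continuous n j)) (@face_subproof n j).

Lemma face_vtx0 n (j : 'I_n.+1) : face (lift ord0 j) (vtx0 n) = vtx0 n.+1.
Proof.
apply/val_inj/rowP => i; rewrite /= !mxE /=.
case: (unliftP (lift ord0 j) i) => [k ->|->]; last first.
  by rewrite -[_ == ord0]/false.
rewrite mxE /=; congr (_%:R); congr nat_of_bool.
apply/eqP/eqP => [->|]; first by apply/val_inj.
case: k => [[|k] hk] /(congr1 val) /=; first by move=> _; apply/val_inj.
by rewrite /bump /= addnS.
Qed.

Definition edge_row n (t : R) : 'rV[R]_n.+2 :=
  (1 - t) *: delta_mx ord0 ord0 + t *: delta_mx ord0 (lift ord0 ord0).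

Lemma edge_subproof n (t : R) :
  [set` `[0, 1]] t -> simplex_set (edge_row n t).
Proof.
rewrite /= in_itv /= => /andP[t0 t1]; split=> [i|].
  by rewrite !mxE addr_ge0 // mulr_ge0 ?ler0n // subr_ge0.
rewrite (bigD1 ord0) //= (bigD1 (lift ord0 ord0)) //=.
rewrite big1 => [|i /andP[/negPf a /negPf b]].
  by rewrite !mxE /= !mulr1 !mulr0 !addr0 add0r subrK.
by rewrite !mxE a b /= !mulr0 addr0.
Qed.

Lemma edge_row_continuous n : continuous (edge_row n).
Proof.
move=> t; apply: cvgD; apply: cvgZr_tmp.
- by apply: cvgB; [exact: cvg_cst|exact: cvg_id].
- exact: cvg_id.
Qed.

Definition edge n : I -> simplex n.+1 :=
  restr (f := mkcts (@edge_row_continuous n)) (@edge_subproof n).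
HB.instance Definition _ n := Continuous.on (@edge n).

Lemma edge_zero n : edge n zero = vtx0 n.+1.
Proof. by apply/val_inj; rewrite /= /mkcts /edge_row subr0 scale1r scale0r addr0. Qed.

Lemma edge_one n : edge n one = face ord0 (vtx0 n).
Proof.
apply/val_inj/rowP => i; rewrite /= /mkcts /edge_row subrr scale1r scale0r add0r !mxE /=.
case: (unliftP ord0 i) => [k ->|->] //.
by rewrite mxE /= (inj_eq lift_inj).
Qed.

HB.instance Definition _ n := isPath.Build I (simplex n.+1) (vtx0 n.+1)
  (face ord0 (vtx0 n)) (@edge n) (@edge_zero n) (@edge_one n).
End simplices.

(* A contravariant functor from the fundamental groupoid of `Y` to abelian
   groups. *)
Record local_system (R : realType) (Y : topologicalType) := LocalSystem {
  ls_fiber :> Y -> zmodType;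
  ls_map : forall x y : Y, path_class R x y -> {additive ls_fiber y -> ls_fiber x};
  ls_map_id : forall (x : Y) (m : ls_fiber x), ls_map (path_id R x) m = m;
  ls_map_comp : forall (x y z : Y) (c : path_class R x y) (d : path_class R y z)
    (m : ls_fiber z), ls_map (path_comp c d) m = ls_map c (ls_map d m) }.

Section local_coefficients.
Context (R : realType) (Y : topologicalType) (A : local_system R Y).

Definition ls_cast (x y : Y) (e : x = y) (m : A x) : A y :=
  eq_rect x (fun z : Y => A z) m y e.

Lemma ls_castB (x y : Y) (e : x = y) : {morph ls_cast e : m n / m - n}.
Proof. by case: _ / e. Qed.

Lemma ls_cast_id (x : Y) (e : x = x) (m : A x) : ls_cast e m = m.
Proof. by rewrite (Prop_irrelevance e erefl). Qed.

Definition cochain n : zmodType :=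
  prodz (fun s : continuousType (simplex R n) Y => A (s (vtx0 R n))).

Lemma cochain_ext n (f : forall s : continuousType (simplex R n) Y, A (s (vtx0 R n)))
    (s t : continuousType (simplex R n) Y) (st : s = t)
    (e : s (vtx0 R n) = t (vtx0 R n)) : ls_cast e (f s) = f t.
Proof. by move: e; rewrite -st => e; rewrite ls_cast_id. Qed.

(* f(s^(0)) lies over s^(0)(0) = s(1), where the edge [0, 1] of s ends, and
   f(s^(j.+1)) over s^(j.+1)(0), which equals s(0) only propositionally. *)
Definition coboundary_map n
    (f : forall s : continuousType (simplex R n) Y, A (s (vtx0 R n))) :
  forall s : continuousType (simplex R n.+1) Y, A (s (vtx0 R n.+1)) := fun s =>
  ls_map A (pclass (s \o @edge R n)) (f (s \o face R ord0)) +
  \sum_(j < n.+1)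
    ls_cast (congr1 s (face_vtx0 R j)) (f (s \o face R (lift ord0 j)))
      *~ (-1) ^+ j.+1.

Lemma coboundary_map_zmod_morphism n :
  zmod_morphism (@coboundary_map n : cochain n -> cochain n.+1).
Proof.
move=> f g; apply: functional_extensionality_dep => s.
rewrite [RHS]prodzB /coboundary_map prodzB raddfB opprD addrACA; congr (_ + _).
rewrite -sumrB; apply: eq_bigr => j _.
by rewrite prodzB ls_castB mulrzBl.
Qed.
HB.instance Definition _ n := GRing.isZmodMorphism.Build (cochain n) (cochain n.+1)
  (@coboundary_map n) (@coboundary_map_zmod_morphism n).

End local_coefficients.

Section orbit_category.
Context (G : groupType).
Local Open Scope group_scope.

(* The subgroups of `G` are the `H : groupClosed G`; the object G/H of the
   orbit category is represented by `H`, and the morphisms G/H -> G/K are the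
   G-maps between the sets of left cosets. *)

Section cosets.
Context (H : groupClosed G).

Definition coset_rel : rel G := fun a b => a^-1 * b \in H.

Lemma coset_rel_refl : reflexive coset_rel.
Proof. by move=> a; rewrite /coset_rel mulVg gpred1. Qed.
Lemma coset_rel_sym : symmetric coset_rel.
Proof. by move=> a b; rewrite /coset_rel -gpredV invgM invgK. Qed.
Lemma coset_rel_trans : transitive coset_rel.
Proof.
move=> b a c ab bc; rewrite /coset_rel.
have -> : a^-1 * c = a^-1 * b * (b^-1 * c) by rewrite -mulgA mulVKg.
exact: gpredM.
Qed.

Canonical coset_equiv :=
  EquivRel coset_rel coset_rel_refl coset_rel_sym coset_rel_trans.
Definition coset_space := {eq_quot coset_rel}.
HB.instance Definition _ := Choice.on coset_space.
HB.instance Definition _ := Quotient.on coset_space.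

Definition coset (a : G) : coset_space := \pi a.

Lemma cosetP (a b : G) : (coset a == coset b) = (a^-1 * b \in H).
Proof. exact: eqmodE. Qed.

Definition coset_act (g : G) (c : coset_space) : coset_space := coset (g * repr c).

Lemma coset_act_coset g a : coset_act g (coset a) = coset (g * a).
Proof.
apply/eqP; rewrite cosetP invgM -mulgA mulKg -cosetP /coset reprK //.
Qed.
End cosets.

Record orbit_map (H K : groupClosed G) := OrbitMap {
  orbit_fun :> coset_space H -> coset_space K;
  orbit_funJ : forall g c, orbit_fun (coset_act g c) = coset_act g (orbit_fun c) }.

Definition orbit_id (H : groupClosed G) : orbit_map H H :=
  @OrbitMap H H id (fun _ _ => erefl).

Lemma orbit_comp_subproof (H K L : groupClosed G) (u : orbit_map H K) (v : orbit_map K L)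
  g c : v (u (coset_act g c)) = coset_act g (v (u c)).
Proof. by rewrite !orbit_funJ. Qed.

Definition orbit_comp (H K L : groupClosed G) (v : orbit_map K L) (u : orbit_map H K) :
  orbit_map H L := OrbitMap (orbit_comp_subproof u v).

(* a^-1 H a is contained in K; `hat` is then the G-map eH |-> aK. *)
Definition subconj (a : G) (H K : groupClosed G) := forall h, h \in H -> h ^ a \in K.

Definition hat_fun (H K : groupClosed G) (a : G) (c : coset_space H) : coset_space K :=
  coset K (repr c * a).

Lemma hat_fun_coset (H K : groupClosed G) a (Ha : subconj a H K) (g : G) :
  hat_fun K a (coset H g) = coset K (g * a).
Proof.
have /Ha : (repr (coset H g))^-1 * g \in H by rewrite -cosetP /coset reprK.
by move=> gaK; apply/eqP; rewrite cosetP invgM -mulgA [X in _ * X]mulgA -conjgE.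
Qed.

Lemma hat_subproof (H K : groupClosed G) a (Ha : subconj a H K) (g : G) (c : coset_space H) :
  hat_fun K a (coset_act g c) = coset_act g (hat_fun K a c).
Proof. by rewrite hat_fun_coset // coset_act_coset mulgA. Qed.

Definition hat (H K : groupClosed G) a (Ha : subconj a H K) : orbit_map H K :=
  OrbitMap (hat_subproof Ha).

Lemma subconj1 (H : groupClosed G) : subconj 1 H H.
Proof. by move=> h; rewrite conjg1. Qed.

Lemma subconjM (H K L : groupClosed G) a b :
  subconj a H K -> subconj b K L -> subconj (a * b) H L.
Proof. by move=> Ha Kb h /Ha/Kb; rewrite conjgM. Qed.

Record og_group := OgGroup {
  og :> groupClosed G -> groupType;
  og_map : forall H K, orbit_map H K -> {multiplicative og K -> og H};
  og_map_id : forall H x, og_map (orbit_id H) x = x;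
  og_map_comp : forall H K L (v : orbit_map K L) (u : orbit_map H K) x,
    og_map (orbit_comp v u) x = og_map u (og_map v x) }.

Record og_abgroup := OgAbgroup {
  oga :> groupClosed G -> zmodType;
  oga_map : forall H K, orbit_map H K -> {additive oga K -> oga H};
  oga_map_id : forall H x, oga_map (orbit_id H) x = x;
  oga_map_comp : forall H K L (v : orbit_map K L) (u : orbit_map H K) x,
    oga_map (orbit_comp v u) x = oga_map u (oga_map v x) }.

Record pi_module (pi : og_group) := PiModule {
  pm_group :> og_abgroup;
  pm_act : forall H, pi H -> pm_group H -> pm_group H;
  pm_act1 : forall H m, @pm_act H 1%g m = m;
  pm_actM : forall H (x y : pi H) m, pm_act (x * y)%g m = pm_act x (pm_act y m);
  pm_actD : forall H (x : pi H) m n, pm_act x (m + n)%R = (pm_act x m + pm_act x n)%R;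
  pm_act_nat : forall H K (u : orbit_map H K) (x : pi K) (m : pm_group K),
    oga_map pm_group u (pm_act x m) = pm_act (og_map pi u x) (oga_map pm_group u m) }.

End orbit_category.

(* As `G` is discrete, an action is continuous as soon as every element acts
   continuously. *)
Record gspace (G : groupType) := Gspace {
  gspace_sort :> topologicalType;
  gact : G -> gspace_sort -> gspace_sort;
  gact_continuous : forall g, continuous (gact g);
  gact1 : forall x, gact 1%g x = x;
  gactM : forall g h x, gact (g * h)%g x = gact g (gact h x) }.

Section g_spaces.
Context (G : groupType).

Record gmap (X Y : gspace G) := Gmap {
  gmap_fun :> continuousType X Y;
  gmapJ : forall g x, gmap_fun (gact g x) = gact g (gmap_fun x) }.

Definition fixed_set (X : gspace G) (H : groupClosed G) : set X :=
  [set x | forall h, h \in H -> gact h x = x].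

Arguments fixed_set X H : clear implicits.

Definition fixpts (X : gspace G) (H : groupClosed G) : topologicalType :=
  set_type (fixed_set X H).

Lemma gact_fixed (X : gspace G) (H K : groupClosed G) a (Ha : subconj a H K) (x : X) :
  fixed_set X K x -> fixed_set X H (gact a x).
Proof.
move=> xK h hH; rewrite -{2}(xK _ (Ha _ hH)) -!gactM.
by rewrite conjgE mulVKg.
Qed.

(* The map x |-> a x from X^K to X^H, the value of the functor Phi X at
   `hat Ha`. *)
Definition fix_act (X : gspace G) (H K : groupClosed G) a (Ha : subconj a H K) :
    continuousType (fixpts X K) (fixpts X H) :=
  restr (f := mkcts (gact_continuous (g := a))) (gact_fixed (X := X) Ha).

Arguments fix_act X {H K a} Ha.

Lemma gmap_fixed (X Y : gspace G) (p : gmap X Y) (H : groupClosed G) (x : X) :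
  fixed_set X H x -> fixed_set Y H (p x).
Proof. by move=> xH h hH; rewrite -gmapJ xH. Qed.

Definition gmap_fix (X Y : gspace G) (p : gmap X Y) (H : groupClosed G) :
    continuousType (fixpts X H) (fixpts Y H) :=
  restr (f := gmap_fun p) (gmap_fixed p (H := H)).

Arguments gmap_fix {X Y} p H.

Lemma fix_act1 (X : gspace G) (H : groupClosed G) (x : fixpts X H) :
  fix_act X (@subconj1 G H) x = x.
Proof. by apply/val_inj; rewrite /= /mkcts gact1. Qed.

Lemma fix_actM (X : gspace G) (H K L : groupClosed G) a b
    (Ha : subconj a H K) (Hb : subconj b K L) (x : fixpts X L) :
  fix_act X (subconjM Ha Hb) x = fix_act X Ha (fix_act X Hb x).
Proof. by apply/val_inj; rewrite /= /mkcts gactM. Qed.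

Lemma gmap_fix_act (X Y : gspace G) (p : gmap X Y) (H K : groupClosed G) a
    (Ha : subconj a H K) (x : fixpts X K) :
  gmap_fix p H (fix_act X Ha x) = fix_act Y Ha (gmap_fix p K x).
Proof. by apply/val_inj; rewrite /= /mkcts gmapJ. Qed.

End g_spaces.

Arguments fixed_set {G} X H.

Arguments fix_act {G} X {H K a} Ha.
Arguments gmap_fix {G X Y} p H.

(* The component at x of N(hat a) is the map `els_map` with `y` equal to
   fix_act X Ha x. It is indexed by a point `y` and a proof of this equation,
   rather than only by x, so that pulled back systems need no transport along
   equalities of points. The structure is indexed by the elements `a`, and
   `els_map_hat` makes it depend on the morphism `hat a` only. *)
Record eq_local_system (R : realType) (G : groupType) (X : gspace G) := EqLocalSystem {
  els :> forall H : groupClosed G, local_system R (fixpts X H);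
  els_map : forall (H K : groupClosed G) a (Ha : subconj a H K)
    (x : fixpts X K) (y : fixpts X H), y = fix_act X Ha x ->
    {additive els K x -> els H y};
  els_map_nat : forall (H K : groupClosed G) a (Ha : subconj a H K)
    (x y : fixpts X K) (c : path_class R x y) (m : els K y),
    els_map (erefl (fix_act X Ha x)) (ls_map (els K) c m) =
    ls_map (els H) (path_map (fix_act X Ha) c) (els_map (erefl (fix_act X Ha y)) m);
  els_map_hat : forall (H K : groupClosed G) a b (Ha : subconj a H K) (Hb : subconj b H K)
    (x : fixpts X K) (y : fixpts X H)
    (ea : y = fix_act X Ha x) (eb : y = fix_act X Hb x) (m : els K x),
    hat Ha = hat Hb -> els_map ea m = els_map eb m;
  els_map_id : forall (H : groupClosed G) (x : fixpts X H)
    (e : x = fix_act X (@subconj1 G H) x) (m : els H x), els_map e m = m;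
  els_map_comp : forall (H K L : groupClosed G) a b (Ha : subconj a H K) (Hb : subconj b K L)
    (x : fixpts X L) (y : fixpts X K) (z : fixpts X H)
    (e1 : y = fix_act X Hb x) (e2 : z = fix_act X Ha y)
    (e : z = fix_act X (subconjM Ha Hb) x) (m : els L x),
    els_map e m = els_map e2 (els_map e1 m) }.

Section eq_local_system_theory.
Context (R : realType) (G : groupType).
Local Notation I := (interval01 R).

Lemma els_map_path (X : gspace G) (N : eq_local_system R X) (H K : groupClosed G) a
    (Ha : subconj a H K) (x y : fixpts X K) (x' y' : fixpts X H)
    (p : {path I from x to y in fixpts X K}) (q : {path I from x' to y' in fixpts X H})
    (ex : x' = fix_act X Ha x) (ey : y' = fix_act X Ha y) (m : N K y) :
  (forall t, q t = fix_act X Ha (p t)) ->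
  els_map N ex (ls_map (N K) (pclass p) m) =
  ls_map (N H) (pclass q) (els_map N ey m).
Proof.
subst x' y' => qp; rewrite els_map_nat path_map_pclass.
by congr (ls_map _ (pclass _) _); apply/path_eqP => t; rewrite qp.
Qed.

Section pullback.
Context (X Y : gspace G) (p : gmap X Y) (N : eq_local_system R Y).

Definition ls_pull (Z W : topologicalType) (f : continuousType Z W) (A : local_system R W) :
  local_system R Z.
Proof.
refine (@LocalSystem R Z (fun x => A (f x)) (fun x y c => ls_map A (path_map f c)) _ _).
- by move=> x m; rewrite path_map_id ls_map_id.
- by move=> x y z c d m; rewrite path_map_comp ls_map_comp.
Defined.

Lemma pullback_subproof (H K : groupClosed G) a (Ha : subconj a H K)
    (x : fixpts X K) (y : fixpts X H) :
  y = fix_act X Ha x -> gmap_fix p H y = fix_act Y Ha (gmap_fix p K x).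
Proof. by move=> ->; exact: gmap_fix_act. Qed.

Definition pullback : eq_local_system R X.
Proof.
refine (@EqLocalSystem R G X (fun H => ls_pull (gmap_fix p H) (N H))
  (fun H K a Ha x y e => els_map N (pullback_subproof e)) _ _ _ _).
- move=> H K a Ha x y c m; rewrite -[c]reprK /=.
  rewrite (path_map_pclass (gmap_fix p K) (repr c)).
  rewrite (path_map_pclass (fix_act X Ha) (repr c)).
  rewrite (path_map_pclass (gmap_fix p H)).
  by apply: els_map_path => t; exact: gmap_fix_act.
- by move=> H K a b Ha Hb x y ea eb m ab; exact: els_map_hat.
- by move=> H x e m; exact: els_map_id.
- by move=> H K L a b Ha Hb x y z e1 e2 e m; exact: els_map_comp.
Defined.
End pullback.

Section bredon.
Context (X : gspace G) (N : eq_local_system R X).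

Definition fix_cochains n : zmodType := prodz (fun H : groupClosed G => cochain (N H) n).

(* The arrays f with f(G/H)(a s) = N(hat a)(s(0)) (f(G/K)(s)). *)
Definition equivariant_cochain n : {pred fix_cochains n} := fun f =>
  `[< forall (H K : groupClosed G) a (Ha : subconj a H K)
        (s : continuousType (simplex R n) (fixpts X K)),
      f H (fix_act X Ha \o s) = els_map N (erefl (fix_act X Ha (s (vtx0 R n)))) (f K s) >].

Lemma equivariant_cochain_closed n : zmod_closed (@equivariant_cochain n).
Proof.
split=> [|f g /asboolP fE /asboolP gE]; apply/asboolP => H K a Ha s.
  by rewrite !prodz0 raddf0.
by rewrite !prodzB raddfB fE gE.
Qed.
HB.instance Definition _ n := GRing.isZmodClosed.Build (fix_cochains n)
  (@equivariant_cochain n) (@equivariant_cochain_closed n).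

Definition bredon_cochain n : zmodType := subz (@equivariant_cochain n).

Definition fix_coboundary n (f : fix_cochains n) : fix_cochains n.+1 :=
  fun H => coboundary_map (f H).

Lemma els_map_cast (H K : groupClosed G) a (Ha : subconj a H K)
    (x y : fixpts X K) (x' y' : fixpts X H) (e : x = y) (e' : x' = y')
    (ex : x' = fix_act X Ha x) (ey : y' = fix_act X Ha y) (m : N K x) :
  els_map N ey (ls_cast e m) = ls_cast e' (els_map N ex m).
Proof.
subst y y'; rewrite ls_cast_id; congr (els_map _ _ _).
exact: Prop_irrelevance.
Qed.

Lemma fix_coboundary_equivariant n (f : fix_cochains n) :
  f \in @equivariant_cochain n -> fix_coboundary f \in @equivariant_cochain n.+1.
Proof.
move=> /asboolP fE; apply/asboolP => H K a Ha s.
have fE' (u : continuousType (simplex R n) (simplex R n.+1)) :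
    f H ((fix_act X Ha \o s) \o u) =
    els_map N (erefl (fix_act X Ha (s (u (vtx0 R n))))) (f K (s \o u)).
  rewrite -(fE H K a Ha (s \o u)).
  have e : (fix_act X Ha \o (s \o u)) = ((fix_act X Ha \o s) \o u) :> continuousType _ _.
    exact/continuousEP.
  by rewrite -(cochain_ext (A := N H) (f H) e erefl).
rewrite /fix_coboundary /coboundary_map raddfD raddf_sum; congr (_ + _).
  by rewrite fE'; symmetry; apply: els_map_path.
apply: eq_bigr => j _; rewrite raddfMz; congr (_ *~ _).
by rewrite fE'; symmetry; exact: els_map_cast.
Qed.

Definition bredon_diff n (f : bredon_cochain n) : bredon_cochain n.+1 :=
  exist (fun g => g \in @equivariant_cochain n.+1) (fix_coboundary (val f))
    (fix_coboundary_equivariant (valP f)).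

Lemma bredon_diff_zmod_morphism n : zmod_morphism (@bredon_diff n).
Proof.
move=> f g; apply/val_inj; apply: functional_extensionality_dep => H.
exact: (@coboundary_map_zmod_morphism R _ (N H) n (val f H) (val g H)).
Qed.
HB.instance Definition _ n := GRing.isZmodMorphism.Build (bredon_cochain n)
  (bredon_cochain n.+1) (@bredon_diff n) (@bredon_diff_zmod_morphism n).

Definition bredon_complex : cochains := @Cochains bredon_cochain bredon_diff.

Definition bredon_cohomology (n : int) : zmodType := cohomology bredon_complex n.
End bredon.
End eq_local_system_theory.

Section disks.
Context (R : realType).

Definition disk_set n : set 'rV[R]_n := [set x | \sum_i x ord0 i ^+ 2 <= 1].
Definition disk n : Type := @disk_set n.
HB.instance Definition _ n := Topological.copy (disk n) (set_type (@disk_set n)).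

Definition sphere n : set (disk n) :=
  [set x | \sum_i (val (x : set_type (@disk_set n)) : 'rV[R]_n) ord0 i ^+ 2 = 1].

Definition circle_set : set (R * R) := [set z | z.1 ^+ 2 + z.2 ^+ 2 = 1].
Definition circle : Type := circle_set.
HB.instance Definition _ := Topological.copy circle (set_type circle_set).
End disks.

Section equivariant_homotopy.
Context (R : realType) (G : groupType).
Local Notation I := (interval01 R).

Definition g_homotopic (X Y : gspace G) (f g : X -> Y) :=
  exists h : continuousType (X * I)%type Y,
    [/\ forall x, h (x, zero) = f x, forall x, h (x, one) = g x &
        forall a x t, h (gact a x, t) = gact a (h (x, t))].

Definition g_homotopy_equivalent (X Y : gspace G) :=
  exists (f : gmap X Y) (g : gmap Y X),
    g_homotopic (g \o f) idfun /\ g_homotopic (f \o g) idfun.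

(* The cells G/H x D^n with their characteristic maps; `skeleton D n` is the
   union of the cells of dimension < n, so that `skeleton D 0` is empty. *)
Record g_cells (Y : gspace G) := GCells {
  cell : nat -> Type;
  cell_stab : forall n, cell n -> groupClosed G;
  cell_map : forall n (e : cell n),
    continuousType (discrete_topology (coset_space (cell_stab e)) * disk R n)%type Y;
  cell_mapJ : forall n (e : cell n) g (c : coset_space (cell_stab e)) x,
    cell_map e (coset_act g c, x) = gact g (cell_map e (c, x)) }.

Definition skeleton (Y : gspace G) (D : g_cells Y) (n : nat) : set Y :=
  [set y | exists m (e : cell D m) z, (m < n)%N /\ y = cell_map e z].

(* `skeleton D n.+1` is the pushout of `skeleton D n` and the cells G/H x D^n
   along the restrictions of their characteristic maps to G/H x S^(n-1): the
   open cells are disjointly embedded outside of `skeleton D n` as sets, and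
   the topology is the quotient one. The space is the colimit of its skeleta. *)
Record is_g_cw (Y : gspace G) (D : g_cells Y) : Prop := IsGCW {
  cw_boundary : forall n (e : cell D n) c x,
    sphere x -> skeleton D n (cell_map e (c, x));
  cw_interior : forall n (e : cell D n) c x,
    ~ sphere x -> ~ skeleton D n (cell_map e (c, x));
  cw_injective : forall n
    (u v : {e : cell D n & (coset_space (cell_stab e) * disk R n)%type}),
    ~ sphere (projT2 u).2 -> ~ sphere (projT2 v).2 ->
    cell_map (projT1 u) (projT2 u) = cell_map (projT1 v) (projT2 v) -> u = v;
  cw_attach : forall n (A : set Y),
    closed (A : set (subspace (skeleton D n.+1))) <->
    closed (A : set (subspace (skeleton D n))) /\
    forall e : cell D n, closed (cell_map e @^-1` A);
  cw_exhaust : forall y, exists n, skeleton D n y;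
  cw_colimit : forall A : set Y,
    closed A <-> forall n, closed (A : set (subspace (skeleton D n))) }.

Definition is_g_cw_complex (Y : gspace G) := exists D : g_cells Y, is_g_cw D.
End equivariant_homotopy.

Section eilenberg_mac_lane.
Context (R : realType) (G : groupType).
Local Notation I := (interval01 R).

Definition fixed_pt (X : gspace G) (x : X) (xG : forall g, gact g x = x)
    (H : groupClosed G) : fixpts X H :=
  exist (fun y => y \in fixed_set X H) x (mem_set (fun h _ => xG h)).

(* The n-th homotopy group, of maps of pairs (D^n, S^(n-1)) -> (Y, y) up to
   homotopy relative to S^(n-1), is trivial. *)
Definition homotopy_trivial (n : nat) (Y : topologicalType) (y : Y) :=
  forall f : continuousType (disk R n) Y, (forall x, sphere x -> f x = y) ->
  homotopic_rel R (@sphere R n) f (cst y).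

(* `em_pi1` is the identification of the fundamental group of K^H with
   pi(G/H); it is an isomorphism of groups, natural in G/H. *)
Record em_space (pi : og_group G) := EmSpace {
  em_gspace :> gspace G;
  em_pt : em_gspace;
  em_ptJ : forall g, gact g em_pt = em_pt;
  em_connected : forall (H : groupClosed G) (x y : fixpts em_gspace H),
    inhabited {path I from x to y in fixpts em_gspace H};
  em_cw : exists2 Y : gspace G, is_g_cw_complex R Y & g_homotopy_equivalent R em_gspace Y;
  em_pi1 : forall H : groupClosed G,
    path_class R (fixed_pt em_ptJ H) (fixed_pt em_ptJ H) -> pi H;
  em_pi1_bij : forall H : groupClosed G, bijective (@em_pi1 H);
  em_pi1M : forall (H : groupClosed G) c d,
    em_pi1 (path_comp c d) = (@em_pi1 H c * @em_pi1 H d)%g;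
  em_pi1_nat : forall (H K : groupClosed G) a (Ha : subconj a H K)
    (p : {path I from fixed_pt em_ptJ K to fixed_pt em_ptJ K in fixpts em_gspace K})
    (q : {path I from fixed_pt em_ptJ H to fixed_pt em_ptJ H in fixpts em_gspace H}),
    (forall t, q t = fix_act em_gspace Ha (p t)) ->
    em_pi1 (pclass q) = og_map pi (hat Ha) (em_pi1 (pclass p));
  em_higher : forall n, (1 < n)%N -> forall H : groupClosed G,
    homotopy_trivial n (fixed_pt em_ptJ H) }.

Definition em_base (pi : og_group G) (K : em_space pi) (H : groupClosed G) : fixpts K H :=
  fixed_pt (@em_ptJ pi K) H.

Lemma em_base_act (pi : og_group G) (K : em_space pi) (H L : groupClosed G) a
    (Ha : subconj a H L) : em_base K H = fix_act K Ha (em_base K L).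
Proof. by apply/val_inj; rewrite /= /mkcts em_ptJ. Qed.

(* The equivariant local coefficient system `N` corresponds to the pi-module
   `M` when its fibre at the base point, with the action of the fundamental
   groups, is `M`. As the fixed point sets are path-connected this determines
   `N` up to isomorphism. Since `path_comp c d` runs through `c` first, the
   contravariant functors `N H` give left actions of the loops. *)
Record given_by_module (pi : og_group G) (K : em_space pi) (M : pi_module pi)
    (N : eq_local_system R K) := GivenByModule {
  gm_iso : forall H : groupClosed G, {additive M H -> N H (em_base K H)};
  gm_iso_bij : forall H : groupClosed G, bijective (gm_iso H);
  gm_act : forall (H : groupClosed G)
    (c : path_class R (em_base K H) (em_base K H)) (m : M H),
    gm_iso H (pm_act (em_pi1 c) m) = ls_map (N H) c (gm_iso H m);
  gm_nat : forall (H L : groupClosed G) a (Ha : subconj a H L) (m : M L),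
    gm_iso H (oga_map M (hat Ha) m) = els_map N (em_base_act K Ha) (gm_iso L m) }.
End eilenberg_mac_lane.

Section suspension.
Context (R : realType) (G : groupType) (X B : gspace G) (p : gmap X B).
Context (s0 : circle R).

Definition susp_part (b : bool) : topologicalType :=
  if b return topologicalType then (X * circle R)%type else B.

Definition susp_sum : topologicalType := {b : bool & susp_part b}.
Definition susp_inl (x : X) (t : circle R) : susp_sum := existT susp_part true (x, t).
Definition susp_inr (y : B) : susp_sum := existT susp_part false y.

(* The generating relation (x, s0) ~ p(x). *)
Definition susp_glue (u v : susp_sum) : Prop :=
  exists x : X, u = susp_inl x s0 /\ v = susp_inr (p x).

Definition susp_rel : rel susp_sum :=
  fun u v => `[< clos_refl_sym_trans susp_sum susp_glue u v >].

Lemma susp_rel_refl : reflexive susp_rel.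
Proof. by move=> u; apply/asboolP; exact: rst_refl. Qed.
Lemma susp_rel_sym : symmetric susp_rel.
Proof. by move=> u v; apply: asbool_equiv_eq; split; exact: rst_sym. Qed.
Lemma susp_rel_trans : transitive susp_rel.
Proof. by move=> v u w /asboolP uv /asboolP vw; apply/asboolP; exact: rst_trans uv vw. Qed.

Canonical susp_equiv := EquivRel susp_rel susp_rel_refl susp_rel_sym susp_rel_trans.

Definition susp_quot := {eq_quot susp_rel}.
HB.instance Definition _ := Quotient.on susp_quot.
HB.instance Definition _ := Topological.copy susp_quot (quotient_topology susp_quot).

Definition susp_pi (u : susp_sum) : susp_quot := \pi u.

Lemma susp_repr_pi (Z : Type) (f : susp_sum -> Z) :
  (forall x, f (susp_inl x s0) = f (susp_inr (p x))) ->
  forall u, f (repr (susp_pi u)) = f u.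
Proof.
move=> fE u.
have gen a b : clos_refl_sym_trans susp_sum susp_glue a b -> f a = f b.
  by elim => {a b} [a b [x [-> ->]]|a|a b _ ->|a b c _ -> _ ->].
apply: gen; apply/asboolP.
by have /eqmodP : susp_pi (repr (susp_pi u)) = susp_pi u by rewrite /susp_pi reprK.
Qed.

Lemma susp_lift_continuous (Z : topologicalType) (f : susp_sum -> Z) :
  (forall x, f (susp_inl x s0) = f (susp_inr (p x))) ->
  continuous f -> continuous (fun q : susp_quot => f (repr q)).
Proof.
move=> fE cf; apply: (repr_comp_continuous cf) => a b /eqP ab; apply/eqP.
by rewrite -(susp_repr_pi fE a) -(susp_repr_pi fE b) /susp_pi ab.
Qed.

Lemma susp_piE (x : X) : susp_pi (susp_inl x s0) = susp_pi (susp_inr (p x)).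
Proof. by apply/eqmodP/asboolP/rst_step; exists x. Qed.

Definition sum_part_act (g : G) (b : bool) : susp_part b -> susp_part b :=
  if b return susp_part b -> susp_part b
  then fun z : X * circle R => (gact g z.1, z.2) else fun y : B => gact g y.

Definition sum_act (g : G) (u : susp_sum) : susp_sum :=
  existT susp_part (projT1 u) (sum_part_act g (projT2 u)).

Lemma sum_act_continuous g : continuous (sum_act g).
Proof.
apply: (@sigT_continuous _ _ _ (fun b w => existT susp_part b (sum_part_act g w))) => b.
apply: (@comp_continuous _ _ _ (@sum_part_act g b) (existT susp_part b)).
  case: b => /=; last exact: gact_continuous.
  apply: (@pair_continuous _ _ _ (fun z : X * circle R => gact g z.1) snd).
    apply: (@comp_continuous _ _ _ fst (gact g)); last exact: gact_continuous.
    by move=> z; exact: cvg_fst.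
  by move=> z; exact: cvg_snd.
exact: existT_continuous.
Qed.

Definition susp_act (g : G) (q : susp_quot) : susp_quot := susp_pi (sum_act g (repr q)).

Lemma susp_act_glue g x :
  susp_pi (sum_act g (susp_inl x s0)) = susp_pi (sum_act g (susp_inr (p x))).
Proof. by rewrite /sum_act /= -gmapJ; exact: susp_piE. Qed.

Lemma susp_act_pi g u : susp_act g (susp_pi u) = susp_pi (sum_act g u).
Proof. exact: (susp_repr_pi (f := susp_pi \o sum_act g) (susp_act_glue g)). Qed.

Lemma susp_act_continuous g : continuous (susp_act g).
Proof.
refine (susp_lift_continuous (f := susp_pi \o sum_act g) (susp_act_glue g) _).
apply: (@comp_continuous _ _ _ (sum_act g) susp_pi); first exact: sum_act_continuous.
exact: pi_continuous.
Qed.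

Lemma susp_act1 q : susp_act 1%g q = q.
Proof.
rewrite -[q]reprK susp_act_pi; congr susp_pi.
by case: (repr q) => -[[x t]|y]; rewrite /sum_act /= gact1.
Qed.

Lemma susp_actM g h q : susp_act (g * h)%g q = susp_act g (susp_act h q).
Proof.
rewrite -[q]reprK !(susp_act_pi _ (repr q)) susp_act_pi; congr susp_pi.
by case: (repr q) => -[[x t]|y]; rewrite /sum_act /= gactM.
Qed.

Definition susp : gspace G := Gspace susp_act_continuous susp_act1 susp_actM.

Definition sum_part_proj (b : bool) : susp_part b -> B :=
  if b return susp_part b -> B
  then fun z : X * circle R => p z.1 else fun y : B => y.

Definition sum_proj (u : susp_sum) : B := sum_part_proj (projT2 u).

(* (x, t) |-> p(x) and y |-> y, on representatives. *)
Definition susp_proj_fun (q : susp) : B := sum_proj (repr (q : susp_quot)).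

Lemma susp_proj_inl x t : susp_proj_fun (susp_pi (susp_inl x t)) = p x.
Proof. exact: (susp_repr_pi (f := sum_proj)). Qed.

Lemma susp_proj_inr y : susp_proj_fun (susp_pi (susp_inr y)) = y.
Proof. exact: (susp_repr_pi (f := sum_proj)). Qed.

Lemma susp_proj_continuous : continuous susp_proj_fun.
Proof.
apply: (susp_lift_continuous (f := sum_proj)) => //.
apply: (@sigT_continuous _ _ _ sum_part_proj) => -[]; last by move=> y; exact: cvg_id.
apply: (@comp_continuous _ _ _ fst (gmap_fun p)); last exact: cts_fun.
by move=> z; exact: cvg_fst.
Qed.

Lemma susp_projJ g (q : susp) : susp_proj_fun (gact g q) = gact g (susp_proj_fun q).
Proof.
rewrite /gact /= -[q](@reprK _ susp_quot) susp_act_pi.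
case: (repr (q : susp_quot)) => -[[x t]|y]; rewrite /sum_act /=.
  by rewrite !susp_proj_inl gmapJ.
by rewrite !susp_proj_inr.
Qed.

Definition susp_proj : gmap susp B :=
  @Gmap G susp B (mkcts susp_proj_continuous) susp_projJ.
End suspension.

(* Main.v *)
(* The suspension S is covered by a neighbourhood U of the base K, which contracts
   to K over K, and by the complement V of K, which is X times a line by
   stereographic projection; the intersection of U and V consists of the two ends
   of the line. A class in H^n(S) is determined by its restriction k to K and by a
   class g in H^(n-1)(X): on simplices that lie in U or in V, the difference of a
   cocycle and the pullback of k is cohomologous to the cochain that vanishes on U
   and is the coboundary of (g times the indicator of the upper half line) on V.
   This relation between cocycles on S and pairs (g, k) is additive and induces
   the isomorphism; it never requires a linear choice of representatives.

   Two tools are needed, homotopy invariance and the small simplices theorem. For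
   both, a cochain is evaluated on the affine simplices of the domain of a
   singular simplex, with values transported along segments to the fibre over the
   vertex 0. It becomes a function on tuples of points, where prisms and
   barycentric subdivision are given by cones, and naturality in the maps and the
   coefficients makes all constructions equivariant. *)
From HB Require Import structures.
Require Import Defs.
From mathcomp Require Import all_boot all_order all_algebra.
From mathcomp Require Import generic_quotient ring_quotient.
From mathcomp Require Import all_classical all_reals topology normedtype sequences.
From mathcomp Require Import realfun homotopy.
From mathcomp Require Import zify lra.

Set Implicit Arguments.
Unset Strict Implicit.
Unset Printing Implicit Defensive.

Import Order.TTheory GRing.Theory Num.Theory numFieldNormedType.Exports.

Local Open Scope classical_set_scope.
Local Open Scope ring_scope.
Local Open Scope quotient_scope.

(** * Operators on functions of tuples *)

(** Cochains on [U] and on [V] do not glue to a cochain on the suspension: a singular simplex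
    contained in neither has no prescribed value. Extension by zero is used instead, at the price
    that identities hold only on simplices inside [U] or inside [V]. The small simplices theorem
    repairs this in a sharp form: a cocycle that vanishes on both kinds of simplices has a primitive
    that vanishes on them too. Primitives have to come from uniform formulas (prisms, subdivisions),
    because values chosen simplex by simplex would break the equations between different fixed point
    sets. In the stereographic coordinate $t$ the part of [V] inside [U] is $|t|>1$; the levels -2
    and 2 are sample points of its two ends, and the jump at 0 separates them. As there are no
    cochains in degree -1, the homotopy and excision statements treat degree 0 separately. *)

Section tuple_differential.
Context (D : Type) (E : zmodType).
Implicit Types (F G : seq D -> E) (w : seq D).

(** The alternating sum over deleted entries ([tdiffE]), in the recursive form of the boundary of a
    cone: the base minus the cone over the boundary of the base. The complex is augmented: on a
    one-element tuple the value is [F [::]]. *)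
Fixpoint tdiff (w : seq D) (F : seq D -> E) : E :=
  if w is x :: w' then F w' - tdiff w' (fun u => F (x :: u)) else 0.

Lemma eq_tdiff w F G : (forall u, (size u).+1 = size w -> F u = G u) ->
  tdiff w F = tdiff w G.
Proof.
elim: w F G => //= x w IH F G FG; rewrite FG //; congr (_ - _).
by apply: IH => u uw; apply: FG => /=; rewrite uw.
Qed.

Lemma tdiff0 w : tdiff w (fun=> 0) = 0.
Proof. by elim: w => //= x w ->; rewrite subr0. Qed.

Lemma tdiffB w F G : tdiff w (fun u => F u - G u) = tdiff w F - tdiff w G.
Proof.
elim: w F G => [|x w IH] F G /=; first by rewrite subrr.
by rewrite IH !opprD !opprK addrACA.
Qed.

Lemma tdiffD w F G : tdiff w (fun u => F u + G u) = tdiff w F + tdiff w G.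
Proof.
elim: w F G => [|x w IH] F G /=; first by rewrite addr0.
by rewrite IH opprD addrACA.
Qed.

Lemma tdiffK w F : tdiff w (fun u => tdiff u F) = 0.
Proof.
elim: w F => //= x w IH F.
by rewrite tdiffB IH subr0 subrr.
Qed.

Definition remove (j : nat) (w : seq D) := take j w ++ drop j.+1 w.

Lemma tdiffE w F : tdiff w F = \sum_(j < size w) F (remove j w) *~ (-1) ^+ j.
Proof.
elim: w F => [|x w IH] F /=; first by rewrite big_ord0.
rewrite big_ord_recl /= mulr1z IH -sumrN /remove /= drop0; congr (_ + _).
by apply: eq_bigr => j _; rewrite exprS mulN1r mulrNz.
Qed.
End tuple_differential.

Arguments tdiff {D E} w F : simpl never.

Lemma tdiff_cons D (E : zmodType) (F : seq D -> E) x w :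
  tdiff (x :: w) F = F w - tdiff w (fun u => F (x :: u)).
Proof. by []. Qed.

Lemma tdiff_rel D D2 (E E2 : zmodType) (phi : D -> D2) (th : {additive E -> E2})
    (F : seq D -> E) (F2 : seq D2 -> E2) w :
  (forall u, F2 (map phi u) = th (F u)) ->
  tdiff (map phi w) F2 = th (tdiff w F).
Proof.
elim: w F F2 => [|x w IH] F F2 FE; first by rewrite /tdiff raddf0.
by rewrite /= !tdiff_cons raddfB FE (IH (fun u => F (x :: u))) // => u; rewrite -FE.
Qed.


(* Operators on functions of tuples are taken polymorphic in the values, so that
   naturality in the values (for projections and subtraction on [E * E])
   includes additivity. *)
Definition operator (D' D : Type) := forall E : zmodType, (seq D' -> E) -> seq D -> E.

Definition op_rel D' D D2' D2 (phi' : D' -> D2') (phi : D -> D2)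
    (L : operator D' D) (L2 : operator D2' D2) :=
  forall (E E2 : zmodType) (th : {additive E -> E2}) (F : seq D' -> E)
    (F2 : seq D2' -> E2) w,
  (forall u, F2 (map phi' u) = th (F u)) -> L2 E2 F2 (map phi w) = th (L E F w).

Definition op_natural D' D (L : operator D' D) := op_rel id id L L.

HB.instance Definition _ (E : zmodType) :=
  GRing.isZmodMorphism.Build (E * E)%type E fst (fun _ _ => erefl).
HB.instance Definition _ (E : zmodType) :=
  GRing.isZmodMorphism.Build (E * E)%type E snd (fun _ _ => erefl).

Section natural_operators.
Context (D' D : Type) (L : operator D' D) (Lnat : op_natural L).
Context (E : zmodType).
Implicit Types (F G : seq D' -> E) (w : seq D).

Lemma op_mor (E2 : zmodType) (th : {additive E -> E2}) F (F2 : seq D' -> E2) w :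
  (forall u, F2 u = th (F u)) -> L F2 w = th (L F w).
Proof. by move=> h; rewrite -[w in LHS]map_id; apply: Lnat => u; rewrite map_id. Qed.

Lemma op_ext F G w : F =1 G -> L F w = L G w.
Proof. by move=> FG; apply: (op_mor (th := idfun)) => u; rewrite FG. Qed.

End natural_operators.

Lemma opB D' D (L : operator D' D) (Lnat : op_natural L) (E : zmodType)
    (F G : seq D' -> E) w :
  L E (fun u => F u - G u) w = L E F w - L E G w.
Proof.
pose FG u : (E * E)%type := (F u, G u).
have <- : (L _ FG w).1 = L E F w by symmetry; exact: (op_mor Lnat (th := @fst E E)).
have <- : (L _ FG w).2 = L E G w by symmetry; exact: (op_mor Lnat (th := @snd E E)).
exact: (op_mor Lnat (th := @fst E E \- @snd E E)).
Qed.

Lemma op0 D' D (L : operator D' D) (Lnat : op_natural L) (E : zmodType) w :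
  L E (fun=> 0) w = 0.
Proof. by rewrite (@op_mor _ _ _ Lnat E E (\0 : {additive E -> E}) (fun=> 0)). Qed.
(* As for acyclic models: a natural operator [L] commuting with the
   differential and vanishing on the empty tuple is null-homotopic, by
   induction on the size of tuples, through cones on the points [c x w]. *)
Section acyclic_homotopy.
Context (D D' : Type) (L : operator D' D) (c : D -> seq D -> D').

Definition cone (E : Type) (x : D') (F : seq D' -> E) : seq D' -> E :=
  fun u => F (x :: u).

(** Dual to the recursion $h(w)=c\cdot(L(w)-h(\partial w))$ on chains. The counter [k] stands for
    the size of the tuple, since [tdiff] hides the calls on shorter tuples from structural recursion
    on [w]. *)
Fixpoint hop_rec k (E : zmodType) (F : seq D' -> E) (w : seq D) : E :=
  if k is k'.+1 then
    if w is x :: w' then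
      L (cone (c x w') F) w - tdiff w (hop_rec k' (cone (c x w') F))
    else 0
  else 0.

Definition hop : operator D' D := fun E F w => hop_rec (size w) F w.

Hypothesis Lnat : op_natural L.
Hypothesis Lnil : forall (E : zmodType) (F : seq D' -> E), L F [::] = 0.
Hypothesis Ldiff : forall (E : zmodType) (F : seq D' -> E) w,
  tdiff w (L F) = L (fun u => tdiff u F) w.

Lemma hop_cons (E : zmodType) (F : seq D' -> E) x w :
  hop F (x :: w) = L (cone (c x w) F) (x :: w) - tdiff (x :: w) (hop (cone (c x w) F)).
Proof.
rewrite [in LHS]/hop [size _]/= [hop_rec _ _ _]/=; congr (_ - _).
by apply: eq_tdiff => u [uw]; rewrite /hop uw.
Qed.
End acyclic_homotopy.

Lemma hop_rel D D' D2 D2' (L : operator D' D) (L2 : operator D2' D2) c c2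
    (phi' : D' -> D2') (phi : D -> D2) :
  op_rel phi' phi L L2 ->
  (forall x w, c2 (phi x) (map phi w) = phi' (c x w)) ->
  op_rel phi' phi (hop L c) (hop L2 c2).
Proof.
move=> LL cc E E2 th F F2 w; rewrite /hop size_map.
move: (size w) => k; elim: k F F2 w => [|k IH] F F2 [|x w] FE /=; rewrite ?raddf0 //.
have conE u : cone (c2 (phi x) [seq phi i | i <- w]) F2 (map phi' u) = th (cone (c x w) F u).
  by rewrite /cone cc -FE.
rewrite -[phi x :: _]/(map phi (x :: w)) (LL _ _ _ _ _ (x :: w) conE).
rewrite [RHS]raddfB; congr (_ - _).
by apply: tdiff_rel => u; exact: IH.
Qed.

Section acyclic_homotopy_theory.
Context (D D' : Type) (L : operator D' D) (c : D -> seq D -> D').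
Hypothesis Lnat : op_natural L.
Hypothesis Lnil : forall (E : zmodType) (F : seq D' -> E), L F [::] = 0.
Hypothesis Ldiff : forall (E : zmodType) (F : seq D' -> E) w,
  tdiff w (L F) = L (fun u => tdiff u F) w.

Lemma hop_natural : op_natural (hop L c).
Proof. by apply: hop_rel => // x w; rewrite map_id. Qed.

(** Coning turns the coboundary of [F] into [F] minus the coboundary of the cone [G] ([coneE]). In
    the recursion for the second term, the induction hypothesis for [G] on shorter tuples leaves a
    double coboundary, which is zero, and two terms that cancel by [Ldiff]. *)
Lemma hopP (E : zmodType) (F : seq D' -> E) w :
  tdiff w (hop L c F) + hop L c (fun u => tdiff u F) w = L F w.
Proof.
have [k] := ubnP (size w); elim: k F w => // k IH F [|x w] kw.
  by rewrite Lnil /hop /= addr0.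
set G := cone (c x w) F.
have coneE : cone (c x w) (fun u => tdiff u F) =1 (fun u => F u - tdiff u G) by [].
rewrite [X in _ + X]hop_cons.
rewrite (op_ext Lnat _ coneE) (opB Lnat).
rewrite [X in _ - X](@eq_tdiff _ _ _ _
    (fun u => hop L c F u - (L G u - tdiff u (hop L c G)))); last first.
  move=> u [uw]; rewrite (op_ext hop_natural _ coneE) (opB hop_natural).
  congr (_ - _); rewrite -(IH G u) 1?addrAC ?subrr ?add0r //.
  by rewrite uw -ltnS.
rewrite tdiffB tdiffB tdiffK subr0 Ldiff.
have alg (p q r : E) : p + (q - r - (p - r)) = q by rewrite opprB addrC -addrA !subrK.
exact: alg.
Qed.
End acyclic_homotopy_theory.

(* [sd F w] is the value of [F] on the barycentric subdivision of [w]: the cone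
   from the center [b x w'] over the subdivided boundary. *)
Section subdivision.
Context (D : Type) (b : D -> seq D -> D).

Fixpoint sd_rec k (E : zmodType) (F : seq D -> E) (w : seq D) : E :=
  if k is k'.+1 then
    if w is x :: w' then tdiff w (sd_rec k' (cone (b x w') F)) else 0
  else F w.

Definition sd : operator D D := fun E F w => sd_rec (size w) F w.

Lemma sd_cons (E : zmodType) (F : seq D -> E) x w :
  sd F (x :: w) = tdiff (x :: w) (sd (cone (b x w) F)).
Proof.
rewrite [in LHS]/sd [size _]/= [sd_rec _ _ _]/=.
by apply: eq_tdiff => u [uw]; rewrite /sd uw.
Qed.

(** The tuples on which [sd b F w] evaluates [F]: the centers of a descending chain of faces, one
    entry being removed at each step. Signs are forgotten, as only vanishing and diameters are read
    off. *)
Inductive sd_support : seq D -> seq D -> Prop :=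
| SdNil : sd_support [::] [::]
| SdCons x w j u : (j < size (x :: w))%N -> sd_support (remove j (x :: w)) u ->
    sd_support (x :: w) (b x w :: u).
End subdivision.

Lemma sd_rel D D2 (phi : D -> D2) b b2 :
  (forall x w, b2 (phi x) (map phi w) = phi (b x w)) ->
  op_rel phi phi (sd b) (sd b2).
Proof.
move=> bb E E2 th F F2 w; rewrite /sd size_map.
move: (size w) => k; elim: k F F2 w => [|k IH] F F2 [|x w] FE //=;
  rewrite ?raddf0 ?(FE [::]) ?(FE (x :: w)) //.
rewrite -[phi x :: _]/(map phi (x :: w)); apply: tdiff_rel => u.
by apply: IH => v; rewrite /cone bb -FE.
Qed.

Section subdivision_theory.
Context (D : Type) (b : D -> seq D -> D).

Lemma sd_natural : op_natural (sd b).
Proof. by apply: sd_rel => x w; rewrite map_id. Qed.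

(** The cone identity used for [hopP] again: the extra term is, by induction on shorter tuples, the
    coboundary of a coboundary. *)
Lemma sd_diff (E : zmodType) (F : seq D -> E) w :
  tdiff w (sd b F) = sd b (fun u => tdiff u F) w.
Proof.
have [k] := ubnP (size w); elim: k F w => // k IH F [|x w] kw //.
set G := cone (b x w) F.
have coneE : cone (b x w) (fun u => tdiff u F) =1 (fun u => F u - tdiff u G) by [].
rewrite sd_cons [RHS](@eq_tdiff _ _ _ _ (fun u => sd b F u - tdiff u (sd b G))).
  by rewrite tdiffB tdiffK subr0.
move=> u [uw]; rewrite (op_ext sd_natural _ coneE) (opB sd_natural) IH //.
by rewrite uw -ltnS.
Qed.

Lemma sd_eq0 (E : zmodType) (F : seq D -> E) w :
  (forall u, sd_support b w u -> F u = 0) -> sd b F w = 0.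
Proof.
have [k] := ubnP (size w); elim: k F w => // k IH F [|x w] kw F0.
  by apply: F0; exact: SdNil.
rewrite sd_cons tdiffE big1 // => j _; rewrite IH ?mul0rz //.
  rewrite /remove size_cat size_take size_drop.
  by rewrite ltn_ord; case: j => j /= jw; move: kw => /=; lia.
by move=> u wu; apply: F0; exact: SdCons wu.
Qed.

Lemma iter_sd_diff (E : zmodType) (F : seq D -> E) i w :
  tdiff w (iter i (@sd _ b E) F) = iter i (@sd _ b E) (fun u => tdiff u F) w.
Proof.
elim: i w => //= i IH w; rewrite sd_diff; apply: op_ext => //; exact: sd_natural.
Qed.

Lemma iter_sd0 (E : zmodType) (F : seq D -> E) i w :
  F =1 (fun=> 0) -> iter i (@sd _ b E) F w = 0.
Proof.
move=> F0; elim: i w => //= i IH w.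
by rewrite (op_ext sd_natural _ IH) (op0 sd_natural).
Qed.

Definition sd_diff_op : operator D D := fun E F w => F w - sd b F w.
(** The cone points of the homotopy are the centers used by [sd] itself, so that every map of points
    commuting with the centers commutes with the homotopy too. *)
Definition sdh : operator D D := hop sd_diff_op b.

End subdivision_theory.

Lemma sdh_rel D D2 (phi : D -> D2) b b2 :
  (forall x w, b2 (phi x) (map phi w) = phi (b x w)) ->
  op_rel phi phi (sdh b) (sdh b2).
Proof.
move=> bb; apply: hop_rel => // E E2 th F F2 w FE.
by rewrite /sd_diff_op FE (sd_rel bb w FE) raddfB.
Qed.

Section subdivision_homotopy.
Context (D : Type) (b : D -> seq D -> D) (E : zmodType).

Lemma sdh_natural : op_natural (sdh b).
Proof. by apply: sdh_rel => x w; rewrite map_id. Qed.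

Lemma sdhP (F : seq D -> E) w :
  tdiff w (sdh b F) + sdh b (fun u => tdiff u F) w = F w - sd b F w.
Proof.
apply: hopP.
- move=> E1 E2 th F1 F2 u FE; rewrite /sd_diff_op raddfB FE.
  by rewrite (sd_rel (b := b) (b2 := b) _ u FE) // => x v; rewrite map_id.
- by move=> E1 F1; rewrite /sd_diff_op /sd subrr.
- by move=> E1 F1 u; rewrite /sd_diff_op tdiffB sd_diff.
Qed.

Definition sdh_sum N (F : seq D -> E) w :=
  \sum_(i < N) sdh b (iter i (@sd _ b E) F) w.

(** A telescoping sum: the [i]-th summand joins the [i]-th subdivision to the next one, and the
    terms containing the coboundary of [F] disappear because [F] is a cocycle. *)
Lemma sdh_sumP N (F : seq D -> E) w : (forall u, tdiff u F = 0) ->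
  tdiff w (sdh_sum N F) = F w - iter N (@sd _ b E) F w.
Proof.
move=> F0; elim: N => [|N IH].
  by rewrite subrr; under eq_tdiff do rewrite /sdh_sum big_ord0; rewrite tdiff0.
under eq_tdiff => u _ do rewrite /sdh_sum big_ord_recr /=.
rewrite tdiffD IH.
have := sdhP (iter N (@sd _ b E) F) w.
rewrite [X in _ + X](_ : _ = 0) ?addr0 => [->|].
  by rewrite addrA subrK.
rewrite (op_ext sdh_natural (G := fun=> 0)) ?(op0 sdh_natural) // => u.
by rewrite iter_sd_diff iter_sd0.
Qed.

Lemma sdh_sum_stable N M (F : seq D -> E) w : (N <= M)%N ->
  (forall i, (N <= i)%N -> forall u, iter i (@sd _ b E) F u = 0) ->
  sdh_sum M F w = sdh_sum N F w.
Proof.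
move=> NM F0; rewrite /sdh_sum -!(big_mkord xpredT (fun i => sdh b (iter i (@sd _ b E) F) w)).
rewrite (big_cat_nat (n := N)) //= [X in _ + X]big_nat_cond [X in _ + X]big1 ?addr0 //.
move=> i /andP[/andP[Ni _] _].
by rewrite (op_ext sdh_natural (G := fun=> 0)) ?(op0 sdh_natural) // => u; rewrite F0.
Qed.
End subdivision_homotopy.

Lemma sdh_sum_rel D D2 (phi : D -> D2) b b2 N (E E2 : zmodType)
    (th : {additive E -> E2}) (F : seq D -> E) (F2 : seq D2 -> E2) w :
  (forall x w, b2 (phi x) (map phi w) = phi (b x w)) ->
  (forall u, F2 (map phi u) = th (F u)) ->
  sdh_sum b2 N F2 (map phi w) = th (sdh_sum b N F w).
Proof.
move=> bb FE; rewrite /sdh_sum raddf_sum; apply: eq_bigr => i _.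
apply: sdh_rel => // {w}u; elim: (i : nat) u => //= {}i IH u.
exact: sd_rel.
Qed.

Section prism.
Context (D I : Type) (i0 i1 : I).

Definition prism_ends : operator (D * I) D := fun E F w =>
  F [seq (x, i1) | x <- w] - F [seq (x, i0) | x <- w].

(** The cone point depends only on the first entry and the initial end, so the operator commutes
    with arbitrary maps of points. Compared with the usual triangulated prism there are extra terms
    on tuples with repeated entries; they are harmless, since only formal properties of the operator
    are used. *)
Definition prism : operator (D * I) D := hop prism_ends (fun x _ => (x, i0)).

Lemma tdiff_map A B (E : zmodType) (f : A -> B) (F : seq B -> E) w :
  tdiff w (fun u => F (map f u)) = tdiff (map f w) F.
Proof. by elim: w F => //= x w IH F; rewrite !tdiff_cons (IH (fun u => F (f x :: u))). Qed.

Lemma prism_ends_natural : op_natural prism_ends.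
Proof.
by move=> E E2 th F F2 w FE; rewrite /prism_ends !map_id -[X in F2 X - _]map_id
  -[X in _ - F2 X]map_id !FE raddfB.
Qed.

Lemma prismP (E : zmodType) (F : seq (D * I) -> E) w :
  tdiff w (prism F) + prism (fun u => tdiff u F) w =
  F [seq (x, i1) | x <- w] - F [seq (x, i0) | x <- w].
Proof.
apply: (hopP (L := prism_ends)).
- exact: prism_ends_natural.
- by move=> E1 F1; rewrite /prism_ends subrr.
- by move=> E1 F1 u; rewrite /prism_ends tdiffB !tdiff_map.
Qed.
End prism.

Lemma prism_rel D D2 I (i0 i1 : I) (phi : D -> D2) :
  op_rel (fun z => (phi z.1, z.2)) phi (@prism D I i0 i1) (@prism D2 I i0 i1).
Proof.
apply: hop_rel => // E E2 th F F2 w FE; rewrite /prism_ends raddfB -!FE.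
by rewrite -!map_comp.
Qed.

Lemma prism_natural D I (i0 i1 : I) : op_natural (@prism D I i0 i1).
Proof. by apply: hop_natural; exact: prism_ends_natural. Qed.

(** * Convex spaces *)

Section convex_spaces.
Context (R : realType).
Local Notation I := (interval01 R).

(* A convex subset of a normed module, known through its inclusion [cs_val]. *)
Record cspace := CSpace {
  cs_sort :> topologicalType;
  cs_vec : normedModType R;
  cs_val : cs_sort -> cs_vec;
  cs_val_inj : injective cs_val;
  cs_val_continuous : continuous cs_val;
  cs_continuous : forall (T : topologicalType) (f : T -> cs_sort),
    continuous (fun x => cs_val (f x)) -> continuous f;
  cs_lin : forall m (w : nat -> cs_sort) (t : simplex R m), cs_sort;
  cs_linE : forall m w (t : simplex R m),
    cs_val (cs_lin w t) = \sum_(i < m.+1) val t ord0 i *: cs_val (w i) }.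

Section theory.
Context (C : cspace).
Implicit Types (w : nat -> C).

Lemma lin_continuous m w : continuous (@cs_lin C m w).
Proof.
apply: cs_continuous; under eq_fun do rewrite cs_linE.
apply: continuous_big => [|i _]; first exact: add_continuous.
have c : continuous (fun x : simplex R m => val x ord0 i).
  refine (comp_continuous (f := fun x : simplex R m => val x) _ (@coord_continuous _ _ _ _ _)).
  exact: val_continuous.
refine (comp_continuous (g := fun r : R => r *: cs_val (w i)) c _) => r.
by apply: cvgZr_tmp; exact: cvg_id.
Qed.

Definition lin m w : continuousType (simplex R m) C := mkcts (@lin_continuous m w).

Lemma linE m w t : cs_val (lin m w t) = \sum_(i < m.+1) val t ord0 i *: cs_val (w i).
Proof. exact: cs_linE. Qed.

Lemma eq_lin m w w' t : (forall i, (i <= m)%N -> w i = w' i) -> lin m w t = lin m w' t.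
Proof.
move=> ww; apply: cs_val_inj; rewrite !linE; apply: eq_bigr => i _.
by rewrite ww // -ltnS.
Qed.

Lemma lin_face m w j t :
  lin m.+1 w (face R j t) = lin m (fun i => w (bump j i)) t.
Proof.
apply: cs_val_inj; rewrite !linE (bigD1_ord j) //= mxE unlift_none scale0r add0r.
by apply: eq_bigr => i _; rewrite mxE liftK.
Qed.

Definition seg_fun (a b : C) (t : I) : C := lin 1 (fun i => if i is 0%N then a else b) (edge 0 t).

Lemma seg_funE a b t : cs_val (seg_fun a b t) = (1 - val t) *: cs_val a + val t *: cs_val b.
Proof.
rewrite linE big_ord_recr big_ord1 /= /mkcts /edge_row !mxE /=.
by rewrite !mulr1 !mulr0 addr0 add0r.
Qed.

Lemma seg_fun_continuous (T : topologicalType) (f g : T -> C) (h : T -> I) :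
  continuous f -> continuous g -> continuous h ->
  continuous (fun x => seg_fun (f x) (g x) (h x)).
Proof.
move=> cf cg ch; apply: cs_continuous; under eq_fun do rewrite seg_funE.
have ch' : continuous (fun x => val (h x)) by exact (comp_continuous ch val_continuous).
have cf' : continuous (fun x => cs_val (f x)) by exact (comp_continuous cf (@cs_val_continuous C)).
have cg' : continuous (fun x => cs_val (g x)) by exact (comp_continuous cg (@cs_val_continuous C)).
move=> x; apply: cvgD; last by apply: cvgZ; [exact: ch'|exact: cg'].
apply: cvgZ; last exact: cf'.
by apply: cvgB; [exact: cvg_cst|exact: ch'].
Qed.

Lemma seg_zero a b : seg_fun a b zero = a.
Proof. by apply: cs_val_inj; rewrite seg_funE /= subr0 scale1r scale0r addr0. Qed.

Lemma seg_one a b : seg_fun a b one = b.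
Proof. by apply: cs_val_inj; rewrite seg_funE /= subrr scale1r scale0r add0r. Qed.

Lemma seg_cst a t : seg_fun a a t = a.
Proof. by apply: cs_val_inj; rewrite seg_funE -scalerDl subrK scale1r. Qed.

Definition seg a b : {path I from a to b in C} :=
  mk_path (seg_fun_continuous (@cst_continuous I C a) (@cst_continuous I C b)
    (fun x => cvg_id)) (seg_zero a b) (seg_one a b).

(* Convex spaces are simply connected. *)
Lemma lift_pclass (Y : topologicalType) (s : C -> Y) x y
    (p q : {path I from x to y in Y}) (p' q' : I -> C) :
  continuous s -> continuous p' -> continuous q' ->
  (forall t, p t = s (p' t)) -> (forall t, q t = s (q' t)) ->
  p' zero = q' zero -> p' one = q' one -> pclass p = pclass q.
Proof.
move=> cs cp cq ps qs e0 e1; apply/eqP/pclassP.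
have c1 : continuous (fst : I * I -> I) by move=> u; exact: cvg_fst.
have c2 : continuous (snd : I * I -> I) by move=> u; exact: cvg_snd.
have ch : continuous (fun u : I * I => s (seg_fun (p' u.1) (q' u.1) u.2)).
  refine (comp_continuous _ cs); apply: seg_fun_continuous => //.
    exact (comp_continuous c1 cp).
  exact (comp_continuous c1 cq).
exists (mkcts ch); rewrite /mkcts; split=> [t|t|t u /=].
- by rewrite -[LHS]/(s (seg_fun (p' t) (q' t) zero)) seg_zero -ps.
- by rewrite -[LHS]/(s (seg_fun (p' t) (q' t) one)) seg_one -qs.
- by move=> tA; rewrite -[LHS]/(s (seg_fun (p' t) (q' t) u)) ps; case: tA => ->; rewrite ?e0 ?e1 seg_cst.
Qed.
End theory.

Program Definition simplex_cspace n : cspace :=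
  @CSpace (simplex R n) 'rV[R]_n.+1 (fun x => val x) _ _ _
   (fun m w t => @simplex_of R n (\sum_(i < m.+1) val t ord0 i *: val (w i)) _) _.
Next Obligation. by move=> n; exact: val_inj. Qed.
Next Obligation. by move=> n; exact: val_continuous. Qed.
Next Obligation. by move=> n T f cf; exact: subtype_continuous. Qed.
Next Obligation.
move=> n m w t; have /set_mem[t0 t1] := valP t; split=> [i|].
  rewrite summxE sumr_ge0 // => j _; rewrite mxE mulr_ge0 //.
  by have /set_mem[] := valP (w j).
under eq_bigr do rewrite summxE.
rewrite exchange_big -[RHS]t1; apply: eq_bigr => j _.
under eq_bigr do rewrite mxE.
by rewrite -mulr_sumr; have /set_mem[_ ->] := valP (w j); rewrite mulr1.
Qed.
Next Obligation. by []. Qed.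

Program Definition interval_cspace : cspace :=
  @CSpace I R (fun x => val x) _ _ _
   (fun m w t => @interval01_of R (\sum_(i < m.+1) val t ord0 i * val (w i)) _) _.
Next Obligation. exact: val_inj. Qed.
Next Obligation. exact: val_continuous. Qed.
Next Obligation. by move=> T f cf; exact: subtype_continuous. Qed.
Next Obligation.
move=> m w t; have /set_mem[t0 t1] := valP t; apply/andP; split.
  rewrite sumr_ge0 // => j _; rewrite mulr_ge0 //.
  by have /set_mem := valP (w j); rewrite /= in_itv => /andP[].
rewrite -[leRHS]t1; apply: ler_sum => j _; rewrite ler_piMr //.
by have /set_mem := valP (w j); rewrite /= in_itv => /andP[].
Qed.
Next Obligation. by []. Qed.

Program Definition prod_cspace (C D : cspace) : cspace :=
  @CSpace (C * D)%type (cs_vec C * cs_vec D)%type (fun x => (cs_val x.1, cs_val x.2)) _ _ _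
   (fun m w t => (cs_lin (fun i => (w i).1) t, cs_lin (fun i => (w i).2) t)) _.
Next Obligation. by move=> C D [a b] [c d] [/cs_val_inj -> /cs_val_inj ->]. Qed.
Next Obligation.
move=> C D; apply: pair_continuous.
  refine (comp_continuous (f := fst) _ (@cs_val_continuous C)); move=> z; exact: cvg_fst.
refine (comp_continuous (f := snd) _ (@cs_val_continuous D)); move=> z; exact: cvg_snd.
Qed.
Next Obligation.
move=> C D T f cf.
have -> : f = fun x => ((f x).1, (f x).2) by apply/funext => x; case: (f x).
apply: pair_continuous; apply: cs_continuous.
  refine (comp_continuous (g := fst) cf _); move=> z; exact: cvg_fst.
refine (comp_continuous (g := snd) cf _); move=> z; exact: cvg_snd.
Qed.
Next Obligation.
move=> C D m w t /=; rewrite !cs_linE.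
by elim/big_rec3: _ => // i x y z _ <-.
Qed.

End convex_spaces.

(** * Evaluation of cochains on affine simplices *)

Lemma size_remove D (w : seq D) j : (j < size w)%N -> size (remove j w) = (size w).-1.
Proof. by move=> jw; rewrite /remove size_cat size_take size_drop jw; lia. Qed.

Lemma nth_remove D (x : D) (w : seq D) j i : (j < size w)%N ->
  nth x (remove j w) i = nth x w (bump j i).
Proof.
move=> jw; rewrite /remove nth_cat size_take jw /bump; case: ltnP => ij /=.
  by rewrite nth_take.
by rewrite nth_drop; congr (nth x w _); lia.
Qed.

Lemma nth_map_default D D' (phi : D -> D') x w i :
  nth (phi x) (map phi w) i = phi (nth x w i).
Proof.
case: (ltnP i (size w)) => iw; first by rewrite (nth_map x).
by rewrite !nth_default ?size_map.
Qed.

Section evaluation.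
Context (R : realType) (Y : topologicalType) (A : local_system R Y).
Local Notation I := (interval01 R).

Lemma ls_map_cast x y z (p : {path I from x to y in Y}) (q : {path I from x to z in Y})
    (e : z = y) (m : A z) : p =1 q ->
  ls_map A (pclass p) (ls_cast e m) = ls_map A (pclass q) m.
Proof. by subst y => /path_eqP ->; rewrite ls_cast_id. Qed.

Section lifts.
Context (C : cspace R) (s : C -> Y) (cs : continuous s).

Lemma ls_map_lift2 x y z (p : {path I from x to y in Y}) (q : {path I from y to z in Y})
    (r : {path I from x to z in Y}) (p' q' r' : I -> C) (m : A z) :
  continuous p' -> continuous q' -> continuous r' ->
  (forall t, p t = s (p' t)) -> (forall t, q t = s (q' t)) -> (forall t, r t = s (r' t)) ->
  p' zero = r' zero -> p' one = q' zero -> q' one = r' one ->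
  ls_map A (pclass p) (ls_map A (pclass q) m) = ls_map A (pclass r) m.
Proof.
move=> cp cq cr ps qs rs e0 e1 e2; rewrite -ls_map_comp path_comp_pclass.
pose P := mk_path cp erefl erefl; pose Q := mk_path cq (esym e1) erefl.
congr (ls_map A _ m); apply: (lift_pclass (p' := concat P Q) (q' := r') cs) => //.
- exact: cts_fun.
- by move=> t; rewrite !concatE; case: ifP; rewrite ?ps ?qs.
- by rewrite path_zero.
- by rewrite path_one.
Qed.

(** Simplices that agree only pointwise have values in fibres over points that are not convertible.
    Comparing the values after transport to a common point [x] avoids casts. *)
Lemma ls_map_cochain m (f : cochain A m) x (u v : continuousType (simplex R m) Y)
    (p : {path I from x to u (vtx0 R m) in Y}) (q : {path I from x to v (vtx0 R m) in Y})
    (p' q' : I -> C) :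
  u =1 v -> continuous p' -> continuous q' ->
  (forall t, p t = s (p' t)) -> (forall t, q t = s (q' t)) ->
  p' zero = q' zero -> p' one = q' one ->
  ls_map A (pclass p) (f u) = ls_map A (pclass q) (f v).
Proof.
move=> /continuousEP uv; subst v => cp cq ps qs e0 e1; congr (ls_map A _ _).
exact: (lift_pclass (p' := p') (q' := q') cs).
Qed.
End lifts.

Section ev.
Context (m : nat) (f : cochain A m) (C : cspace R) (s : continuousType C Y) (d : C).

(* The value of [f] on the affine simplex with vertices [w], composed with [s]
   and transported to the fibre over the base point [s d] (zero unless [w] has
   [m + 1] elements). *)
Definition ev (w : seq C) : A (s d) :=
  if size w == m.+1 then
    ls_map A (pclass (s \o seg d (lin m (nth d w) (vtx0 R m)))) (f (s \o lin m (nth d w)))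
  else 0.

Lemma evE w : size w = m.+1 -> ev w =
  ls_map A (pclass (s \o seg d (lin m (nth d w) (vtx0 R m)))) (f (s \o lin m (nth d w))).
Proof. by move=> mw; rewrite /ev mw eqxx. Qed.

Lemma ev_size w : size w != m.+1 -> ev w = 0.
Proof. by rewrite /ev => /negPf ->. Qed.

Lemma ev_eq0 w : f (s \o lin m (nth d w)) = 0 -> ev w = 0.
Proof. by rewrite /ev => ->; rewrite raddf0; case: ifP. Qed.
End ev.

(** Transport to a single fibre absorbs the twist in the face opposite to the vertex 0: the segment
    to the vertex 0 followed by the edge to the vertex 1 is homotopic to the segment to the vertex
    1, the domain being convex. What remains is the plain alternating sum. *)
Lemma ev_diff m (f : cochain A m) (C : cspace R) (s : continuousType C Y) (d : C) w :
  tdiff w (ev f s d) = ev (coboundary_map f : cochain A m.+1) s d w.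
Proof.
have [mw|mw] := eqVneq (size w) m.+2; last first.
  rewrite ev_size // tdiffE big1 // => j _; rewrite ev_size ?mul0rz //.
  by rewrite size_remove //; apply: contra mw => /eqP; case: j => j /= jw; lia.
rewrite evE // tdiffE mw big_ord_recl /= mulr1z.
rewrite [in RHS]/coboundary_map [RHS]raddfD raddf_sum; congr (_ + _).
  rewrite evE; last by rewrite size_remove mw.
  have rE t : lin m (nth d (remove 0 w)) t = lin m.+1 (nth d w) (face R ord0 t).
    rewrite lin_face; apply: eq_lin => i _; rewrite nth_remove //; lia.
  set q := seg d (lin m (nth d (remove 0 w)) (vtx0 R m)).
  have Q0 : s (q zero) = s d by rewrite path_zero.
  have Q1 : s (q one) = (s \o lin m.+1 (nth d w) \o face R ord0) (vtx0 R m).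
    by rewrite path_one rE.
  (* [Q] is the path [s \o q] with its end point written as the vertex 0 of the face; the two
     descriptions of this point are only propositionally equal. *)
  pose Q := mk_path (comp_continuous (@cts_fun _ _ q) (@cts_fun _ _ s)) Q0 Q1.
  pose P : {path I from s d to s (lin m (nth d (remove 0 w)) (vtx0 R m)) in Y} := s \o q.
  rewrite (ls_map_cochain (@cts_fun _ _ s) f (u := s \o lin m (nth d (remove 0 w)))
    (p := P) (v := s \o lin m.+1 (nth d w) \o face R ord0)
    (q := Q) (p' := q) (q' := q)) //; try exact: cts_fun; last first.
    by move=> t /=; rewrite rE.
  symmetry; apply: (ls_map_lift2 (@cts_fun _ _ s) (p' := seg d (lin m.+1 (nth d w) (vtx0 R m.+1)))
     (q' := lin m.+1 (nth d w) \o @edge R m) (r' := q)) => //; try exact: cts_fun.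
  - by rewrite !path_zero.
  - by rewrite -[RHS]/(lin m.+1 (nth d w) (edge m zero)) edge_zero; exact: path_one.
  - by rewrite -[LHS]/(lin m.+1 (nth d w) (edge m one)) edge_one -rE; symmetry; exact: path_one.
apply: eq_bigr => j _; rewrite [RHS]raddfMz; congr (_ *~ _).
rewrite evE; last by rewrite size_remove mw /bump /=; case: (j) => k /= ?; lia.
have rE t : lin m (nth d (remove (bump 0 j) w)) t =
    lin m.+1 (nth d w) (face R (lift ord0 j) t).
  by rewrite lin_face; apply: eq_lin => i _; rewrite nth_remove // mw /bump; case: (j) => k /= ?; lia.
set q := seg d (lin m (nth d (remove (bump 0 j) w)) (vtx0 R m)).
have Q0 : s (q zero) = s d by rewrite path_zero.
have Q1 : s (q one) = (s \o lin m.+1 (nth d w) \o face R (lift ord0 j)) (vtx0 R m).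
  by rewrite path_one rE.
pose Q := mk_path (comp_continuous (@cts_fun _ _ q) (@cts_fun _ _ s)) Q0 Q1.
pose P : {path I from s d to s (lin m (nth d (remove (bump 0 j) w)) (vtx0 R m)) in Y} := s \o q.
rewrite (ls_map_cochain (@cts_fun _ _ s) f (u := s \o lin m (nth d (remove (bump 0 j) w)))
  (p := P) (v := s \o lin m.+1 (nth d w) \o face R (lift ord0 j))
  (q := Q) (p' := q) (q' := q)) //; try exact: cts_fun; last first.
  by move=> t /=; rewrite rE.
symmetry; apply: ls_map_cast => t /=; rewrite /mk_path /q.
by rewrite rE face_vtx0.
Qed.

Section evaluation_naturality.
Context (m : nat) (f : cochain A m) (C C' : cspace R).
Context (phi : continuousType C' C).
Hypothesis phi_lin : forall k w t, phi (lin k w t) = lin k (fun i => phi (w i)) t.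

(** An affine map of domains carries affine simplices to affine simplices. Only the base point
    changes, which costs a transport along a segment. *)
Lemma ev_nat (s : continuousType C Y) (d : C) (d' : C') w :
  ev f s d (map phi w) = ls_map A (pclass (s \o seg d (phi d'))) (ev f (s \o phi) d' w).
Proof.
have [mw|mw] := eqVneq (size w) m.+1; last by rewrite !ev_size ?size_map ?raddf0.
rewrite !evE ?size_map //.
have E t : lin m (nth d (map phi w)) t = phi (lin m (nth d' w) t).
  rewrite phi_lin; apply: eq_lin => i im; rewrite -(nth_map_default phi d').
  by rewrite (set_nth_default (phi d')) // size_map mw.
set q := seg d (lin m (nth d (map phi w)) (vtx0 R m)).
have Q0 : s (q zero) = s d by rewrite path_zero.
have Q1 : s (q one) = (s \o phi \o lin m (nth d' w)) (vtx0 R m) by rewrite path_one E.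
pose Q := mk_path (comp_continuous (@cts_fun _ _ q) (@cts_fun _ _ s)) Q0 Q1.
pose P : {path I from s d to s (lin m (nth d (map phi w)) (vtx0 R m)) in Y} := s \o q.
rewrite (ls_map_cochain (@cts_fun _ _ s) f (u := s \o lin m (nth d (map phi w)))
  (v := s \o phi \o lin m (nth d' w))
  (p := P) (q := Q) (p' := q) (q' := q)) //; try exact: cts_fun; last first.
  by move=> t /=; rewrite E.
symmetry; apply: (ls_map_lift2 (@cts_fun _ _ s) (p' := seg d (phi d'))
     (q' := phi \o seg d' (lin m (nth d' w) (vtx0 R m))) (r' := q)) => //; try exact: cts_fun.
- by rewrite !path_zero.
- rewrite -[RHS]/(phi (seg d' (lin m (nth d' w) (vtx0 R m)) zero)) path_zero; exact: path_one.
- rewrite -[LHS]/(phi (seg d' (lin m (nth d' w) (vtx0 R m)) one)) path_one -E.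
  by symmetry; exact: path_one.
Qed.
End evaluation_naturality.

End evaluation.

Section evaluation_morphism.
Context (R : realType) (Y Y' : topologicalType).
Context (A : local_system R Y) (A' : local_system R Y').
Context (u : continuousType Y Y').
Local Notation I := (interval01 R).

(** For coefficients that map forward along [u], as the structure maps of an equivariant system do;
    this is the source of all equivariance statements. *)
Lemma ev_push (th : forall x, {additive A x -> A' (u x)}) m (f : cochain A m) (f' : cochain A' m)
    (C : cspace R) (s : continuousType C Y) d w :
  (forall x y (p : {path I from x to y in Y}) a,
    th x (ls_map A (pclass p) a) = ls_map A' (pclass (u \o p)) (th y a)) ->
  (forall t : continuousType (simplex R m) Y, f' (u \o t) = th _ (f t)) ->
  ev f' (u \o s) d w = th _ (ev f s d w).
Proof.
move=> thP ff; rewrite /ev; case: ifP => _; last by rewrite raddf0.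
rewrite thP.
transitivity (ls_map A' (pclass (u \o (s \o seg d (lin m (nth d w) (vtx0 R m)))))
  (f' (u \o (s \o lin m (nth d w))))); last by congr (ls_map A' _ _); exact (ff (s \o lin m (nth d w))).
apply: (ls_map_cochain (C := C) (s := u \o s) _ f'
  (p' := seg d (lin m (nth d w) (vtx0 R m))) (q' := seg d (lin m (nth d w) (vtx0 R m)))) => //;
  exact: cts_fun.
Qed.

(** For coefficients that map back along [u], as in the pullback of cochains. *)
Lemma ev_pull (th : forall x, {additive A' (u x) -> A x}) m (f : cochain A m) (f' : cochain A' m)
    (C : cspace R) (s : continuousType C Y) d w :
  (forall x y (p : {path I from x to y in Y}) a,
    th x (ls_map A' (pclass (u \o p)) a) = ls_map A (pclass p) (th y a)) ->
  (forall t : continuousType (simplex R m) Y, f t = th _ (f' (u \o t))) ->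
  ev f s d w = th _ (ev f' (u \o s) d w).
Proof.
move=> thP ff; rewrite /ev; case: ifP => _; last by rewrite raddf0.
rewrite ff -thP; congr (th _ _).
apply: (ls_map_cochain (C := C) (s := u \o s) _ f'
  (p' := seg d (lin m (nth d w) (vtx0 R m))) (q' := seg d (lin m (nth d w) (vtx0 R m)))) => //;
  exact: cts_fun.
Qed.
End evaluation_morphism.

Section vertices.
Context (R : realType).
Local Notation I := (interval01 R).

Lemma vtx_subproof n (i : 'I_n.+1) : simplex_set (delta_mx ord0 i : 'rV[R]_n.+1).
Proof.
split=> [j|]; first by rewrite mxE ler0n.
rewrite (bigD1 i) //= mxE !eqxx big1 ?addr0 // => j /negPf ij.
by rewrite mxE ij andbF.
Qed.

Definition vtx n (i : nat) : simplex_cspace R n := simplex_of (vtx_subproof (inord i)).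

Definition verts n : seq (simplex_cspace R n) := mkseq (vtx n) n.+1.

Lemma lin_vtx (C : cspace R) n (w : nat -> C) i : (i <= n)%N -> lin n w (vtx n i) = w i.
Proof.
move=> i_n; apply: cs_val_inj; rewrite linE (bigD1 (inord i)) //= big1 ?addr0 => [|j /negPf ij].
  by rewrite mxE !eqxx scale1r inordK.
by rewrite mxE ij andbF scale0r.
Qed.

Lemma lin_verts n d t : lin n (nth d (verts n)) t = t.
Proof.
apply: cs_val_inj; rewrite linE [RHS]row_sum_delta; apply: eq_bigr => i _.
by rewrite nth_mkseq //= inord_val.
Qed.

Lemma map_lin_verts (C : cspace R) n (d : C) (w : seq C) : size w = n.+1 ->
  map (lin n (nth d w)) (verts n) = w.
Proof.
move=> nw; apply: (@eq_from_nth _ d); first by rewrite size_map size_mkseq nw.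
move=> i; rewrite size_map size_mkseq => i_n.
by rewrite (nth_map (vtx0 R n)) ?size_mkseq // nth_mkseq // lin_vtx.
Qed.

Lemma lin_lin (C : cspace R) n (w : nat -> C) k (v : nat -> simplex_cspace R n) t :
  lin n w (lin k v t) = lin k (fun i => lin n w (v i)) t.
Proof.
apply: cs_val_inj; rewrite !linE.
under [RHS]eq_bigr do rewrite linE scaler_sumr.
rewrite exchange_big; apply: eq_bigr => i _; rewrite summxE scaler_suml.
by apply: eq_bigr => j _; rewrite mxE scalerA.
Qed.

(** This brings identities between functions of tuples back to cochains: the affine simplex on the
    vertices is the identity, and the transport runs along a constant path up to homotopy. *)
Lemma ev_verts (Y : topologicalType) (A : local_system R Y) n (f : cochain A n)
    (s : continuousType (simplex_cspace R n) Y) :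
  ev f s (vtx0 R n) (verts n) = f s.
Proof.
rewrite evE ?size_mkseq // -[RHS](@ls_map_id _ _ A) /path_id.
set l := lin n _.
pose P : {path I from s (vtx0 R n) to s (l (vtx0 R n)) in Y} := s \o seg (vtx0 R n : simplex_cspace R n) (l (vtx0 R n)).
pose Q : {path I from s (vtx0 R n) to s (vtx0 R n) in Y} := cst (s (vtx0 R n)).
apply: (@ls_map_cochain _ _ A (simplex_cspace R n) s (@cts_fun _ _ s) n f (s (vtx0 R n))
  (s \o l) s P Q (seg (vtx0 R n : simplex_cspace R n) (l (vtx0 R n))) (cst (vtx0 R n))) => //; try exact: cts_fun.
- by move=> t /=; rewrite lin_verts.
- exact: path_zero.
- by rewrite path_one lin_verts.
Qed.

End vertices.

Lemma coboundary_mapK (R : realType) (Y : topologicalType) (A : local_system R Y) n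
    (f : cochain A n) : coboundary_map (coboundary_map f : cochain A n.+1) = (fun=> 0).
Proof.
apply: functional_extensionality_dep => s.
rewrite -[LHS](ev_verts (coboundary_map (coboundary_map f : cochain A n.+1) : cochain A n.+2)).
rewrite -ev_diff -[RHS](tdiffK (verts R n.+2)
  (ev f (s : continuousType (simplex_cspace R n.+2) Y) (vtx0 R n.+2))).
by apply: eq_tdiff => u _; rewrite ev_diff.
Qed.

(** * The prism operator *)

Section product_maps.
Context (R : realType).
Local Notation I := (interval01 R).

Lemma fst_continuous (T U : topologicalType) : continuous (fst : T * U -> T).
Proof. by move=> x; exact: cvg_fst. Qed.

Lemma snd_continuous (T U : topologicalType) : continuous (snd : T * U -> U).
Proof. by move=> x; exact: cvg_snd. Qed.

Lemma times_id_continuous (T U V : topologicalType) (f : continuousType T U) :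
  continuous (fun z : T * V => (f z.1, z.2)).
Proof.
apply: pair_continuous; last exact: snd_continuous.
exact (comp_continuous (@fst_continuous T V) (@cts_fun _ _ f)).
Qed.

Definition fst_cts (T U : topologicalType) : continuousType (T * U)%type T :=
  mkcts (@fst_continuous T U).

Definition times_id (T U V : topologicalType) (f : continuousType T U) :
  continuousType (T * V)%type (U * V)%type := mkcts (@times_id_continuous T U V f).

Lemma slice_continuous (T U : topologicalType) (t : U) : continuous (fun x : T => (x, t)).
Proof. by apply: pair_continuous; [move=> x; exact: cvg_id|exact: cst_continuous]. Qed.

Definition slice (T U : topologicalType) (t : U) : continuousType T (T * U)%type :=
  mkcts (@slice_continuous T U t).

Definition prism_cspace n := prod_cspace (simplex_cspace R n) (interval_cspace R).

Definition prism_base n : prism_cspace n := (vtx0 R n, zero).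

Section prism_operator.
Context (Y : topologicalType) (A : local_system R Y) (A' : local_system R (Y * I)%type).
Context (th : forall z : Y * I, {additive A' z -> A z.1}).
Hypothesis thP : forall z z' (p : {path I from z to z' in (Y * I)%type}) a,
  th z (ls_map A' (pclass p) a) = ls_map A (pclass (fst_cts Y I \o p)) (th z' a).

Definition cprism_fun n (f : cochain A' n.+1) (s : continuousType (prism_cspace n) (Y * I)%type) :
    A' (s (prism_base n)) :=
  prism (zero : I) one (ev f s (prism_base n)) (verts R n).

Definition cprism n (f : cochain A' n.+1) : cochain A n :=
  fun s => th (s (vtx0 R n), zero)
    (cprism_fun f (times_id I s : continuousType (prism_cspace n) (Y * I)%type)).

Lemma cprism_fun_eq n (f : cochain A' n.+1) x (s s' : continuousType (prism_cspace n) (Y * I)%type)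
    (p : {path I from x to (s (prism_base n)).1 in Y})
    (q : {path I from x to (s' (prism_base n)).1 in Y})
    (C : cspace R) (g : C -> Y) (p' q' : I -> C) :
  s =1 s' -> continuous g -> continuous p' -> continuous q' ->
  (forall t, p t = g (p' t)) -> (forall t, q t = g (q' t)) ->
  p' zero = q' zero -> p' one = q' one ->
  ls_map A (pclass p) (th _ (cprism_fun f s)) = ls_map A (pclass q) (th _ (cprism_fun f s')).
Proof.
move=> /continuousEP e; subst s' => cg cp cq ps qs e0 e1; congr (ls_map A _ _).
exact: (lift_pclass (p' := p') (q' := q') cg).
Qed.

(** The affine map onto the simplex [w] intertwines the prism operators, and the base points differ
    by a segment of a convex domain. Thus [prismP], an identity on tuples, passes to cochains. *)
Lemma ev_cprism k n (f : cochain A' n.+1) (s : continuousType (simplex_cspace R k) Y)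
    (w : seq (simplex_cspace R k)) : size w = n.+1 ->
  ev (cprism f) s (vtx0 R k) w =
  th (s (vtx0 R k), zero) (prism (zero : I) one
    (ev f (times_id I s : continuousType (prism_cspace k) (Y * I)%type) (prism_base k)) w).
Proof.
move=> nw; rewrite evE //; set l : continuousType (simplex_cspace R n) (simplex_cspace R k) := lin n _.
pose phi : continuousType (prism_cspace n) (prism_cspace k) := times_id I l.
pose s1 : continuousType (prism_cspace k) (Y * I)%type := times_id I s.
pose b : prism_cspace k := phi (prism_base n).
rewrite -[w in RHS](map_lin_verts (vtx0 R k : simplex_cspace R k) nw) -/l.
have phiP u : ev f s1 (prism_base k) (map phi u) =
    ls_map A' (pclass (s1 \o seg (prism_base k) b)) (ev f (s1 \o phi) (prism_base n) u).
  apply: ev_nat => j v t.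
  have E : l (lin j (fun i => (v i).1) t) = lin j (fun i => l (v i).1) t by exact: lin_lin.
  by rewrite -[LHS]/(l (lin j (fun i => (v i).1) t), lin j (fun i=>(v i).2) t) E.
rewrite -/s1.
have -> := @prism_rel _ _ _ (zero : I) one l _ _ _ _ _ (verts R n) phiP.
rewrite [RHS]thP.
apply: (cprism_fun_eq f (s := times_id I (s \o l)) (s' := s1 \o phi) (g := s)
  (C := simplex_cspace R k) (p' := seg (vtx0 R k : simplex_cspace R k) (l (vtx0 R n)))
  (q' := fun t => (seg (prism_base k) b t).1)) => //.
- exact: cts_fun.
- exact: cts_fun.
- exact (comp_continuous (@cts_fun _ _ (seg (prism_base k) b)) (@fst_continuous _ _)).
- by rewrite !path_zero.
- by rewrite !path_one.
Qed.

(** The prism over [s] is made of simplices whose first coordinate stays in the image of [s]. *)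
Lemma cprism_eq0 n (f : cochain A' n.+1) (s : continuousType (simplex R n) Y) :
  (forall r : continuousType (simplex R n.+1) (Y * I)%type,
     (forall t, exists u, (r t).1 = s u) -> f r = 0) ->
  cprism f s = 0.
Proof.
move=> f0; rewrite /cprism /cprism_fun.
rewrite [X in th _ X](_ : _ = 0) ?raddf0 //.
rewrite (op_ext (@prism_natural (simplex R n) I zero one) (G := fun=> 0)).
  exact: (op0 (@prism_natural (simplex R n) I zero one)).
move=> w; apply: ev_eq0; apply: f0 => t; rewrite /=; by eexists.
Qed.

Lemma th_cochain_eq n (f : cochain A' n) (u v : continuousType (simplex R n) (Y * I)%type)
    (p : {path I from (v (vtx0 R n)).1 to (u (vtx0 R n)).1 in Y})
    (C : cspace R) (g : C -> Y) (p' : I -> C) c :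
  u =1 v -> continuous g -> continuous p' ->
  (forall t, p t = g (p' t)) -> p' zero = c -> p' one = c ->
  ls_map A (pclass p) (th _ (f u)) = th _ (f v).
Proof.
move=> /continuousEP e; subst v => cg cp ps p0 p1; rewrite -[RHS](@ls_map_id _ _ A) /path_id.
congr (ls_map A _ _).
apply: (lift_pclass (p' := p') (q' := cst c) cg) => //; first exact: cst_continuous.
by move=> t; rewrite -(@path_zero _ _ _ _ p) ps p0.
Qed.

Lemma ev_prism_end n (f : cochain A' n) (s : continuousType (simplex R n) Y) t :
  th _ (ev f (times_id I s : continuousType (prism_cspace n) (Y * I)%type) (prism_base n)
    [seq (x, t) | x <- verts R n]) = th (s (vtx0 R n), t) (f (slice Y t \o s)).
Proof.
rewrite evE; last by rewrite size_map size_mkseq.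
rewrite thP.
set w := [seq _ | x <- _].
have wE (x : simplex R n) : lin n (nth (prism_base n) w) x = (x, t).
  rewrite (eq_lin (w' := fun i => (vtx R n i, t) : prism_cspace n)); last first.
    by move=> i i_n; rewrite (nth_map (vtx0 R n)) ?size_mkseq // nth_mkseq.
  have -> : lin n (fun i => (vtx R n i, t) : prism_cspace n) x =
    (lin n (vtx R n) x, lin n (fun=> t : interval_cspace R) x) by [].
  congr (_, _).
    rewrite -[RHS](lin_verts (vtx0 R n)); apply: eq_lin => i i_n.
    by rewrite nth_mkseq.
  apply: (@cs_val_inj _ (interval_cspace R)); rewrite linE -scaler_suml.
  by have /set_mem[_ ->] := valP x; rewrite scale1r.
set p := seg _ _.
apply: (th_cochain_eq f (C := simplex_cspace R n) (u := times_id I s \o lin n (nth (prism_base n) w))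
  (v := slice Y t \o s) (g := s) (p' := fun u => (p u).1) (c := vtx0 R n)) => //.
- by move=> x; rewrite /= wE.
- exact: cts_fun.
- exact (comp_continuous (@cts_fun _ _ p) (@fst_continuous _ _)).
- by rewrite path_zero.
- by rewrite path_one wE.
Qed.

(** The first term is left as a [tdiff] because for [n = 0] it is not the coboundary of any cochain;
    it is then a value on the empty tuple, which is zero. *)
Lemma prism_formula n (f : cochain A' n) (s : continuousType (simplex R n) Y) :
  th _ (tdiff (verts R n) (prism (zero : I) one
    (ev f (times_id I s : continuousType (prism_cspace n) (Y * I)%type) (prism_base n)))) +
  cprism (coboundary_map f : cochain A' n.+1) s =
  th (s (vtx0 R n), one) (f (slice Y one \o s)) - th (s (vtx0 R n), zero) (f (slice Y zero \o s)).
Proof.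
rewrite -!ev_prism_end -[RHS]raddfB -prismP [RHS]raddfD; congr (_ + _).
rewrite /cprism /cprism_fun; congr (th _ _); symmetry.
apply: (op_ext (@prism_natural (simplex R n) I zero one)) => u; exact: ev_diff.
Qed.

Lemma cprismP n (f : cochain A' n.+1) (s : continuousType (simplex R n.+1) Y) :
  coboundary_map (cprism f) s + cprism (coboundary_map f : cochain A' n.+2) s =
  th (s (vtx0 R n.+1), one) (f (slice Y one \o s)) -
  th (s (vtx0 R n.+1), zero) (f (slice Y zero \o s)).
Proof.
rewrite -prism_formula; congr (_ + _).
rewrite -[LHS](ev_verts (coboundary_map (cprism f) : cochain A n.+1)).
rewrite -ev_diff; set F := prism _ _ _.
transitivity (tdiff (verts R n.+1) (fun u => th (s (vtx0 R n.+1), zero) (F u))).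
  apply: eq_tdiff => u; rewrite size_mkseq => -[un].
  exact: (ev_cprism f (s : continuousType (simplex_cspace R n.+1) Y) un).
rewrite -[X in tdiff X _]map_id; apply: tdiff_rel => u.
by rewrite map_id.
Qed.

Lemma cprismP0 (f : cochain A' 0) (s : continuousType (simplex R 0) Y) :
  cprism (coboundary_map f : cochain A' 1) s =
  th (s (vtx0 R 0), one) (f (slice Y one \o s)) -
  th (s (vtx0 R 0), zero) (f (slice Y zero \o s)).
Proof.
by rewrite -prism_formula [X in th _ X](_ : _ = 0) ?raddf0 ?add0r //; exact: subrr.
Qed.

End prism_operator.

Section prism_naturality.
Context (Y Y2 : topologicalType) (u : continuousType Y Y2).
Context (A : local_system R Y) (A' : local_system R (Y * I)%type).
Context (A2 : local_system R Y2) (A2' : local_system R (Y2 * I)%type).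
Context (th : forall z : Y * I, {additive A' z -> A z.1}).
Context (th2 : forall z : Y2 * I, {additive A2' z -> A2 z.1}).
Context (ph : forall x, {additive A x -> A2 (u x)}).
Context (ph' : forall z, {additive A' z -> A2' (times_id I u z)}).
Hypothesis ph'P : forall z z' (p : {path I from z to z' in (Y * I)%type}) a,
  ph' z (ls_map A' (pclass p) a) = ls_map A2' (pclass (times_id I u \o p)) (ph' z' a).
Hypothesis th_ph : forall z a, th2 (times_id I u z) (ph' z a) = ph z.1 (th z a).

Lemma cprism_push n (f : cochain A' n.+1) (f2 : cochain A2' n.+1) (s : continuousType (simplex R n) Y) :
  (forall r : continuousType (simplex R n.+1) (Y * I)%type, f2 (times_id I u \o r) = ph' _ (f r)) ->
  cprism th2 f2 (u \o s) = ph _ (cprism th f s).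
Proof.
move=> ff; rewrite /cprism.
have irr (g : prism_cspace n -> Y2 * I) (c c' : continuous g) :
    cprism_fun f2 (mkcts c) = cprism_fun f2 (mkcts c') by rewrite (Prop_irrelevance c c').
have := @th_ph (s (vtx0 R n), zero) (cprism_fun f (times_id I s : continuousType (prism_cspace n) (Y * I)%type)).
move=> <-; apply: (congr1 (th2 (times_id I u (s (vtx0 R n), zero)))).
transitivity (cprism_fun f2 (times_id I u \o (times_id I s : continuousType (prism_cspace n) (Y * I)%type))).
  exact: irr.
rewrite /cprism_fun; apply: (op_mor (@prism_natural (simplex R n) I zero one)) => w.
exact (@ev_push R (Y*I)%type (Y2*I)%type A' A2' (times_id I u) ph' n.+1 f f2 (prism_cspace n) (times_id I s) (prism_base n) w ph'P ff).
Qed.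
End prism_naturality.
End product_maps.

(** * Small simplices *)

Section barycenters.
Context (R : realType).

Lemma center_subproof n : simplex_set (const_mx (n.+1%:R^-1) : 'rV[R]_n.+1).
Proof.
split=> [i|]; first by rewrite mxE invr_ge0 ler0n.
under eq_bigr do rewrite mxE.
by rewrite sumr_const card_ord -[LHS]mulr_natl mulfV // pnatr_eq0.
Qed.

Definition center n : simplex R n := simplex_of (center_subproof n).

Definition bary (C : cspace R) (x : C) (w : seq C) : C :=
  lin (size w) (nth x (x :: w)) (center (size w)).

Lemma bary_map (C C' : cspace R) (phi : continuousType C C') x w :
  (forall k v t, phi (lin k v t) = lin k (fun i => phi (v i)) t) ->
  bary (phi x) (map phi w) = phi (bary x w).
Proof.
move=> phi_lin; rewrite /bary phi_lin size_map; apply: eq_lin => i _.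
by rewrite -map_cons nth_map_default.
Qed.

Section mesh.
Context (C : cspace R).
Implicit Types (w u : seq C).

(** The barycenter is at most as far from [c] as the vertices are on average. The hypothesis keeps
    the whole sum because one summand vanishes when [c] is a vertex, and this produces the factor
    $n/(n+1)$. *)
Lemma bary_dist x w (c : cs_vec C) (r : R) :
  \sum_(i < (size w).+1) `|cs_val (nth x (x :: w) i) - c| <= (size w).+1%:R * r ->
  `|cs_val (bary x w) - c| <= r.
Proof.
move=> h; rewrite linE.
have -> : \sum_(i < (size w).+1) val (center (size w)) ord0 i *: cs_val (nth x (x :: w) i) - c =
    (size w).+1%:R^-1 *: \sum_(i < (size w).+1) (cs_val (nth x (x :: w) i) - c).
  rewrite sumrB sumr_const card_ord scalerBr -[c *+ _]scaler_nat scalerA mulVf ?pnatr_eq0 // scale1r.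
  by rewrite scaler_sumr; congr (_ - _); apply: eq_bigr => i _; rewrite mxE.
rewrite normrZ ger0_norm ?invr_ge0 ?ler0n // ler_pdivrMl ?ltr0n //.
exact: le_trans (ler_norm_sum _ _ _) h.
Qed.

Lemma bary_near x w (c : cs_vec C) (r : R) :
  (forall y, y \in x :: w -> `|cs_val y - c| <= r) -> `|cs_val (bary x w) - c| <= r.
Proof.
move=> h; apply: bary_dist; rewrite mulr_natl -[X in _ *+ X]card_ord -sumr_const.
by apply: ler_sum => i _; apply: h; rewrite mem_nth.
Qed.

Lemma mem_remove w j x : x \in remove j w -> x \in w.
Proof.
rewrite mem_cat => /orP[/mem_take //|]; exact: mem_drop.
Qed.

Lemma sd_support_near w u (c : cs_vec C) (r : R) : sd_support (@bary C) w u ->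
  (forall y, y \in w -> `|cs_val y - c| <= r) ->
  forall y, y \in u -> `|cs_val y - c| <= r.
Proof.
elim=> [//|x {}w j {}u jw _ IH h y]; rewrite inE => /orP[/eqP->|]; first exact: bary_near.
by apply: IH => {}y /mem_remove; exact: h.
Qed.

Lemma sd_support_size w u : sd_support (@bary C) w u -> size u = size w.
Proof. by elim=> // x {}w j {}u jw _ /= ->; rewrite size_remove //= -?(ltn_predK jw). Qed.

Definition diam_le w (r : R) := forall x y, x \in w -> y \in w -> `|cs_val x - cs_val y| <= r.

(** The classical mesh estimate. Pairs containing the new barycenter are handled by its distance to
    the vertices and convexity of balls, the other pairs by induction on the face. The bound [n] is
    not tied to the size of [w], so that faces obey the same factor. *)
Lemma sd_support_diam n w u (r : R) : sd_support (@bary C) w u -> (size w <= n.+1)%N ->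
  0 <= r -> diam_le w r -> diam_le u (n%:R / n.+1%:R * r).
Proof.
move=> su; elim: su n => [//|x {}w j {}u jw su IH n wn r0 wr].
have b_w y : y \in x :: w -> `|cs_val (bary x w) - cs_val y| <= n%:R / n.+1%:R * r.
  move=> yw; apply: bary_dist.
  have iw : (index y (x :: w) < (size w).+1)%N by rewrite -[(size w).+1]/(size (x :: w)) index_mem.
  rewrite (bigD1 (Ordinal iw)) //= nth_index // subrr normr0 add0r.
  apply: (@le_trans _ _ (\sum_(i < (size w).+1 | i != Ordinal iw) r)).
    by apply: ler_sum => i _; apply: wr => //; rewrite mem_nth.
  rewrite sumr_const cardC1 card_ord /= -[r *+ _]mulr_natl [leRHS]mulrA ler_wpM2r //.
  rewrite mulrA ler_pdivlMr ?ltr0n // -!natrM ler_nat.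
  by move: wn => /=; nia.
move=> y z; rewrite !inE => /orP[/eqP->|yu] /orP[/eqP->|zu].
- by rewrite subrr normr0 !mulr_ge0 ?invr_ge0 ?ler0n.
- rewrite distrC; apply: (sd_support_near su) zu => v /mem_remove vw.
  by rewrite distrC b_w.
- apply: (sd_support_near su) yu => v /mem_remove vw.
  by rewrite distrC b_w.
- apply: IH yu zu => //; first by rewrite size_remove //=; move: wn => /=; lia.
  by move=> v v' /mem_remove vw /mem_remove vw'; exact: wr.
Qed.

Lemma iter_sd_eq0 (E : zmodType) (F : seq C -> E) n i (r : R) w : 0 <= r ->
  (forall u, size u != n.+1 -> F u = 0) ->
  (forall u, size u = n.+1 -> diam_le u ((n%:R / n.+1%:R) ^+ i * r) -> F u = 0) ->
  diam_le w r -> iter i (@sd _ (@bary C) E) F w = 0.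
Proof.
move=> r0; elim: i F w => [|i IH] F w F0 F1 wr.
  have [/F1|/F0 //] := eqVneq (size w) n.+1.
  by rewrite mul1r; exact.
rewrite iterSr; apply: IH wr => u.
  by move=> un; apply: sd_eq0 => v /sd_support_size uv; apply: F0; rewrite uv.
move=> un ur; apply: sd_eq0 => v uv; apply: F1; first by rewrite (sd_support_size uv).
rewrite exprS -mulrA; apply: (sd_support_diam uv) ur; first by rewrite un.
by rewrite mulr_ge0 // exprn_ge0 // mulr_ge0 ?invr_ge0 ?ler0n.
Qed.

Lemma lin_near n w (r : R) x t : diam_le w r -> size w = n.+1 ->
  `|cs_val (lin n (nth x w) t) - cs_val (nth x w 0)| <= r.
Proof.
move=> wr nw; have /set_mem[t0 t1] := valP t; rewrite linE.
have -> : cs_val (nth x w 0) = \sum_(i < n.+1) val t ord0 i *: cs_val (nth x w 0).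
  by rewrite -scaler_suml t1 scale1r.
rewrite -sumrB; apply: le_trans (ler_norm_sum _ _ _) _.
have -> : r = \sum_(i < n.+1) val t ord0 i * r by rewrite -mulr_suml t1 mul1r.
apply: ler_sum => i _; rewrite -scalerBr normrZ ger0_norm // ler_wpM2l //.
by apply: wr; rewrite mem_nth // nw.
Qed.
End mesh.

Lemma simplex_compact n : compact (@simplex_set R n).
Proof.
have cK : compact [set v : 'rV[R]_n.+1 | forall i, v ord0 i \in `[0, 1]].
  exact: (@rV_compact R n.+1 (fun=> `[0, 1]%classic) (fun=> @segment_compact R 0 1)).
apply: subclosed_compact cK _; last first.
  move=> v [v0 v1] i; rewrite in_itv /= v0 -v1 (bigD1 i) //= lerDl.
  by rewrite sumr_ge0.
have -> : @simplex_set R n =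
    (\bigcap_(i in [set: 'I_n.+1]) ((fun v : 'rV[R]_n.+1 => v ord0 i) @^-1` [set x | 0 <= x])) `&`
    ((fun v : 'rV[R]_n.+1 => \sum_i v ord0 i) @^-1` [set x | x = 1]).
  by apply/seteqP; split=> v [v0 v1]; split=> // i; [move=> _; exact: v0|exact: (v0 i I)].
apply: closedI.
  apply: closed_bigI => i _; apply: (continuous_closedP _).1; last exact: (@closed_ge R 0).
  exact: coord_continuous.
apply: (continuous_closedP _).1; last exact: (@closed_eq R 1).
apply: continuous_big => [|i _]; [exact: add_continuous|exact: coord_continuous].
Qed.

Lemma simplex_bounded n : exists2 M : R, 0 <= M &
  forall w : seq (simplex_cspace R n), diam_le w M.
Proof.
have [M [_ KM]] := compact_bounded (@simplex_compact n).
have h : M < Num.max M 0 + 1 by rewrite (le_lt_trans (y := Num.max M 0)) ?le_max ?lexx // ltrDl.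
exists (2 * (Num.max M 0 + 1)); first by rewrite mulr_ge0 // addr_ge0 // le_max lexx orbT.
move=> w x y _ _; apply: le_trans (ler_normB _ _) _; rewrite mulrDl mul1r lerD //.
  exact/(KM _ h)/set_mem/(valP x).
exact/(KM _ h)/set_mem/(valP y).
Qed.

Lemma lebesgue_number n (Y : topologicalType) (s : continuousType (simplex R n) Y) (U V : set Y) :
  open U -> open V -> (forall y, U y \/ V y) ->
  exists2 e : R, 0 < e & forall x : simplex R n,
    (forall y : simplex R n, `|val y - val x| < e -> U (s y)) \/
    (forall y : simplex R n, `|val y - val x| < e -> V (s y)).
Proof.
move=> oU oV UV.
pose P (e : R) (x : 'rV[R]_n.+1) :=
  (forall y : simplex R n, `|val y - x| < e -> U (s y)) \/
  (forall y : simplex R n, `|val y - x| < e -> V (s y)).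
have nb (W : set Y) (x : simplex R n) : open W -> W (s x) ->
    exists2 d : R, 0 < d & forall y : simplex R n, `|val y - val x| < d -> W (s y).
  move=> oW Wx.
  have [B oB BW] : open (s @^-1` W : set (simplex R n)).
    by apply: open_comp oW => ? _; exact: cts_fun.
  have : nbhs (val x) B.
    by apply: open_nbhs_nbhs; split=> //; rewrite -[B _]/((val @^-1` B) x) BW.
  move=> /nbhs_ballP[d d0 dB]; exists d => // y yd.
  rewrite -[W _]/((s @^-1` W) y) -BW /=; apply: dB.
  by rewrite -ball_normE /= distrC.
(* Compactness relative to the filter of positive radii tending to 0: what holds near each point for
   all small radii holds everywhere for one radius. *)
have /compact_near_coveringP/(_ R (0^'+) P) := @simplex_compact n.
have : forall x, simplex_set x -> \forall x' \near x & e \near 0^'+, P e x'.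
  move=> x Kx; pose sx := simplex_of Kx.
  have [d d0 dP] : exists2 d : R, 0 < d &
      (forall y : simplex R n, `|val y - x| < d -> U (s y)) \/
      (forall y : simplex R n, `|val y - x| < d -> V (s y)).
    by case: (UV (s sx)) => [/(nb _ _ oU)[d d0 h]|/(nb _ _ oV)[d d0 h]]; exists d => //;
      [left|right].
  (* For a center within [d / 2] of [x] and a radius below [d / 2], the ball stays in the ball of
     radius [d] around [x]. *)
  have d2 : 0 < d / 2 by rewrite divr_gt0.
  exists (ball x (d / 2), [set e | e < d / 2]).
    by split; [exact: nbhsx_ballx|exact: nbhs_right_lt].
  move=> [x' e] [/=]; rewrite -ball_normE /= => xx' ed.
  have tri y : `|y - x'| < e -> `|y - x| < d.
    move=> yx'; rewrite (splitr d) (le_lt_trans (ler_distD x' _ _)) // ltrD //.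
      exact: lt_trans ed.
    by rewrite distrC.
  by case: dP => dP; [left|right] => y /tri; exact: dP.
move=> h /(_ _ h) {}h.
have [e [e0 eP]] : exists e : R, 0 < e /\ @simplex_set R n `<=` P e.
  have [e [h1 h2]] := @filter_ex _ _ (at_right_proper_filter (0 : R)) _ (filterI h (nbhs_right_gt 0)).
  by exists e.
exists e => // x; have := eP _ (set_mem (valP x)).
by case=> h1; [left|right] => y yx; apply: h1.
Qed.

Section small_simplices.
Context (Y : topologicalType) (A : local_system R Y) (U V : set Y).
Hypotheses (oU : open U) (oV : open V) (UV : forall y, U y \/ V y).

Definition small_vanishing n (f : cochain A n) := forall s : continuousType (simplex R n) Y,
  (forall t, U (s t)) \/ (forall t, V (s t)) -> f s = 0.

Definition sd_stable n k (f : cochain A n) (s : continuousType (simplex R k) Y) N :=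
  forall i, (N <= i)%N -> forall w,
    iter i (@sd _ (@bary (simplex_cspace R k)) _)
      (ev f (s : continuousType (simplex_cspace R k) Y) (vtx0 R k)) w = 0.

(** The simplices left after many subdivisions have diameter below a Lebesgue number of the cover
    pulled back along [s], so [f] vanishes on them. The number of subdivisions depends on [s] and
    has no common bound. *)
Lemma sd_stable_exists n k (f : cochain A n.+1) (s : continuousType (simplex R k) Y) :
  small_vanishing f -> exists N, sd_stable f s N.
Proof.
move=> f0; have [e e0 se] := lebesgue_number s oU oV UV.
have [M M0 KM] := simplex_bounded k.
pose q : R := n.+1%:R / n.+2%:R.
have q0 : 0 <= q by rewrite mulr_ge0 ?invr_ge0 ?ler0n.
have q1 : q < 1 by rewrite ltr_pdivrMr ?ltr0n // mul1r ltr_nat.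
have : \forall N \near \oo, q ^+ N * M < e.
  have : (fun N => q ^+ N * M) @ \oo --> (0 : R).
    rewrite -[X in _ --> X](mul0r M); apply: cvgM; last exact: cvg_cst.
    by apply: cvg_expr; rewrite ger0_norm.
  by move=> /cvgr_lt; apply.
move=> [N _ NP]; exists N => i Ni w.
apply: (@iter_sd_eq0 (simplex_cspace R k) _ _ n.+1 i M) => //.
  by move=> u un; exact: ev_size.
move=> u un ud; apply: ev_eq0; apply: f0.
have small t : `|val (lin n.+1 (nth (vtx0 R k : simplex_cspace R k) u) t) - val (nth (vtx0 R k) u 0)| < e.
  by apply: le_lt_trans (NP i Ni); exact: (lin_near _ _ ud un).
by case: (se (nth (vtx0 R k) u 0)) => h; [left|right] => t; exact: h.
Qed.

(** The number of subdivisions is chosen separately for each simplex. By [exciseE] every admissible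
    number gives the same value, so this choice does not spoil naturality; 0 is the default when
    there is none. *)
Definition excise n (f : cochain A n.+1) : cochain A n := fun s =>
  sdh_sum (@bary (simplex_cspace R n)) (xget 0%N [set N | sd_stable f s N])
    (ev f (s : continuousType (simplex_cspace R n) Y) (vtx0 R n)) (verts R n).

Lemma exciseE n (f : cochain A n.+1) (s : continuousType (simplex R n) Y) N :
  sd_stable f s N -> excise f s = sdh_sum (@bary (simplex_cspace R n)) N
    (ev f (s : continuousType (simplex_cspace R n) Y) (vtx0 R n)) (verts R n).
Proof.
move=> sN; rewrite /excise; set N' := xget _ _.
have sN' : sd_stable f s N' by exact: (@xgetPex _ 0%N [set N | sd_stable f s N]) (ex_intro _ N sN).
rewrite -(@sdh_sum_stable _ _ _ N (maxn N N')) ?leq_maxl //.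
by rewrite -(@sdh_sum_stable _ _ _ N' (maxn N N')) ?leq_maxr //.
Qed.

(** All simplices obtained by subdividing [s] stay in its image, hence in the same member of the
    cover, and each term vanishes by itself. *)
Lemma excise_small n (f : cochain A n.+1) : small_vanishing f -> small_vanishing (excise f).
Proof.
move=> f0 s sS; rewrite /excise /sdh_sum big1 // => i _.
rewrite (op_ext (@sdh_natural _ _) (G := fun=> 0)) ?(op0 (@sdh_natural _ _)) //.
move=> w; apply: iter_sd0 => u; apply: ev_eq0; apply: f0.
by case: sS => h; [left|right] => t; exact: h.
Qed.

(** The number admissible for [s] need not be the one chosen for the affine simplex [s \o l]; both
    sums are computed with the maximum. *)
Lemma ev_excise n (f : cochain A n.+1) k (s : continuousType (simplex R k) Y) N
    (w : seq (simplex_cspace R k)) : small_vanishing f -> sd_stable f s N -> size w = n.+1 ->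
  ev (excise f) (s : continuousType (simplex_cspace R k) Y) (vtx0 R k) w =
  sdh_sum (@bary (simplex_cspace R k)) N
    (ev f (s : continuousType (simplex_cspace R k) Y) (vtx0 R k)) w.
Proof.
move=> f0 sN nw; rewrite evE //.
set l : continuousType (simplex_cspace R n) (simplex_cspace R k) := lin n _.
have [N' sN'] := sd_stable_exists (s \o l) f0.
pose M := maxn N N'.
rewrite (@exciseE _ _ _ M); last by move=> i iM; apply: sN'; exact: leq_trans (leq_maxr _ _) iM.
rewrite -(@sdh_sum_stable _ _ _ N M) ?leq_maxl //.
rewrite -[w in RHS](map_lin_verts (vtx0 R k : simplex_cspace R k) nw) -/l.
symmetry; apply: sdh_sum_rel.
  by move=> x v; exact (@bary_map _ _ l x v (fun j u t => lin_lin _ u t)).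
move=> u; exact (@ev_nat _ _ _ _ f _ _ l (fun j u t => lin_lin _ u t) s _ _ u).
Qed.

(** By [sdh_sumP] the coboundary is [f] minus its iterated subdivision, and the latter vanishes on
    [s] after enough steps. *)
Lemma exciseP n (f : cochain A n.+1) : small_vanishing f ->
  coboundary_map f = (fun=> 0) -> coboundary_map (excise f) = f.
Proof.
move=> f0 fZ; apply: functional_extensionality_dep => s.
rewrite -[LHS](ev_verts (coboundary_map (excise f) : cochain A n.+1)) -ev_diff.
have [N sN] := sd_stable_exists s f0.
rewrite (@eq_tdiff _ _ _ _ (sdh_sum (@bary (simplex_cspace R n.+1)) N
    (ev f (s : continuousType (simplex_cspace R n.+1) Y) (vtx0 R n.+1)))); last first.
  by move=> u; rewrite size_mkseq => -[un]; rewrite (ev_excise f0 sN un).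
rewrite sdh_sumP; first by rewrite sN // subr0 ev_verts.
move=> u; rewrite ev_diff; apply: ev_eq0.
by rewrite fZ.
Qed.

Lemma excise0 (f : cochain A 0) : small_vanishing f -> f = (fun=> 0).
Proof.
move=> f0; apply: functional_extensionality_dep => s; apply: f0.
have s1 t : s t = s (vtx0 R 0).
  congr (s _); apply/val_inj/rowP => i; rewrite ord1 /= mxE !eqxx.
  by have /set_mem[_] := valP t; rewrite big_ord1.
by case: (UV (s (vtx0 R 0))) => h; [left|right] => t; rewrite s1.
Qed.
End small_simplices.

(** No relation between the two covers is required: they only influence the number of subdivisions,
    and a common number exists. *)
Lemma excise_push (Y Y2 : topologicalType) (u : continuousType Y Y2)
    (A : local_system R Y) (A2 : local_system R Y2) (U V : set Y) (U2 V2 : set Y2)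
    (ph : forall x, {additive A x -> A2 (u x)}) n (f : cochain A n.+1) (f2 : cochain A2 n.+1)
    (s : continuousType (simplex R n) Y) :
  open U -> open V -> (forall y, U y \/ V y) -> small_vanishing U V f ->
  open U2 -> open V2 -> (forall y, U2 y \/ V2 y) -> small_vanishing U2 V2 f2 ->
  (forall x y (p : {path interval01 R from x to y in Y}) a,
    ph x (ls_map A (pclass p) a) = ls_map A2 (pclass (u \o p)) (ph y a)) ->
  (forall t : continuousType (simplex R n.+1) Y, f2 (u \o t) = ph _ (f t)) ->
  excise f2 (u \o s) = ph _ (excise f s).
Proof.
move=> oU oV UV f0 oU2 oV2 UV2 f20 phP ff.
have [N sN] := sd_stable_exists oU oV UV s f0.
have [N2 sN2] := sd_stable_exists oU2 oV2 UV2 (u \o s) f20.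
pose M := maxn N N2.
rewrite (@exciseE _ _ _ f _ M); last by move=> i iM; apply: sN; exact: leq_trans (leq_maxl _ _) iM.
rewrite (@exciseE _ _ _ f2 _ M); last by move=> i iM; apply: sN2; exact: leq_trans (leq_maxr _ _) iM.
rewrite -[X in sdh_sum _ _ _ X = _]map_id; apply: sdh_sum_rel.
  by move=> x w; rewrite map_id.
by move=> w; rewrite map_id; exact: (ev_push (s : continuousType (simplex_cspace R n) Y)).
Qed.
End barycenters.

(** * Diagrams of spaces over the fixed point sets *)

HB.instance Definition _ (R : realType) (Y : topologicalType) (A : local_system R Y)
    (x y : Y) (e : x = y) :=
  GRing.isZmodMorphism.Build (A x) (A y) (ls_cast e) (ls_castB e).

Section casts.
Context (R : realType) (B : topologicalType) (A : local_system R B).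
Local Notation I := (interval01 R).

Lemma ls_cast_map x y x' y' (p : {path I from x to y in B}) (q : {path I from x' to y' in B})
    (ex : x = x') (ey : y = y') (a : A y) : p =1 q ->
  ls_cast ex (ls_map A (pclass p) a) = ls_map A (pclass q) (ls_cast ey a).
Proof. by subst x' y' => /path_eqP ->. Qed.

Lemma ls_cast_trans x y z (e : x = y) (e' : y = z) (e'' : x = z) (a : A x) :
  ls_cast e' (ls_cast e a) = ls_cast e'' a.
Proof. by subst y z; rewrite !ls_cast_id. Qed.

Lemma ls_cast0 x y (e : x = y) : ls_cast e (0 : A x) = 0.
Proof. exact: raddf0. Qed.

Lemma cochain_cast (Y : topologicalType) (q : continuousType Y B) n (f : cochain (ls_pull q A) n)
    (s t : continuousType (simplex R n) Y) (e : q (s (vtx0 R n)) = q (t (vtx0 R n))) :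
  s =1 t -> ls_cast e (f s) = f t.
Proof. by move=> /continuousEP st; subst t; exact: ls_cast_id. Qed.

Lemma coboundaryE (Y : topologicalType) (A' : local_system R Y) n (f : cochain A' n)
    (s : continuousType (simplex R n.+1) Y) :
  coboundary_map f s = tdiff (verts R n.+1)
    (ev f (s : continuousType (simplex_cspace R n.+1) Y) (vtx0 R n.+1)).
Proof. by rewrite ev_diff ev_verts. Qed.

(** Transport in the system pulled back along the identity passes through [path_map idfun], which is
    the identity only propositionally. *)
Lemma coboundary_pull_id n (f : cochain A n) :
  coboundary_map (f : cochain (ls_pull idfun A) n) = coboundary_map f.
Proof.
apply: functional_extensionality_dep => s; rewrite !coboundaryE.
apply: eq_tdiff => u _; rewrite /ev; case: ifP => // _.
rewrite [LHS]/(ls_map A _ _) path_map_pclass; congr (ls_map A (pclass _) _).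
exact/path_eqP.
Qed.
End casts.

Section orbit_spaces.
Context (R : realType) (G : groupType) (B : gspace G) (N : eq_local_system R B).
Local Notation I := (interval01 R).

(* Diagrams of spaces over the fixed point sets of [B]; all coefficients are
   pulled back from [B]. *)
Record ospace := OSpace {
  os :> groupClosed G -> topologicalType;
  oact : forall (H K : groupClosed G) a, subconj a H K -> continuousType (os K) (os H);
  oq : forall H, continuousType (os H) (fixpts B H);
  oqJ : forall H K a (Ha : subconj a H K) x, oq H (oact Ha x) = fix_act B Ha (oq K x) }.

Definition osys (Y : ospace) H : local_system R (Y H) := ls_pull (oq Y H) (N H).

Definition ocochain (Y : ospace) n : zmodType := prodz (fun H => cochain (osys Y H) n).

Definition odiff (Y : ospace) n (f : ocochain Y n) : ocochain Y n.+1 :=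
  fun H => coboundary_map (f H).

Definition equivariant (Y : ospace) n (f : ocochain Y n) :=
  forall (H K : groupClosed G) a (Ha : subconj a H K) (s : continuousType (simplex R n) (Y K)),
    f H (oact Y Ha \o s) = els_map N (oqJ Ha (s (vtx0 R n))) (f K s).

Lemma ocochainP (Y : ospace) n (f g : ocochain Y n) : (forall H s, f H s = g H s) -> f = g.
Proof.
by move=> fg; do 2 apply: functional_extensionality_dep => ?; exact: fg.
Qed.

Lemma ocochain_cast (Y : ospace) n (f : ocochain Y n) H (s t : continuousType (simplex R n) (Y H))
    (e : oq Y H (s (vtx0 R n)) = oq Y H (t (vtx0 R n))) :
  s =1 t -> ls_cast (A := N H) e (f H s) = f H t.
Proof. exact: (cochain_cast (q := oq Y H)). Qed.

Section theory.
Context (Y : ospace).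

Lemma osys_act (H K : groupClosed G) a (Ha : subconj a H K) x y
    (p : {path I from x to y in Y K}) (m : osys Y K y) :
  els_map N (oqJ Ha x) (ls_map (osys Y K) (pclass p) m) =
  ls_map (osys Y H) (pclass (oact Y Ha \o p)) (els_map N (oqJ Ha y) m).
Proof.
rewrite /= !path_map_pclass; apply: els_map_path => t; exact: oqJ.
Qed.

Lemma odiffB n (f g : ocochain Y n) : odiff (f - g) = odiff f - odiff g.
Proof.
apply: functional_extensionality_dep => H.
exact: (@coboundary_map_zmod_morphism R _ (osys Y H) n (f H) (g H)).
Qed.

Lemma odiffK n (f : ocochain Y n) : odiff (odiff f) = 0.
Proof. by apply: functional_extensionality_dep => H; exact: coboundary_mapK. Qed.

Lemma odiff0 n : odiff (0 : ocochain Y n) = 0.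
Proof. by rewrite -[in LHS](subrr (0 : ocochain Y n)) odiffB subrr. Qed.

Lemma odiffN n (f : ocochain Y n) : odiff (- f) = - odiff f.
Proof. by rewrite -sub0r odiffB odiff0 sub0r. Qed.

Lemma odiffD n (f g : ocochain Y n) : odiff (f + g) = odiff f + odiff g.
Proof. by rewrite -[in LHS](opprK g) odiffB odiffN opprK. Qed.

Lemma odiff_equivariant n (f : ocochain Y n) : equivariant f -> equivariant (odiff f).
Proof.
move=> fE H K a Ha s; rewrite /odiff !coboundaryE.
rewrite -[verts R n.+1 in LHS]map_id.
apply: (@tdiff_rel _ _ _ _ id (els_map N (oqJ Ha (s (vtx0 R n.+1))))) => u.
rewrite map_id.
exact (@ev_push R _ _ (osys Y K) (osys Y H) (oact Y Ha) (fun x => els_map N (oqJ Ha x))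
  n (f K) (f H) _ (s : continuousType (simplex_cspace R n.+1) (Y K)) _ u
  (fun x y p m => osys_act Ha p m) (fE H K a Ha)).
Qed.

Lemma equivariant0 n : equivariant (0 : ocochain Y n).
Proof. by move=> H K a Ha s; rewrite [RHS](raddf0 (els_map _ _)). Qed.

Lemma equivariantB n (f g : ocochain Y n) : equivariant f -> equivariant g -> equivariant (f - g).
Proof.
move=> fE gE H K a Ha s.
rewrite -[LHS]/(f H _ - g H _) fE gE.
by rewrite -[RHS]/(els_map N _ (f K s - g K s)) [RHS](raddfB (els_map _ _)).
Qed.

Lemma equivariantN n (f : ocochain Y n) : equivariant f -> equivariant (- f).
Proof. by move=> fE; rewrite -sub0r; apply: equivariantB => //; exact: equivariant0. Qed.

Lemma equivariantD n (f g : ocochain Y n) : equivariant f -> equivariant g -> equivariant (f + g).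
Proof. by move=> fE gE; rewrite -[g]opprK; apply/equivariantB/equivariantN. Qed.

Definition vanish (P : forall H, set (Y H)) n (f : ocochain Y n) :=
  forall H (s : continuousType (simplex R n) (Y H)), (forall t, P H (s t)) -> f H s = 0.

Lemma vanishB P n (f g : ocochain Y n) : vanish P f -> vanish P g -> vanish P (f - g).
Proof.
by move=> f0 g0 H s sP; rewrite -[LHS]/(f H s - g H s) f0 // g0 // subrr.
Qed.

Lemma vanish0 P n : vanish P (0 : ocochain Y n).
Proof. by []. Qed.

Lemma vanishN P n (f : ocochain Y n) : vanish P f -> vanish P (- f).
Proof. by move=> f0; rewrite -sub0r; apply: vanishB => //; exact: vanish0. Qed.

Lemma vanishD P n (f g : ocochain Y n) : vanish P f -> vanish P g -> vanish P (f + g).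
Proof. by move=> f0 g0; rewrite -[g]opprK; apply/vanishB/vanishN. Qed.

Lemma vanish_odiff P n (f : ocochain Y n) : vanish P f -> vanish P (odiff f).
Proof.
move=> f0 H s sP; rewrite /odiff coboundaryE -[RHS](tdiff0 _ (verts R n.+1)).
apply: eq_tdiff => u _; rewrite [LHS]ev_eq0 //; apply: f0 => t; exact: sP.
Qed.

(** The whole simplex is tested: the result agrees with [f] on the simplices inside [P] and is
    extended by zero to all others. *)
Definition ocut (P : forall H, set (Y H)) n (f : ocochain Y n) : ocochain Y n :=
  fun H s => if `[< forall t, P H (s t) >] then f H s else 0.

(** The cup product of the indicator function of [P], a 0-cochain, with [f]; hence only the vertex 0
    is tested. *)
Definition ochi (P : forall H, set (Y H)) n (f : ocochain Y n) : ocochain Y n :=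
  fun H s => if `[< P H (s (vtx0 R n)) >] then f H s else 0.

Definition oinvariant (P : forall H, set (Y H)) :=
  forall (H K : groupClosed G) a (Ha : subconj a H K) x, P H (oact Y Ha x) <-> P K x.

Lemma ocut_equivariant P n (f : ocochain Y n) : oinvariant P -> equivariant f ->
  equivariant (ocut P f).
Proof.
move=> iP fE H K a Ha s; rewrite /ocut.
have -> : `[< forall t, P H ((oact Y Ha \o s) t) >] = `[< forall t, P K (s t) >].
  apply: asbool_equiv_eq; split=> sP t; [apply: (iP H K a Ha (s t)).1|apply: (iP H K a Ha (s t)).2]; exact: sP.
by case: ifP => _; [exact: fE|rewrite [RHS](raddf0 (els_map _ _))].
Qed.

Lemma ochi_equivariant P n (f : ocochain Y n) : oinvariant P -> equivariant f ->
  equivariant (ochi P f).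
Proof.
move=> iP fE H K a Ha s; rewrite /ochi.
have -> : `[< P H ((oact Y Ha \o s) (vtx0 R n)) >] = `[< P K (s (vtx0 R n)) >].
  exact/asbool_equiv_eq/iP.
by case: ifP => _; [exact: fE|rewrite [RHS](raddf0 (els_map _ _))].
Qed.

Lemma ocut_vanish P n (f : ocochain Y n) : vanish P (f - ocut P f).
Proof.
move=> H s sP; rewrite -[LHS]/(f H s - (ocut P f : ocochain Y n) H s) /ocut.
by case: asboolP => // _; rewrite subrr.
Qed.

End theory.

Record ogmap (Y Z : ospace) := OgMap {
  om :> forall H, continuousType (Y H) (Z H);
  omJ : forall (H K : groupClosed G) a (Ha : subconj a H K) x,
    om H (oact Y Ha x) = oact Z Ha (om K x);
  omq : forall H x, oq Z H (om H x) = oq Y H x }.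

Section pullback.
Context (Y Z : ospace) (u : ogmap Y Z).

Definition opull n (f : ocochain Z n) : ocochain Y n :=
  fun H s => ls_cast (A := N H) (omq u (s (vtx0 R n))) (f H (u H \o s)).

Lemma opullB n (f g : ocochain Z n) : opull (f - g) = opull f - opull g.
Proof. by apply: ocochainP => H s; exact (ls_castB (A := N H) (omq u (s (vtx0 R n))) (f H (u H \o s)) (g H (u H \o s))). Qed.

Lemma opull0 n : opull (0 : ocochain Z n) = 0.
Proof. by rewrite -[in LHS](subrr (0 : ocochain Z n)) opullB subrr. Qed.

Lemma opullN n (f : ocochain Z n) : opull (- f) = - opull f.
Proof. by rewrite -sub0r opullB opull0 sub0r. Qed.

Lemma opullD n (f g : ocochain Z n) : opull (f + g) = opull f + opull g.
Proof. by rewrite -[in LHS](opprK g) opullB opullN opprK. Qed.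

Lemma opull_diff n (f : ocochain Z n) : odiff (opull f) = opull (odiff f).
Proof.
apply: ocochainP => H s; rewrite /odiff /opull coboundaryE coboundaryE.
rewrite -[verts R n.+1 in LHS]map_id.
apply: (@tdiff_rel _ _ _ _ id (ls_cast (A := N H) (omq u (s (vtx0 R n.+1))))) => w.
rewrite map_id.
have thP x y (p : {path I from x to y in Y H}) a :
    ls_cast (A := N H) (omq u x) (ls_map (osys Z H) (pclass (u H \o p)) a) =
    ls_map (osys Y H) (pclass p) (ls_cast (A := N H) (omq u y) a).
  rewrite /= !path_map_pclass; apply: ls_cast_map => t; exact: omq.
pose th x : {additive N H (oq Z H (u H x)) -> N H (oq Y H x)} := ls_cast (A := N H) (omq u x).
exact (@ev_pull R _ _ (osys Y H) (osys Z H) (u H) th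
  n ((opull f : ocochain Y n) H) (f H) _ (s : continuousType (simplex_cspace R n.+1) (Y H)) _ w thP (fun t => erefl)).
Qed.

Lemma opull_equivariant n (f : ocochain Z n) : equivariant f -> equivariant (opull f).
Proof.
move=> fE H K a Ha s; rewrite /opull.
have e : oq Z H ((u H \o (oact Y Ha \o s)) (vtx0 R n)) = oq Z H ((oact Z Ha \o (u K \o s)) (vtx0 R n)).
  by rewrite /= omJ.
have -> : f H (u H \o (oact Y Ha \o s)) = ls_cast (A := N H) (esym e) (f H (oact Z Ha \o (u K \o s))).
  by symmetry; apply: ocochain_cast => t; rewrite /= omJ.
rewrite fE; symmetry.
have e2 : oq Z H ((oact Z Ha \o (u K \o s)) (vtx0 R n)) = oq Y H ((oact Y Ha \o s) (vtx0 R n)).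
  by rewrite -e; exact: omq.
rewrite (ls_cast_trans _ _ e2).
exact: els_map_cast.
Qed.

Lemma opull_vanish (P : forall H, set (Y H)) (Q : forall H, set (Z H)) n (f : ocochain Z n) :
  (forall H x, P H x -> Q H (u H x)) -> vanish Q f -> vanish P (opull f).
Proof.
move=> PQ f0 H s sP; rewrite /opull f0; last by move=> t; apply: PQ; exact: sP.
exact (ls_cast0 (N H) (omq u (s (vtx0 R n)))). 
Qed.
End pullback.

Lemma opull_comp (X Y Z : ospace) (u : ogmap X Y) (v : ogmap Y Z) (w : ogmap X Z) n
    (f : ocochain Z n) : (forall H x, v H (u H x) = w H x) -> opull u (opull v f) = opull w f.
Proof.
move=> vuw; apply: ocochainP => H s; rewrite /opull.
have e : oq Z H ((v H \o (u H \o s)) (vtx0 R n)) = oq Z H ((w H \o s) (vtx0 R n)).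
  by rewrite /= vuw.
rewrite -(ocochain_cast f e) ?(ls_cast_trans _ _ (etrans e (omq w _))) //; last first.
  by move=> t /=; rewrite vuw.
Qed.

Lemma opull_id (Y : ospace) (u : ogmap Y Y) n (f : ocochain Y n) H
    (s : continuousType (simplex R n) (Y H)) :
  (forall t, u H (s t) = s t) -> (opull u f : ocochain Y n) H s = f H s.
Proof. move=> uE; exact (@ocochain_cast Y n f H (u H \o s) s (omq u (s (vtx0 R n))) uE). Qed.

End orbit_spaces.

(** * Homotopy invariance and excision for diagrams *)

Section homotopies.
Context (R : realType) (G : groupType) (B : gspace G) (N : eq_local_system R B).
Local Notation I := (interval01 R).
Local Notation ospace := (ospace B).

Lemma oprod_subproof (T : topologicalType) (Y : ospace) (H K : groupClosed G) a
    (Ha : subconj a H K) (x : Y K * T) :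
  (oq Y H \o fst_cts (Y H) T) (times_id T (oact Y Ha) x) =
  fix_act B Ha ((oq Y K \o fst_cts (Y K) T) x).
Proof. exact: oqJ. Qed.

Definition oprod (T : topologicalType) (Y : ospace) : ospace :=
  @OSpace G B (fun H => (Y H * T)%type) (fun H K a Ha => times_id T (oact Y Ha))
    (fun H => oq Y H \o fst_cts (Y H) T) (fun H K a Ha x => oprod_subproof Ha x).

Definition oslice (T : topologicalType) (Y : ospace) (t : T) : ogmap Y (oprod T Y) :=
  @OgMap G B Y (oprod T Y) (fun H => slice (Y H) t) (fun _ _ _ _ _ => erefl) (fun _ _ => erefl).

Definition ofst (T : topologicalType) (Y : ospace) : ogmap (oprod T Y) Y :=
  @OgMap G B (oprod T Y) Y (fun H => fst_cts (Y H) T) (fun _ _ _ _ _ => erefl) (fun _ _ => erefl).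

Local Notation oI := (oprod I).

Section prism.
Context (Y : ospace).

Definition oI_fiber H (z : oI Y H) : {additive osys N (oI Y) H z -> osys N Y H z.1} :=
  (idfun : {additive N H (oq Y H z.1) -> N H (oq Y H z.1)}).

Lemma oI_fiberP H (z z' : oI Y H) (p : {path I from z to z' in oI Y H}) (a : osys N (oI Y) H z') :
  oI_fiber z (ls_map (osys N (oI Y) H) (pclass p) a) =
  ls_map (osys N Y H) (pclass (fst_cts (Y H) I \o p)) (oI_fiber z' a).
Proof.
rewrite /= !path_map_pclass; congr (ls_map _ (pclass _) _).
exact/path_eqP.
Qed.

Definition oprism n (f : ocochain N (oI Y) n.+1) : ocochain N Y n :=
  fun H => cprism (@oI_fiber H) (f H).

Lemma oprism_equivariant n (f : ocochain N (oI Y) n.+1) :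
  equivariant f -> equivariant (oprism f).
Proof.
move=> fE H K a Ha s.
exact (@cprism_push R _ _ (oact Y Ha) (osys N Y K) (osys N (oI Y) K) (osys N Y H)
  (osys N (oI Y) H) (@oI_fiber K) (@oI_fiber H) (fun x => els_map N (oqJ Ha x))
  (fun z => els_map N (oqJ (o := oI Y) Ha z)) (fun z z' p m => osys_act (Y := oI Y) Ha p m)
  (fun z m => congr1 (fun e => els_map N e m) (Prop_irrelevance _ _)) n (f K) (f H) s (fE H K a Ha)).
Qed.

Lemma oprismP n (f : ocochain N (oI Y) n.+1) :
  odiff (oprism f) + oprism (odiff f) = opull (oslice Y one) f - opull (oslice Y zero) f.
Proof.
apply: ocochainP => H s.
exact: (cprismP (@oI_fiberP H) (f H) s).
Qed.

Lemma oprismP0 (f : ocochain N (oI Y) 0) :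
  oprism (odiff f) = opull (oslice Y one) f - opull (oslice Y zero) f.
Proof.
apply: ocochainP => H s.
exact: (cprismP0 (@oI_fiberP H) (f H) s).
Qed.

Lemma oprism_vanish (P : forall H, set (Y H)) n (f : ocochain N (oI Y) n.+1) :
  vanish (Y := oI Y) (fun H (z : Y H * I) => P H z.1) f -> vanish P (oprism f).
Proof.
move=> f0 H s sP; apply: cprism_eq0 => r rs; apply: f0 => t.
by have [u ->] := rs t; exact: sP.
Qed.

Lemma oprism0 n : oprism (0 : ocochain N (oI Y) n.+1) = 0.
Proof. by apply: ocochainP => H s; apply: cprism_eq0. Qed.
End prism.

Section homotopy.
Context (Y Z : ospace) (h : ogmap (oI Y) Z) (h0 h1 : ogmap Y Z).
Hypotheses (h0E : forall H x, h H (x, zero) = h0 H x) (h1E : forall H x, h H (x, one) = h1 H x).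

Lemma ohomotopyP n (f : ocochain N Z n.+1) :
  odiff (oprism (opull h f)) + oprism (opull h (odiff f)) = opull h1 f - opull h0 f.
Proof.
rewrite -opull_diff oprismP (opull_comp (w := h1)) //.
by rewrite (opull_comp (w := h0)).
Qed.

Lemma ohomotopyP0 (f : ocochain N Z 0) :
  oprism (opull h (odiff f)) = opull h1 f - opull h0 f.
Proof.
rewrite -opull_diff oprismP0 (opull_comp (w := h1)) //.
by rewrite (opull_comp (w := h0)).
Qed.

Lemma ohomotopy_equivariant n (f : ocochain N Z n.+1) : equivariant f ->
  equivariant (oprism (opull h f)).
Proof. by move=> fE; apply/oprism_equivariant/opull_equivariant. Qed.

Lemma ohomotopy_vanish (P : forall H, set (Y H)) (Q : forall H, set (Z H)) n
    (f : ocochain N Z n.+1) : (forall H x t, P H x -> Q H (h H (x, t))) -> vanish Q f ->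
  vanish P (oprism (opull h f)).
Proof.
move=> PQ f0; apply: oprism_vanish; apply: opull_vanish f0 => H -[x t] Px.
exact: PQ.
Qed.
End homotopy.

Definition obound (Y : ospace) n : ocochain N Y n -> Prop :=
  match n with
  | 0%N => fun f => f = 0
  | m.+1 => fun f => exists2 g : ocochain N Y m, equivariant g & odiff g = f
  end.

(** The operator [excise] applied at each fixed point set: it is natural, hence equivariant, and it
    keeps the vanishing on [U] and on [V]. In degree 0 every simplex is a point and therefore
    small. *)
Lemma excision (Y : ospace) (U V : forall H, set (Y H)) n (f : ocochain N Y n) :
  (forall H, open (U H)) -> (forall H, open (V H)) -> (forall H x, U H x \/ V H x) ->
  equivariant f -> odiff f = 0 -> vanish U f -> vanish V f ->
  match n return ocochain N Y n -> Prop with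
  | 0%N => fun f => f = 0
  | m.+1 => fun f => exists g : ocochain N Y m,
      [/\ equivariant g, odiff g = f, vanish U g & vanish V g]
  end f.
Proof.
move=> oU oV UV + + fU fV.
have fS H : small_vanishing (U H) (V H) (f H : cochain (osys N Y H) n).
  by move=> s [sU|sV]; [exact: fU|exact: fV].
case: n f fS fU fV => [|n] f fS fU fV fE fZ.
  by apply: functional_extensionality_dep => H; exact: excise0 (fS H).
exists (fun H => excise (f H : cochain (osys N Y H) n.+1)); split.
- move=> H K a Ha s.
  exact (@excise_push R _ _ (oact Y Ha) (osys N Y K) (osys N Y H) (U K) (V K) (U H) (V H)
    (fun x => els_map N (oqJ Ha x)) n (f K) (f H) s (oU K) (oV K) (UV K) (fS K)
    (oU H) (oV H) (UV H) (fS H) (fun x y p m => osys_act Ha p m) (fE H K a Ha)).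
- apply: functional_extensionality_dep => H.
  apply: (exciseP (oU H) (oV H) (UV H) (fS H)).
  exact: (congr1 (fun g : ocochain N Y n.+2 => g H) fZ).
- by move=> H s sU; apply: (excise_small (fS H)); left.
- by move=> H s sV; apply: (excise_small (fS H)); right.
Qed.
End homotopies.

(** * The circle and the suspension *)

Lemma continuous_realM (R : realType) (T : topologicalType) (f g : T -> R) :
  continuous f -> continuous g -> continuous (fun x => f x * g x).
Proof. by move=> cf cg x; apply: cvgM; [exact: cf|exact: cg]. Qed.

Lemma continuous_realB (R : realType) (T : topologicalType) (f g : T -> R) :
  continuous f -> continuous g -> continuous (fun x => f x - g x).
Proof. by move=> cf cg x; apply: cvgB; [exact: cf|exact: cg]. Qed.

Lemma continuous_realD (R : realType) (T : topologicalType) (f g : T -> R) :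
  continuous f -> continuous g -> continuous (fun x => f x + g x).
Proof. by move=> cf cg x; apply: cvgD; [exact: cf|exact: cg]. Qed.

Lemma continuous_realV (R : realType) (T : topologicalType) (f : T -> R) :
  (forall x, f x != 0) -> continuous f -> continuous (fun x => (f x)^-1).
Proof. by move=> f0 cf x; apply: cvgV; [exact: f0|exact: cf]. Qed.

(* Coordinates on the circle, rotated so that the base point is (1, 0), and the
   stereographic projection from the base point. *)
Section circle_coordinates.
Context (R : realType) (s0 : circle R).
Implicit Types (z : circle R).

Let b : R * R := val (s0 : set_type (@circle_set R)).
Let pt z : R * R := val (z : set_type (@circle_set R)).

Lemma circle_eq z : (pt z).1 ^+ 2 + (pt z).2 ^+ 2 = 1.
Proof. exact: (set_mem (valP (z : set_type (@circle_set R)))). Qed.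

Let b1 : b.1 ^+ 2 + b.2 ^+ 2 = 1. Proof. exact: circle_eq. Qed.

(** Real and imaginary part of [z] times the conjugate of [s0], in complex notation; [cpoint]
    multiplies back by [s0]. *)
Definition ccos z : R := (pt z).1 * b.1 + (pt z).2 * b.2.
Definition csin z : R := (pt z).2 * b.1 - (pt z).1 * b.2.

Lemma ccos_csin z : ccos z ^+ 2 + csin z ^+ 2 = 1.
Proof.
rewrite /ccos /csin.
transitivity (((pt z).1 ^+ 2 + (pt z).2 ^+ 2) * (b.1 ^+ 2 + b.2 ^+ 2)); first lra.
by rewrite circle_eq b1 mulr1.
Qed.

Lemma cpoint_subproof (c s : R) : c ^+ 2 + s ^+ 2 = 1 ->
  (c * b.1 - s * b.2, c * b.2 + s * b.1) \in @circle_set R.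
Proof.
move=> cs; apply/mem_set; rewrite /circle_set /=.
transitivity ((c ^+ 2 + s ^+ 2) * (b.1 ^+ 2 + b.2 ^+ 2)); first lra.
by rewrite cs b1 mulr1.
Qed.

Definition cpoint (c s : R) (cs : c ^+ 2 + s ^+ 2 = 1) : circle R :=
  exist (fun x => x \in @circle_set R) _ (cpoint_subproof cs).

Lemma ccos_cpoint c s (cs : c ^+ 2 + s ^+ 2 = 1) : ccos (cpoint cs) = c.
Proof.
rewrite /ccos /pt /=.
by transitivity (c * (b.1 ^+ 2 + b.2 ^+ 2)); [lra|rewrite b1 mulr1].
Qed.

Lemma csin_cpoint c s (cs : c ^+ 2 + s ^+ 2 = 1) : csin (cpoint cs) = s.
Proof.
rewrite /csin /pt /=.
by transitivity (s * (b.1 ^+ 2 + b.2 ^+ 2)); [lra|rewrite b1 mulr1].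
Qed.

Lemma circle_ext z z' : ccos z = ccos z' -> csin z = csin z' -> z = z'.
Proof.
move=> cz sz; apply: (@val_inj _ _ (set_type (@circle_set R))).
have E u : pt u = (ccos u * b.1 - csin u * b.2, ccos u * b.2 + csin u * b.1).
  rewrite [LHS]surjective_pairing /ccos /csin; congr (_, _).
    by transitivity ((pt u).1 * (b.1 ^+ 2 + b.2 ^+ 2)); [rewrite b1 mulr1|lra].
  by transitivity ((pt u).2 * (b.1 ^+ 2 + b.2 ^+ 2)); [rewrite b1 mulr1|lra].
by rewrite -/(pt z) -/(pt z') !E cz sz.
Qed.

Lemma ccos0 : ccos s0 = 1. Proof. by rewrite -b1 /ccos !expr2. Qed.
Lemma csin0 : csin s0 = 0. Proof. by rewrite /csin mulrC subrr. Qed.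

Lemma pt_continuous : continuous pt.
Proof. exact: val_continuous. Qed.

Lemma ccos_continuous : continuous ccos.
Proof.
have c1 : continuous (fun z => (pt z).1) by exact (comp_continuous pt_continuous (@fst_continuous R R)).
have c2 : continuous (fun z => (pt z).2) by exact (comp_continuous pt_continuous (@snd_continuous R R)).
by apply: continuous_realD; apply: continuous_realM => //; exact: cst_continuous.
Qed.

Lemma csin_continuous : continuous csin.
Proof.
have c1 : continuous (fun z => (pt z).1) by exact (comp_continuous pt_continuous (@fst_continuous R R)).
have c2 : continuous (fun z => (pt z).2) by exact (comp_continuous pt_continuous (@snd_continuous R R)).
by apply: continuous_realB; apply: continuous_realM => //; exact: cst_continuous.
Qed.

Lemma cpoint_continuous (T : topologicalType) (c s : T -> R)
    (cs : forall x, c x ^+ 2 + s x ^+ 2 = 1) :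
  continuous c -> continuous s -> continuous (fun x => cpoint (cs x)).
Proof.
move=> cc cs'; apply: (@subtype_continuous _ _ (@circle_set R)) => /=.
apply: pair_continuous; [apply: continuous_realB|apply: continuous_realD]; apply: continuous_realM => //;
  exact: cst_continuous.
Qed.

Let div_eq (x y u : R) : y != 0 -> x = u * y -> x / y = u.
Proof. by move=> y0 ->; rewrite mulfK. Qed.

Lemma stereo_subproof (t : R) :
  ((t ^+ 2 - 1) / (t ^+ 2 + 1)) ^+ 2 + (2 * t / (t ^+ 2 + 1)) ^+ 2 = 1.
Proof.
have d : t ^+ 2 + 1 != 0 by apply: lt0r_neq0; have := sqr_ge0 t; lra.
by rewrite !expr_div_n -mulrDl; apply: div_eq; [exact: expf_neq0|lra].
Qed.

Definition stereo (t : R) : circle R := cpoint (stereo_subproof t).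

Lemma stereo_den (t : R) : t ^+ 2 + 1 != 0.
Proof. by apply: lt0r_neq0; have := sqr_ge0 t; lra. Qed.

Lemma stereo_continuous : continuous stereo.
Proof.
have c2 : continuous (fun t : R => t ^+ 2) by apply: continuous_realM => x; exact: cvg_id.
have cd : continuous (fun t : R => (t ^+ 2 + 1)^-1).
  apply: continuous_realV; first exact: stereo_den.
  by apply: continuous_realD => //; exact: cst_continuous.
apply: cpoint_continuous; apply: continuous_realM => //.
  by apply: continuous_realB => //; exact: cst_continuous.
by apply: continuous_realM => [|x]; [exact: cst_continuous|exact: cvg_id].
Qed.

Lemma ccos_stereo t : ccos (stereo t) = (t ^+ 2 - 1) / (t ^+ 2 + 1).
Proof. exact: ccos_cpoint. Qed.

Lemma ccos_stereo_lt1 t : ccos (stereo t) < 1.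
Proof. by rewrite ccos_stereo ltr_pdivrMr; have := sqr_ge0 t; lra. Qed.

Lemma ccos_stereo_gt0 t : (0 < ccos (stereo t)) = (t < -1) || (1 < t).
Proof.
rewrite ccos_stereo pmulr_lgt0 ?invr_gt0; last by have := sqr_ge0 t; lra.
apply/idP/orP => [h|]; last by case; nra.
by case: (ltP t (-1)) => [|h1]; [left|right]; nra.
Qed.

Definition unstereo z : R := csin z / (1 - ccos z).

Lemma stereoK t : unstereo (stereo t) = t.
Proof.
rewrite /unstereo ccos_cpoint csin_cpoint.
have d := stereo_den t.
have e : 1 - (t ^+ 2 - 1) / (t ^+ 2 + 1) = 2 / (t ^+ 2 + 1).
  by have := divff d; rewrite !mulrBl !mulrDl; lra.
rewrite e; apply: div_eq; first by rewrite mulf_neq0 ?invr_eq0 // pnatr_eq0.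
by rewrite mulrCA mulrA.
Qed.

Lemma unstereoK z : ccos z < 1 -> stereo (unstereo z) = z.
Proof.
move=> c1; have c0 : 1 - ccos z != 0 by apply: lt0r_neq0; lra.
set k := (1 - ccos z)^-1.
have k0 : 2 * k != 0 by rewrite mulf_neq0 ?invr_eq0 // pnatr_eq0.
have kE : (1 - ccos z) * k = 1 by exact: divff.
have E : unstereo z ^+ 2 = (1 + ccos z) * k.
  rewrite /unstereo expr_div_n; apply: div_eq; first exact: expf_neq0.
  have -> : csin z ^+ 2 = (1 - ccos z) * (1 + ccos z) by have := ccos_csin z; lra.
  by rewrite expr2 mulrACA [k * _]mulrC kE; lra.
have Em : unstereo z ^+ 2 - 1 = ccos z * (2 * k) by rewrite E; lra.
have Ep : unstereo z ^+ 2 + 1 = 2 * k by rewrite E; lra.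
apply: circle_ext; rewrite ?ccos_cpoint ?csin_cpoint ?Em Ep; apply: div_eq => //.
by rewrite /unstereo -/k mulrCA mulrA.
Qed.

Lemma unstereo_continuous z : ccos z < 1 -> {for z, continuous unstereo}.
Proof.
move=> c1; have cs := @csin_continuous z; have cc := @ccos_continuous z.
have cd : continuous (fun z => 1 - ccos z) by apply: continuous_realB; [exact: cst_continuous|exact: ccos_continuous].
apply: cvgM; [exact: nbhs_filter|exact: cs|].
by apply: cvgV; [exact: nbhs_filter|apply: lt0r_neq0; lra|exact: (cd z)].
Qed.

(* Contraction of the arc [0 < ccos] to the base point; on the rest of the
   circle it starts from the reflection into that arc. *)
Lemma arc_contract_subproof z (t : interval01 R) :
  Num.sqrt (1 - ((1 - val t) * csin z) ^+ 2) ^+ 2 + ((1 - val t) * csin z) ^+ 2 = 1.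
Proof.
rewrite sqr_sqrtr ?subrK // exprMn.
have /set_mem := valP t; rewrite /= in_itv /= => /andP[t0 t1].
by have := ccos_csin z; have := sqr_ge0 (ccos z); nra.
Qed.

Definition arc_contract z (t : interval01 R) : circle R := cpoint (arc_contract_subproof z t).

Lemma arc_contract_continuous (T : topologicalType) (f : T -> circle R) (g : T -> interval01 R) :
  continuous f -> continuous g -> continuous (fun x => arc_contract (f x) (g x)).
Proof.
move=> cf cg.
have cs : continuous (fun x => (1 - val (g x)) * csin (f x)).
  apply: continuous_realM; last exact (comp_continuous cf csin_continuous).
  by apply: continuous_realB; [exact: cst_continuous|exact (comp_continuous cg val_continuous)].
apply: cpoint_continuous => //.
refine (comp_continuous (g := Num.sqrt) _ (@sqrt_continuous R)).
apply: continuous_realB; first exact: cst_continuous.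
exact: continuous_realM.
Qed.

Lemma arc_contract0 t : arc_contract s0 t = s0.
Proof.
by apply: circle_ext; rewrite ?ccos_cpoint ?csin_cpoint csin0 ?ccos0 mulr0 // expr0n subr0 sqrtr1.
Qed.

Lemma arc_contract_zero z : 0 < ccos z -> arc_contract z zero = z.
Proof.
move=> c0; apply: circle_ext; rewrite ?ccos_cpoint ?csin_cpoint /= subr0 mul1r //.
by rewrite -(ccos_csin z) addrK sqrtr_sqr gtr0_norm.
Qed.

Lemma arc_contract_one z : arc_contract z one = s0.
Proof.
apply: circle_ext; rewrite ?ccos_cpoint ?csin_cpoint /= subrr mul0r ?csin0 ?ccos0 //.
by rewrite expr0n subr0 sqrtr1.
Qed.

Lemma ccos_arc_contract_gt0 z t : 0 < ccos z -> 0 < ccos (arc_contract z t).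
Proof.
move=> c0; rewrite ccos_cpoint sqrtr_gt0 exprMn.
have /set_mem := valP t; rewrite /= in_itv /= => /andP[t0 t1].
by have := ccos_csin z; nra.
Qed.
End circle_coordinates.

(** * The suspension: retraction to the base and stereographic chart *)

Section suspension_topology.
Context (R : realType) (G : groupType) (X B : gspace G) (p : gmap X B) (s0 : circle R).
Local Notation I := (interval01 R).
Local Notation sum := (susp_sum R X B).
Local Notation S := (susp p s0).
Local Notation spi := (@susp_pi R G X B p s0).

Lemma susp_ind (P : S -> Prop) : (forall x z, P (spi (susp_inl B x z))) ->
  (forall y, P (spi (susp_inr R X y))) -> forall q, P q.
Proof.
move=> Pl Pr q; rewrite -[q](@reprK _ (susp_quot p s0)).
by case: (repr (q : susp_quot p s0)) => -[[x z]|y]; [exact: Pl|exact: Pr].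
Qed.

Definition sum_elim_part (Z : Type) (f : X -> circle R -> Z) (g : B -> Z) (b : bool) :
    susp_part R X B b -> Z :=
  if b return susp_part R X B b -> Z then fun w : X * circle R => f w.1 w.2 else g.

Definition sum_elim (Z : Type) (f : X -> circle R -> Z) (g : B -> Z) (u : sum) : Z :=
  sum_elim_part f g (projT2 u).

Definition susp_elim (Z : Type) (f : X -> circle R -> Z) (g : B -> Z) (q : S) : Z :=
  sum_elim f g (repr (q : susp_quot p s0)).

Section elim.
Context (Z : Type) (f : X -> circle R -> Z) (g : B -> Z).
Hypothesis fg : forall x, f x s0 = g (p x).

Lemma susp_elim_inl x z : susp_elim f g (spi (susp_inl B x z)) = f x z.
Proof. exact: (susp_repr_pi (f := sum_elim f g) fg). Qed.

Lemma susp_elim_inr y : susp_elim f g (spi (susp_inr R X y)) = g y.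
Proof. exact: (susp_repr_pi (f := sum_elim f g) fg). Qed.
End elim.

Lemma susp_elim_continuous (Z : topologicalType) (f : X -> circle R -> Z) (g : B -> Z) :
  (forall x, f x s0 = g (p x)) -> continuous (fun w : X * circle R => f w.1 w.2) ->
  continuous g -> continuous (susp_elim f g : S -> Z).
Proof.
move=> fg cf cg; apply: (susp_lift_continuous (f := sum_elim f g) fg).
by apply: (@sigT_continuous _ _ _ (sum_elim_part f g)) => -[].
Qed.

Lemma spi_continuous : continuous (spi : sum -> S).
Proof. exact: pi_continuous. Qed.

Lemma spi_inl_continuous : continuous (fun w : X * circle R => spi (susp_inl B w.1 w.2) : S).
Proof.
have -> : (fun w : X * circle R => spi (susp_inl B w.1 w.2)) =
    (fun w : X * circle R => spi (existT (susp_part R X B) true w)) by apply/funext => -[].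
refine (comp_continuous (f := fun w : X * circle R => existT (susp_part R X B) true w) _ spi_continuous).
  by apply: (@existT_continuous _ (susp_part R X B) true).
Qed.

Lemma spi_inr_continuous : continuous (fun y : B => spi (susp_inr R X y) : S).
Proof.
refine (comp_continuous (f := fun w : B => existT (susp_part R X B) false w) _ spi_continuous).
  by apply: (@existT_continuous _ (susp_part R X B) false).
Qed.

Definition sheight : S -> R := susp_elim (fun _ z => ccos s0 z) (fun=> 1).

Lemma sheight_inl x z : sheight (spi (susp_inl B x z)) = ccos s0 z.
Proof. by apply: susp_elim_inl => x'; rewrite ccos0. Qed.

Lemma sheight_inr y : sheight (spi (susp_inr R X y)) = 1.
Proof. by apply: susp_elim_inr => x'; rewrite ccos0. Qed.

Lemma sheight_continuous : continuous sheight.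
Proof.
apply: susp_elim_continuous; first by move=> x'; rewrite ccos0.
  exact (comp_continuous (@snd_continuous X (circle R)) (@ccos_continuous R s0)).
exact: cst_continuous.
Qed.

Lemma gact_inl g x z : gact g (spi (susp_inl B x z) : S) = spi (susp_inl B (gact g x) z).
Proof. exact: susp_act_pi. Qed.

Lemma gact_inr g y : gact g (spi (susp_inr R X y) : S) = spi (susp_inr R X (gact g y)).
Proof. exact: susp_act_pi. Qed.

Lemma sheightJ g q : sheight (gact g q) = sheight q.
Proof.
elim/susp_ind: q => [x z|y]; first by rewrite gact_inl !sheight_inl.
by rewrite gact_inr !sheight_inr.
Qed.

(** The coordinates of a point off the base, recovered from its class; they show that the chart is
    injective. *)
Definition soff : S -> option (X * circle R) :=
  susp_elim (fun x z => if ccos s0 z < 1 then Some (x, z) else None) (fun=> None).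

Lemma soff_inl x z : ccos s0 z < 1 -> soff (spi (susp_inl B x z)) = Some (x, z).
Proof. by move=> z1; rewrite /soff susp_elim_inl ?z1 // => x'; rewrite ccos0 ltxx. Qed.

(** Defined on the whole suspension, so that no homotopy on an open subspace has to be considered.
    At time zero it is the identity only where the height is positive, and all uses are restricted
    to simplices there. *)
Definition sretract (q : S) (t : I) : S :=
  susp_elim (fun x z => spi (susp_inl B x (arc_contract s0 z t)) : S) (fun y => spi (susp_inr R X y)) q.

Lemma sretract_inl x z t : sretract (spi (susp_inl B x z)) t = spi (susp_inl B x (arc_contract s0 z t)).
Proof. by apply: susp_elim_inl => x'; rewrite arc_contract0; exact: susp_piE. Qed.

Lemma sretract_inr y t : sretract (spi (susp_inr R X y)) t = spi (susp_inr R X y).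
Proof. by apply: susp_elim_inr => x'; rewrite arc_contract0; exact: susp_piE. Qed.

(* The topology of [S * I] is not known to be a quotient topology; continuity is
   checked on the curried map, where [R] is locally compact. *)
Lemma sretract_continuous : continuous (fun w : S * I => sretract w.1 w.2).
Proof.
pose f (x : X) (z : circle R) : {compact-open, R -> S} :=
  fun t => spi (susp_inl B x (arc_contract s0 z (clamp t))).
pose g (y : B) : {compact-open, R -> S} := fun t => spi (susp_inr R X y).
have fg x : f x s0 = g (p x).
  by apply/funext => t; rewrite /f arc_contract0; exact: susp_piE.
have cf : continuous (fun w : X * circle R => f w.1 w.2).
  have c : continuous (fun w : (X * circle R) * R => spi (susp_inl B w.1.1 (arc_contract s0 w.1.2 (clamp w.2))) : S).
    refine (comp_continuous (f := fun w : (X * circle R) * R => (w.1.1, arc_contract s0 w.1.2 (clamp w.2))) _ spi_inl_continuous).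
    have c1 := @fst_continuous (X * circle R)%type R.
    have c2 := @snd_continuous (X * circle R)%type R.
    apply: pair_continuous; first exact (comp_continuous c1 (@fst_continuous _ _)).
    apply: arc_contract_continuous; first exact (comp_continuous c1 (@snd_continuous _ _)).
    exact (comp_continuous c2 (@clamp_continuous R)).
  exact: (continuous_curry_fun c).
have cg : continuous g.
  have c : continuous (fun w : B * R => spi (susp_inr R X w.1) : S).
    exact (comp_continuous (@fst_continuous _ _) spi_inr_continuous).
  exact: (continuous_curry_fun c).
pose h : S -> {compact-open, R -> S} := susp_elim f g.
have ch : continuous h by exact: susp_elim_continuous.
have hE q t : h q t = sretract q (clamp t).
  elim/susp_ind: q => [x z|y].
    by rewrite sretract_inl /h susp_elim_inl.
  by rewrite sretract_inr /h susp_elim_inr.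
have cu : continuous (uncurry h).
  apply: continuous_uncurry => //; first exact: locally_compactR.
  apply: susp_ind => [x z|y].
    rewrite /h susp_elim_inl // /f.
    refine (comp_continuous (f := fun t : R => (x, arc_contract s0 z (clamp t))) _ spi_inl_continuous).
    apply: pair_continuous; first exact: cst_continuous.
    by apply: arc_contract_continuous; [exact: cst_continuous|exact: clamp_continuous].
  by rewrite /h susp_elim_inr // /g; exact: cst_continuous.
have -> : (fun w : S * I => sretract w.1 w.2) = (fun w => uncurry h (w.1, val w.2)).
  by apply/funext => w; rewrite /uncurry hE clampK.
refine (comp_continuous (f := fun w : S * I => (w.1, val w.2)) _ cu).
apply: pair_continuous; first exact: fst_continuous.
exact (comp_continuous (@snd_continuous _ _) val_continuous).
Qed.

Lemma sretractJ g q t : sretract (gact g q) t = gact g (sretract q t).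
Proof.
elim/susp_ind: q => [x z|y]; first by rewrite gact_inl !sretract_inl gact_inl.
by rewrite gact_inr !sretract_inr gact_inr.
Qed.

Lemma sretract_zero q : 0 < sheight q -> sretract q zero = q.
Proof.
elim/susp_ind: q => [x z|y]; last by rewrite sretract_inr.
by rewrite sheight_inl sretract_inl => /arc_contract_zero ->.
Qed.

Lemma sretract_one q : sretract q one = spi (susp_inr R X (susp_proj p s0 q)).
Proof.
elim/susp_ind: q => [x z|y].
  by rewrite sretract_inl arc_contract_one susp_piE /= /mkcts susp_proj_inl.
by rewrite sretract_inr /= /mkcts susp_proj_inr.
Qed.

Lemma sheight_sretract q t : 0 < sheight q -> 0 < sheight (sretract q t).
Proof.
elim/susp_ind: q => [x z|y]; last by rewrite sretract_inr.
by rewrite sretract_inl !sheight_inl; exact: ccos_arc_contract_gt0.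
Qed.

Lemma susp_proj_sretract q t : susp_proj p s0 (sretract q t) = susp_proj p s0 q.
Proof.
elim/susp_ind: q => [x z|y]; last by rewrite sretract_inr.
by rewrite sretract_inl /= /mkcts !susp_proj_inl.
Qed.

Definition schart (w : X * R) : S := spi (susp_inl B w.1 (stereo s0 w.2)).

Lemma schart_continuous : continuous schart.
Proof.
refine (comp_continuous (f := fun w : X * R => (w.1, stereo s0 w.2)) _ spi_inl_continuous).
apply: pair_continuous; first exact: fst_continuous.
exact (comp_continuous (@snd_continuous _ _) (@stereo_continuous R s0)).
Qed.

Lemma schart_inj : injective schart.
Proof.
move=> [x t] [x' t'] /(congr1 soff); rewrite /schart !soff_inl ?ccos_stereo_lt1 //= => E.
have := congr1 (fun o => if o is Some w then (w.1, unstereo s0 w.2) else (x, t)) E.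
by rewrite /= !stereoK.
Qed.

Lemma schartJ g w : gact g (schart w) = schart (gact g w.1, w.2).
Proof. exact: gact_inl. Qed.

Lemma schart_surj q : sheight q < 1 -> exists w, schart w = q.
Proof.
elim/susp_ind: q => [x z|y]; last by rewrite sheight_inr ltxx.
rewrite sheight_inl => z1; exists (x, unstereo s0 z).
by rewrite /schart /= unstereoK.
Qed.

Lemma sheight_schart w : sheight (schart w) = ccos s0 (stereo s0 w.2).
Proof. exact: sheight_inl. Qed.

Lemma susp_proj_schart w : susp_proj p s0 (schart w) = p w.1.
Proof. exact: susp_proj_inl. Qed.

(** Open rectangles suffice: they make both coordinates of the inverse of the chart continuous,
    which is used to lift simplices. *)
Lemma schart_open (A : set X) (C : set R) : open A -> open C ->
  exists2 O : set S, open O & forall w, O (schart w) <-> A w.1 /\ C w.2.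
Proof.
move=> oA oC.
(* The open set is written as a function to [Prop], so that the eliminator of the suspension defines
   it and gives its preimage in the disjoint union. *)
pose f (x : X) (z : circle R) : Prop := [/\ A x, ccos s0 z < 1 & C (unstereo s0 z)].
have fg x : f x s0 = False by rewrite propeqE /f ccos0 ltxx; split=> [[]|].
exists (susp_elim f (fun=> False)); last first.
  move=> w; rewrite [susp_elim _ _ _]susp_elim_inl // /f stereoK.
  by split=> [[]|[]] //; split=> //; exact: ccos_stereo_lt1.
have : open (spi @^-1` (susp_elim f (fun=> False)) : set sum).
  apply/sigT_openP => -[]; last first.
    rewrite [X in open X](_ : _ = set0); first exact: open0.
    by apply/funext => y; exact: (susp_elim_inr (g := fun=> False) fg).
  rewrite [X in open X](_ : _ = [set w : X * circle R | f w.1 w.2]); last first.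
    by apply/funext => -[x z]; exact: (susp_elim_inl (g := fun=> False) fg).
  rewrite openE => -[x z] [/= Ax z1 Cz].
  have nA : nbhs x A by exact: open_nbhs_nbhs.
  have n1 : nbhs z [set z | ccos s0 z < 1].
    by apply: open_nbhs_nbhs; split=> //; apply: open_comp (@open_lt _ 1) => ? _; exact: ccos_continuous.
  have nC : nbhs z [set z | C (unstereo s0 z)].
    by apply: (unstereo_continuous z1); exact: open_nbhs_nbhs.
  exists (A, [set z | ccos s0 z < 1] `&` [set z | C (unstereo s0 z)]).
    by split=> //; exact: filterI.
  by move=> [x' z'] [/= ? []].
by [].
Qed.

End suspension_topology.

(** * Diagrams of fixed point sets of the suspension and maps between them *)

Section diagrams.
Context (R : realType) (G : groupType) (B : gspace G).
Local Notation I := (interval01 R).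

Definition ofix (Y : gspace G) (q : gmap Y B) : ospace B :=
  @OSpace G B (fixpts Y) (fun H K a Ha => fix_act Y Ha) (gmap_fix q)
    (fun H K a Ha x => gmap_fix_act q Ha x).

Definition obase : ospace B :=
  @OSpace G B (fixpts B) (fun H K a Ha => fix_act B Ha) (fun H => idfun)
    (fun H K a Ha x => erefl).

Definition oproj (Y : gspace G) (q : gmap Y B) : ogmap (ofix q) obase :=
  @OgMap G B (ofix q) obase (gmap_fix q) (fun H K a Ha x => gmap_fix_act q Ha x)
    (fun H x => erefl).

Context (X : gspace G) (p : gmap X B) (s0 : circle R).
Local Notation S := (susp p s0).
Local Notation oX := (ofix p).
Local Notation oS := (ofix (susp_proj p s0)).
Local Notation oW := (oprod R oX).

Definition susp_incl : gmap B S :=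
  @Gmap G B S (mkcts (@spi_inr_continuous R G X B p s0)) (fun g y => esym (gact_inr p s0 g y)).

Lemma oincl_subproof H (y : obase H) : oq oS H (gmap_fix susp_incl H y) = oq obase H y.
Proof. by apply/val_inj; rewrite /= /mkcts susp_proj_inr. Qed.

Definition oincl : ogmap obase oS :=
  @OgMap G B obase oS (gmap_fix susp_incl) (fun H K a Ha x => gmap_fix_act susp_incl Ha x)
    oincl_subproof.

Lemma sretract_fixed H (q : oS H) t : fixed_set S H (sretract (val q) t).
Proof. by move=> h hH; rewrite -sretractJ (set_mem (valP q) h hH). Qed.

Definition oretract_fun H (w : oS H * I) : oS H :=
  exist (fun q => q \in fixed_set S H) (sretract (val w.1) w.2) (mem_set (sretract_fixed w.1 w.2)).

Lemma oretract_continuous H : continuous (@oretract_fun H).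
Proof.
apply: subtype_continuous => /=.
refine (comp_continuous (f := fun w : oS H * I => (val w.1, w.2)) _ (@sretract_continuous R G X B p s0)).
apply: pair_continuous; last exact: snd_continuous.
exact (comp_continuous (@fst_continuous _ _) val_continuous).
Qed.

Lemma oretractJ (H K : groupClosed G) a (Ha : subconj a H K) (w : oprod I oS K) :
  oretract_fun (oact (oprod I oS) Ha w) = oact oS Ha (oretract_fun w).
Proof. by apply/val_inj; rewrite /= /mkcts sretractJ. Qed.

Lemma oretractq H (w : oprod I oS H) : oq oS H (oretract_fun w) = oq (oprod I oS) H w.
Proof. by apply/val_inj; exact: susp_proj_sretract. Qed.

Definition oretract : ogmap (oprod I oS) oS :=
  @OgMap G B (oprod I oS) oS (fun H => mkcts (@oretract_continuous H)) oretractJ oretractq.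

Lemma schart_fixed H (w : oW H) : fixed_set S H (schart p s0 (val w.1, w.2)).
Proof. by move=> h hH; rewrite schartJ /= (set_mem (valP w.1) h hH). Qed.

Definition ochart_fun H (w : oW H) : oS H :=
  exist (fun q => q \in fixed_set S H) (schart p s0 (val w.1, w.2)) (mem_set (schart_fixed w)).

Lemma ochart_continuous H : continuous (@ochart_fun H).
Proof.
apply: subtype_continuous => /=.
refine (comp_continuous (f := fun w : oW H => (val w.1, w.2)) _ (@schart_continuous R G X B p s0)).
apply: pair_continuous; last exact: snd_continuous.
exact (comp_continuous (@fst_continuous _ _) val_continuous).
Qed.

Lemma ochartJ (H K : groupClosed G) a (Ha : subconj a H K) (w : oW K) :
  ochart_fun (oact oW Ha w) = oact oS Ha (ochart_fun w).
Proof. by apply/val_inj; exact: (esym (schartJ p s0 a (val w.1, w.2))). Qed.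

Lemma ochartq H (w : oW H) : oq oS H (ochart_fun w) = oq oW H w.
Proof. by apply/val_inj; exact: susp_proj_schart. Qed.

Definition ochart : ogmap oW oS :=
  @OgMap G B oW oS (fun H => mkcts (@ochart_continuous H)) ochartJ ochartq.

Lemma ochart_inj H : injective (ochart H).
Proof.
move=> w w' /(congr1 val) /schart_inj; case: w w' => [x t] [x' t'] /= [xx ->].
by congr (_, _); apply/val_inj.
Qed.

(** Off the base the chart is onto, and injectivity shows that a lift of a fixed point has a fixed
    first coordinate. Continuity of the lift comes from [schart_open]. *)
Lemma ochart_lift (T : topologicalType) H (s : continuousType T (oS H)) :
  (forall t, sheight (val (s t)) < 1) ->
  exists r : continuousType T (oW H), forall t, ochart H (r t) = s t.
Proof.
move=> sV.
have ex t : exists w : oW H, ochart H w = s t.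
  have [[x c] xE] := schart_surj (sV t).
  have xH : fixed_set X H x.
    move=> h hH.
    have : schart p s0 (gact h x, c) = schart p s0 (x, c).
      by rewrite -[LHS](schartJ p s0 h (x, c)) xE; exact: (set_mem (valP (s t))).
    by move=> /schart_inj [].
  exists (exist (fun x => x \in fixed_set X H) x (mem_set xH), c).
  exact/val_inj.
have [r rE] := choice ex.
have cr : continuous r.
  have -> : r = fun t => ((r t).1, (r t).2) by apply/funext => t; case: (r t).
  have cs : continuous (fun t => val (s t)) by exact (comp_continuous (@cts_fun _ _ s) val_continuous).
  apply: pair_continuous.
    apply: subtype_continuous; apply/continuousP => A oA.
    have [O oO OE] := schart_open p s0 oA (@openT R).
    rewrite [X in open X](_ : _ = (fun t => val (s t)) @^-1` O).
      by move/continuousP: cs; exact.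
    apply/seteqP; split=> t /=; rewrite -rE.
      by move=> At; apply/(OE (val (r t).1, (r t).2)).
    by move=> /(OE (val (r t).1, (r t).2))[].
  apply/continuousP => A oA.
  have [O oO OE] := schart_open p s0 (@openT X) oA.
  rewrite [X in open X](_ : _ = (fun t => val (s t)) @^-1` O).
    by move/continuousP: cs; exact.
  apply/seteqP; split=> t /=; rewrite -rE.
    by move=> At; apply/(OE (val (r t).1, (r t).2)).
  by move=> /(OE (val (r t).1, (r t).2))[].
by exists (mkcts cr).
Qed.

(** The intermediate value theorem along a segment of the simplex. It shows that a simplex of the
    chart lying near the base lies at a single end of the line. *)
Lemma simplex_sides n (f : simplex R n -> R) : continuous f ->
  (forall t, f t < -1 \/ 1 < f t) -> (forall t, f t < -1) \/ (forall t, 1 < f t).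
Proof.
move=> cf f1.
have key a b : f a < -1 -> 1 < f b -> False.
  move=> fa fb; pose g (u : R) := f (seg_fun (a : simplex_cspace R n) b (clamp u)).
  have cg : continuous g.
    refine (comp_continuous (f := fun u => seg_fun (a : simplex_cspace R n) b (clamp u)) _ cf).
    by apply: seg_fun_continuous; [exact: cst_continuous|exact: cst_continuous|exact: clamp_continuous].
  have g0 : g 0 = f a.
    by rewrite /g (_ : clamp 0 = zero :> I) ?(seg_zero (a : simplex_cspace R n)) //; exact: (clampK zero).
  have g1 : g 1 = f b.
    by rewrite /g (_ : clamp 1 = one :> I) ?(seg_one (a : simplex_cspace R n)) //; exact: (clampK one).
  have [c _ gc] : exists2 c, c \in `[0, 1]%R & g c = 0.
    apply: IVT => //; first by apply: continuous_subspaceT; exact: cg.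
    by rewrite g0 g1 ge_min le_max; apply/andP; split; apply/orP; [left|right]; lra.
  by have := f1 (seg_fun (a : simplex_cspace R n) b (clamp c)); rewrite -/(g c) gc => -[]; lra.
case: (f1 (vtx0 R n)) => h; [left|right] => t; case: (f1 t) => // h'.
  by case: (key _ _ h h').
by case: (key _ _ h' h).
Qed.

Lemma osegment_continuous (c : R) (T : topologicalType) (f : T -> R) (g : T -> I) :
  continuous f -> continuous g -> continuous (fun w => (1 - val (g w)) * c + val (g w) * f w).
Proof.
move=> cf cg; have cv : continuous (fun w => val (g w)) by exact (comp_continuous cg val_continuous).
by apply: continuous_realD; apply: continuous_realM => //; [apply: continuous_realB => //|]; exact: cst_continuous.
Qed.

Lemma ocontract_continuous (c : R) H :
  continuous (fun w : oW H * I => (w.1.1, (1 - val w.2) * c + val w.2 * w.1.2) : oW H).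
Proof.
have c1 := @fst_continuous (oW H) I; have c2 := @snd_continuous (oW H) I.
apply: pair_continuous; first exact (comp_continuous c1 (@fst_continuous _ _)).
refine (osegment_continuous (c := c) (f := fun w : oW H * I => w.1.2) (g := snd) _ c2).
exact (comp_continuous c1 (@snd_continuous _ _)).
Qed.

Definition ocontract (c : R) : ogmap (oprod I oW) oW :=
  @OgMap G B (oprod I oW) oW (fun H => mkcts (@ocontract_continuous c H))
    (fun _ _ _ _ _ => erefl) (fun _ _ => erefl).

Lemma ocross_continuous (c d : R) H :
  continuous (fun w : oX H * I => (w.1, (1 - val w.2) * c + val w.2 * d) : oW H).
Proof.
apply: pair_continuous; first exact: fst_continuous.
refine (osegment_continuous (c := c) (f := fun=> d) (g := snd) _ _); first exact: cst_continuous.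
exact: snd_continuous.
Qed.

Definition ocross (c d : R) : ogmap (oprod I oX) oW :=
  @OgMap G B (oprod I oX) oW (fun H => mkcts (@ocross_continuous c d H))
    (fun _ _ _ _ _ => erefl) (fun _ _ => erefl).

End diagrams.

(** * Cochains of the suspension *)

Lemma sub_interchange (V : zmodType) (a b c d : V) : (a - b) - (c - d) = (a - c) - (b - d).
Proof. by rewrite opprD addrACA -opprD. Qed.

Section more_orbit_spaces.
Context (R : realType) (G : groupType) (B : gspace G) (N : eq_local_system R B).

Lemma ls_cast_inj0 (Y : topologicalType) (A : local_system R Y) x y (e : x = y) (a : A x) :
  ls_cast e a = 0 -> a = 0.
Proof. by subst y; rewrite ls_cast_id. Qed.

Lemma opull_eq0 (Y Z : ospace B) (u : ogmap Y Z) n (f : ocochain N Z n) H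
    (r : continuousType (simplex R n) (Y H)) (s : continuousType (simplex R n) (Z H)) :
  (forall t, u H (r t) = s t) -> (opull u f : ocochain N Y n) H r = 0 -> f H s = 0.
Proof.
move=> us h; have f0 : f H (u H \o r) = 0 := @ls_cast_inj0 _ (N H) _ _ (omq u (r (vtx0 R n))) _ h.
have e : oq Z H ((u H \o r) (vtx0 R n)) = oq Z H (s (vtx0 R n)) by rewrite /= us.
rewrite -(ocochain_cast f e) // f0; exact (ls_cast0 (N H) e).
Qed.

Lemma ochiB (Y : ospace B) (P : forall H, set (Y H)) n (f g : ocochain N Y n) :
  ochi P (f - g) = ochi P f - ochi P g.
Proof.
apply: ocochainP => H s; rewrite -[RHS]/((ochi P f : ocochain N Y n) H s - (ochi P g : ocochain N Y n) H s) /ochi.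
by case: ifP => // _; rewrite subrr.
Qed.

Lemma vanishT (Y : ospace B) n (f : ocochain N Y n) : vanish (fun H => setT) f -> f = 0.
Proof. by move=> f0; apply: ocochainP => H s; exact: f0. Qed.

Definition ocomp (X Y Z : ospace B) (u : ogmap X Y) (v : ogmap Y Z) : ogmap X Z.
Proof.
refine (@OgMap G B X Z (fun H => v H \o u H) _ _).
- by move=> H K a Ha x; rewrite /= !omJ.
- by move=> H x; rewrite /= !omq.
Defined.

Lemma obound_diff (Y : ospace B) n (f : ocochain N Y n) : obound f -> odiff f = 0.
Proof.
case: n f => [|n] f /=; first by move=> ->; exact: odiff0.
by move=> [u _ <-]; exact: odiffK.
Qed.

End more_orbit_spaces.

Section suspension_cochains.
Context (R : realType) (G : groupType) (B : gspace G) (N : eq_local_system R B).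
Context (X : gspace G) (p : gmap X B) (s0 : circle R).
Local Notation I := (interval01 R).
Local Notation S := (susp p s0).
Local Notation oX := (ofix p).
Local Notation oS := (ofix (susp_proj p s0)).
Local Notation oW := (oprod R oX).
Local Notation oB := (obase B).
Local Notation incl := (oincl p s0).
Local Notation proj := (oproj (susp_proj p s0)).
Local Notation chart := (ochart p s0).
Local Notation retract := (oretract p s0).

Definition near_base H : set (oS H) := [set q | 0 < sheight (val q)].
Definition off_base H : set (oS H) := [set q | sheight (val q) < 1].
(** The thresholds -1 and 1 are the stereographic coordinates of the two points of the circle at
    height 0 ([ccos_stereo_gt0]); any jump between them could serve for [upper]. *)
Definition below H : set (oW H) := [set w | w.2 < -1].
Definition above H : set (oW H) := [set w | 1 < w.2].
Definition upper H : set (oW H) := [set w | 0 < w.2].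

Lemma sheight_val_continuous H : continuous (fun q : oS H => sheight (val q)).
Proof. exact (comp_continuous val_continuous (@sheight_continuous R G X B p s0)). Qed.

Lemma near_base_open H : open (@near_base H).
Proof. by apply: open_comp (@open_gt _ 0) => ? _; exact: sheight_val_continuous. Qed.

Lemma off_base_open H : open (@off_base H).
Proof. by apply: open_comp (@open_lt _ 1) => ? _; exact: sheight_val_continuous. Qed.

Lemma near_off_cover H q : @near_base H q \/ @off_base H q.
Proof. by rewrite /near_base /off_base /=; case: (ltP 0 (sheight (val q))) => h; [left|right; lra]. Qed.

Lemma chart_off_base H w : off_base (chart H w).
Proof. by rewrite /off_base /= sheight_schart ccos_stereo_lt1. Qed.

Lemma chart_near_base H w : near_base (chart H w) <-> below w \/ above w.
Proof.
rewrite /near_base /below /above /= sheight_schart ccos_stereo_gt0 /=.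
by split=> /orP.
Qed.

Lemma vanish_off n (f : ocochain N oS n) : opull chart f = 0 -> vanish (@off_base) f.
Proof.
move=> f0 H s sV; have [r rE] := ochart_lift sV.
by apply: (opull_eq0 rE); rewrite f0.
Qed.

Lemma chart_vanish n (f : ocochain N oS n) : vanish (@near_base) f ->
  vanish (@below) (opull chart f) /\ vanish (@above) (opull chart f).
Proof.
by move=> f0; split; apply: opull_vanish f0 => H w wP; apply/chart_near_base; [left|right].
Qed.

(** Extension by zero from the chart. On a simplex both off and near the base the two prescriptions
    agree, since its lift lies at one end of the line, where [w] vanishes. Simplices that meet the
    base get the value 0, so the extension of a cocycle need not be a cocycle. *)
Lemma oextend n (w : ocochain N oW n) : equivariant w ->
  vanish (@below) w -> vanish (@above) w ->
  exists f : ocochain N oS n, [/\ equivariant f, opull chart f = w & vanish (@near_base) f].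
Proof.
move=> wE wm wp.
have e H (s : continuousType (simplex R n) (oS H)) (r : continuousType (simplex R n) (oW H)) :
    (forall t, chart H (r t) = s t) -> oq oW H (r (vtx0 R n)) = oq oS H (s (vtx0 R n)).
  by move=> <-; rewrite omq.
pose f : ocochain N oS n := fun H s =>
  match pselect (exists r : continuousType (simplex R n) (oW H), forall t, chart H (r t) = s t) with
  | left ex => ls_cast (A := N H) (e H s _ (projT2 (cid ex))) (w H (projT1 (cid ex)))
  | right _ => 0
  end.
(* The chosen lift is the only one, as the chart is injective. *)
have fE H (s : continuousType (simplex R n) (oS H)) (r : continuousType (simplex R n) (oW H))
    (sr : forall t, chart H (r t) = s t) :
    f H s = ls_cast (A := N H) (e H s r sr) (w H r).
  rewrite /f; case: pselect => [ex|[]]; last by exists r.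
  move: (projT2 (cid ex)); move: (projT1 _) => r' sr'.
  have : r' =1 r by move=> t; apply: (@ochart_inj R G B X p s0 H); rewrite sr sr'.
  by move=> /continuousEP rr; subst r'; rewrite (Prop_irrelevance sr' sr).
exists f; split.
- move=> H K a Ha s.
  have [[r sr]|nr] := pselect (exists r : continuousType (simplex R n) (oW K), forall t, chart K (r t) = s t).
    have sr' t : chart H ((oact oW Ha \o r) t) = (oact oS Ha \o s) t.
      by rewrite [LHS](omJ chart) sr.
    rewrite (fE H (oact oS Ha \o s) _ sr') (fE K s _ sr) wE; symmetry; exact: els_map_cast.
  have -> : f K s = 0 by rewrite /f; case: pselect.
  (* The action preserves the height, so a simplex lifts as soon as one of its translates does. *)
  rewrite [RHS](raddf0 (els_map _ _)) /f; case: pselect => // -[r' sr']; exfalso; apply: nr.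
  apply: ochart_lift => t; have := chart_off_base (r' t).
  by rewrite sr' /off_base /= /mkcts sheightJ.
- apply: ocochainP => H r; rewrite /opull (fE H (chart H \o r) r) //.
  rewrite (ls_cast_trans _ _ (erefl _)); by [].
- move=> H s sU; have [[r sr]|nr] := pselect (exists r : continuousType (simplex R n) (oW H), forall t, chart H (r t) = s t); last by rewrite /f; case: pselect.
  rewrite (fE _ _ _ sr) [X in ls_cast _ X](_ : _ = 0); first exact (ls_cast0 (N H) (e H s r sr)).
  have [h|h] : (forall t, (r t).2 < -1) \/ (forall t, 1 < (r t).2).
    apply: (simplex_sides (f := fun t => (r t).2)).
      exact (comp_continuous (@cts_fun _ _ r) (@snd_continuous _ _)).
    by move=> t; have := sU t; rewrite -sr => /chart_near_base.
  exact: wm.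
exact: wp.
Qed.

End suspension_cochains.

(** * Contractions near the base and along the line *)

Section suspension_cohomology.
Context (R : realType) (G : groupType) (B : gspace G) (N : eq_local_system R B).
Context (X : gspace G) (p : gmap X B) (s0 : circle R).
Local Notation I := (interval01 R).
Local Notation S := (susp p s0).
Local Notation oX := (ofix p).
Local Notation oS := (ofix (susp_proj p s0)).
Local Notation oW := (oprod R oX).
Local Notation oB := (obase B).
Local Notation incl := (oincl p s0).
Local Notation proj := (oproj (susp_proj p s0)).
Local Notation chart := (ochart p s0).
Local Notation retract := (oretract p s0).
Local Notation near_base := (@near_base R G B X p s0).
Local Notation off_base := (@off_base R G B X p s0).
Local Notation below := (@below R G B X p).
Local Notation above := (@above R G B X p).
Local Notation upper := (@upper R G B X p).

Lemma convex_gt (c u t : R) : 0 <= u -> u <= 1 -> c < 2 -> c < t -> c < (1 - u) * 2 + u * t.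
Proof.
move=> u0 u1 c2 ct; have h : 0 <= u * (t - c) by apply: mulr_ge0; lra.
case: (ltrP u 1) => h1; last first.
  have -> : u = 1 by apply/eqP; rewrite eq_le u1 h1.
  by rewrite subrr mul0r add0r mul1r.
have : 0 < (1 - u) * (2 - c) by apply: mulr_gt0; lra.
lra.
Qed.

Lemma above_contract H (w : oW H) (u : I) : above w -> above (ocontract p 2 H (w, u)).
Proof.
case: w => x t; rewrite /above /= /mkcts /= => t1.
have /set_mem := valP u; rewrite /= in_itv /= => /andP[u0 u1].
by apply: convex_gt => //; lra.
Qed.

Lemma below_contract H (w : oW H) (u : I) : below w -> below (ocontract p (-2) H (w, u)).
Proof.
case: w => x t; rewrite /below /= /mkcts /= => t1.
have /set_mem := valP u; rewrite /= in_itv /= => /andP[u0 u1].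
have h : 1 < - t by lra.
have := convex_gt u0 u1 _ h; lra.
Qed.

Lemma below_slice H (x : oX H) : below ((x, -2) : oW H).
Proof. by rewrite /below /=; lra. Qed.

Lemma below_aboveF H (w : oW H) : below w -> above w -> False.
Proof. by rewrite /below /above /=; lra. Qed.

Lemma proj_incl n (f : ocochain N oB n) : opull incl (opull proj f) = f.
Proof.
apply: ocochainP => H s.
rewrite (opull_comp (w := ocomp incl proj)) //; apply: opull_id => t.
by apply/val_inj; rewrite /= /mkcts susp_proj_inr.
Qed.

Lemma near_base_retract H (q : oS H) t : near_base q -> near_base (retract H (q, t)).
Proof. exact: sheight_sretract. Qed.

(* [b] comes from the prism over the contraction of a neighbourhood of the base. *)
Lemma vanish_near_base n (f : ocochain N oS n) : equivariant f -> opull incl f = 0 ->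
  vanish near_base (odiff f) ->
  exists b : ocochain N oS n, [/\ equivariant b, obound b & vanish near_base (f - b)].
Proof.
move=> fE fi dfU.
pose h0 := ocomp (oslice oS (zero : I)) retract.
pose h1 := ocomp (oslice oS (one : I)) retract.
have f1 : opull h1 f = 0.
  rewrite -(opull_comp (u := proj) (v := incl)); last first.
    by move=> H q; apply/val_inj; rewrite /= /mkcts sretract_one.
  by rewrite fi opull0.
have f0 : vanish near_base (f - opull h0 f).
  move=> H s sU; rewrite -[LHS]/(f H s - (opull h0 f : ocochain N oS n) H s).
  rewrite opull_id ?subrr // => t; apply/val_inj; exact: (sretract_zero (sU t)).
have pU m (g : ocochain N oS m.+1) : vanish near_base g ->
    vanish near_base (oprism (opull retract g)).
  by apply: ohomotopy_vanish => H q t; exact: near_base_retract.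
case: n f fE fi dfU f0 f1 => [|n] f fE fi dfU f0 f1.
  exists 0; split; [exact: equivariant0|by []|].
  rewrite subr0 -(subrK (opull h0 f) f); apply: vanishD => //.
  have := @ohomotopyP0 R G B N oS oS retract h0 h1 (fun _ _ => erefl) (fun _ _ => erefl) f.
  by rewrite f1 sub0r -[X in vanish _ X]opprK => <-; apply/vanishN/pU.
exists (- odiff (oprism (opull retract f))); split.
- exact/equivariantN/odiff_equivariant/ohomotopy_equivariant.
- exists (- oprism (opull retract f)); last exact: odiffN.
  exact/equivariantN/ohomotopy_equivariant.
- have := @ohomotopyP R G B N oS oS retract h0 h1 (fun _ _ => erefl) (fun _ _ => erefl) n f.
  set P := odiff _; set Q := oprism _; rewrite f1 sub0r => E.
  have -> : P = - opull h0 f - Q by rewrite -E addrK.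
  by rewrite opprK addrA; apply/vanishB/pU.
Qed.

(* [y'] is [y] minus the coboundary of the prism over the contraction to the
   level 2, cut off to the simplices above. *)
Lemma straighten_above n (y : ocochain N oW n) : equivariant y -> vanish above (odiff y) ->
  exists y' : ocochain N oW n, [/\ equivariant y', odiff y' = odiff y, vanish below (y' - y) &
    vanish above (y' - opull (ofst R oX) (opull (oslice oX (2 : R)) y))].
Proof.
move=> yE dy.
pose h0 := ocomp (ofst R oX) (oslice oX (2 : R)).
have hz H w : ocontract p 2 H (w, zero) = h0 H w.
  by case: w => x t; rewrite /= /mkcts /= subr0 mul1r mul0r addr0.
pose h1 := ocomp (oslice oW (one : I)) (ocontract p 2).
have y1 : opull h1 y = y.
  apply: ocochainP => H s; apply: opull_id => t.
  by rewrite /= /mkcts /= subrr mul0r mul1r add0r; case: (s t).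
have -> : opull (ofst R oX) (opull (oslice oX (2 : R)) y) = opull h0 y by exact: opull_comp.
have pA m (g : ocochain N oW m.+1) : vanish above g ->
    vanish above (oprism (opull (ocontract p 2) g)).
  by apply: ohomotopy_vanish => H w u; exact: above_contract.
case: n y yE dy y1 => [|n] y yE dy y1.
  exists y; split=> //; first by rewrite subrr.
  have := @ohomotopyP0 R G B N oW oW (ocontract p 2) h0 h1 hz (fun _ _ => erefl) y.
  by rewrite y1 => <-; exact: pA.
set P := oprism (opull (ocontract p 2) y).
have PE : equivariant P by exact: ohomotopy_equivariant.
have iA : oinvariant above by [].
exists (y - odiff (ocut above P)); split.
- exact/equivariantB/odiff_equivariant/ocut_equivariant.
- by rewrite odiffB odiffK subr0.
- rewrite addrAC subrr add0r; apply/vanishN/vanish_odiff => H s sB.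
  rewrite /ocut; case: asboolP => // sA.
  by case: (below_aboveF (sB (vtx0 R n)) (sA (vtx0 R n))).
- have := @ohomotopyP R G B N oW oW (ocontract p 2) h0 h1 hz (fun _ _ => erefl) n y.
  rewrite y1 -/P => E.
  rewrite addrAC -E addrAC -odiffB; apply: vanishD; last exact: pA.
  by apply: vanish_odiff; exact: ocut_vanish.
Qed.

(** The contraction to the level -2 joins the identity to a map into the part below, where [z]
    vanishes; its prism is a primitive. As the contraction preserves that part, the primitive
    vanishes there too. In degree 0 the homotopy formula leaves [z = 0]. *)
Lemma primitive_below n (z : ocochain N oW n) : equivariant z -> odiff z = 0 -> vanish below z ->
  match n return ocochain N oW n -> Prop with
  | 0%N => fun z => z = 0
  | m.+1 => fun z => exists y : ocochain N oW m, [/\ equivariant y, odiff y = z & vanish below y]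
  end z.
Proof.
move=> + + zB.
pose h0 := ocomp (ofst R oX) (oslice oX (-2 : R)).
have hz H w : ocontract p (-2) H (w, zero) = h0 H w.
  by case: w => x t; rewrite /= /mkcts /= subr0 mul1r mul0r addr0.
pose h1 := ocomp (oslice oW (one : I)) (ocontract p (-2)).
have z1 : opull h1 z = z.
  apply: ocochainP => H s; apply: opull_id => t.
  by rewrite /= /mkcts /= subrr mul0r mul1r add0r; case: (s t).
have z0 : opull h0 z = 0.
  by apply: vanishT; apply: opull_vanish zB => H w _; exact: below_slice.
case: n z zB z0 z1 => [|n] z zB z0 z1 zE dz.
  have := @ohomotopyP0 R G B N oW oW (ocontract p (-2)) h0 h1 hz (fun _ _ => erefl) z.
  by rewrite z0 z1 dz subr0 opull0 oprism0.
exists (oprism (opull (ocontract p (-2)) z)); split.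
- exact: ohomotopy_equivariant.
- have := @ohomotopyP R G B N oW oW (ocontract p (-2)) h0 h1 hz (fun _ _ => erefl) n z.
  by rewrite z0 z1 dz subr0 opull0 oprism0 addr0.
- by apply: ohomotopy_vanish zB => H w u; exact: below_contract.
Qed.

End suspension_cohomology.

(** * The relation between cocycles on the suspension and pairs of cocycles *)

Section suspension_isomorphism.
Context (R : realType) (G : groupType) (B : gspace G) (N : eq_local_system R B).
Context (X : gspace G) (p : gmap X B) (s0 : circle R).
Local Notation I := (interval01 R).
Local Notation S := (susp p s0).
Local Notation oX := (ofix p).
Local Notation oS := (ofix (susp_proj p s0)).
Local Notation oW := (oprod R oX).
Local Notation oB := (obase B).
Local Notation incl := (oincl p s0).
Local Notation proj := (oproj (susp_proj p s0)).
Local Notation chart := (ochart p s0).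
Local Notation near_base := (@near_base R G B X p s0).
Local Notation off_base := (@off_base R G B X p s0).
Local Notation below := (@below R G B X p).
Local Notation above := (@above R G B X p).
Local Notation upper := (@upper R G B X p).

(* The difference [odiff (step g)] is the product of [g] with the class of a
   generator of the first cohomology of the circle relative to its base point. *)
Definition step n (g : ocochain N oX n) : ocochain N oW n :=
  ochi upper (opull (ofst R oX) g).

Lemma step_equivariant n (g : ocochain N oX n) : equivariant g -> equivariant (step g).
Proof. by move=> gE; apply: ochi_equivariant => //; exact: opull_equivariant. Qed.

Lemma stepB n (g g' : ocochain N oX n) : step (g - g') = step g - step g'.
Proof. by rewrite /step opullB ochiB. Qed.

Lemma step0 n : step (0 : ocochain N oX n) = 0.
Proof. by rewrite -[in LHS](subrr (0 : ocochain N oX n)) stepB subrr. Qed.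

Lemma step_below n (g : ocochain N oX n) : vanish below (step g).
Proof.
move=> H s sB; rewrite /step /ochi; case: asboolP => // h; exfalso.
have h1 : (s (vtx0 R n)).2 < -1 := sB (vtx0 R n).
have h2 : 0 < (s (vtx0 R n)).2 := h.
by clear -h1 h2; lra.
Qed.

Lemma step_above n (g : ocochain N oX n) : vanish above (step g - opull (ofst R oX) g).
Proof.
move=> H s sA; rewrite -[LHS]/((step g : ocochain N oW n) H s - (opull (ofst R oX) g : ocochain N oW n) H s).
rewrite /step /ochi; case: asboolP => [_|[]]; first exact: subrr.
have h1 : 1 < (s (vtx0 R n)).2 := sA (vtx0 R n).
by rewrite /upper /=; clear -h1; lra.
Qed.

Lemma diff_step_below n (g : ocochain N oX n) : vanish below (odiff (step g)).
Proof. exact/vanish_odiff/step_below. Qed.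

Lemma diff_step_above n (g : ocochain N oX n) : odiff g = 0 -> vanish above (odiff (step g)).
Proof.
move=> gZ; have := vanish_odiff (@step_above n g).
by rewrite odiffB opull_diff gZ opull0 subr0.
Qed.

Lemma slice_above n (w : ocochain N oW n) : vanish above w -> opull (oslice oX (2 : R)) w = 0.
Proof.
move=> w0; apply: vanishT; apply: opull_vanish w0 => H x _.
by rewrite /above /=; lra.
Qed.

Lemma slice_below n (w : ocochain N oW n) : vanish below w -> opull (oslice oX (-2 : R)) w = 0.
Proof. by move=> w0; apply: vanishT; apply: opull_vanish w0 => H x _; exact: below_slice. Qed.

Lemma slice_fst n (g : ocochain N oX n) (t : R) : opull (oslice oX t) (opull (ofst R oX) g) = g.
Proof.
apply: ocochainP => H s.
by rewrite (opull_comp (w := ocomp (oslice oX t) (ofst R oX))) //; apply: opull_id.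
Qed.

Lemma slice_step n (g : ocochain N oX n) : opull (oslice oX (2 : R)) (step g) = g.
Proof.
have := slice_above (@step_above n g); rewrite opullB slice_fst.
by move/eqP; rewrite subr_eq0 => /eqP.
Qed.

Lemma incl_near n (f : ocochain N oS n) : vanish near_base f -> opull incl f = 0.
Proof.
move=> f0; apply: vanishT; apply: opull_vanish f0 => H y _.
by rewrite /near_base /= /mkcts sheight_inr.
Qed.

(** The correction [h] absorbs the choice of [f] in its class. Nothing is required on simplices
    contained in neither member of the cover. *)
Definition related_by n (h : ocochain N oS n) (f : ocochain N oS n.+1)
    (g : ocochain N oX n) (k : ocochain N oB n.+1) :=
  vanish near_base (f - opull proj k - odiff h) /\
  opull chart (f - opull proj k - odiff h) = odiff (step g).

Definition related n f g k := exists2 h, equivariant h & @related_by n h f g k.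

Lemma relatedB n f g k f' g' k' : @related n f g k -> related f' g' k' ->
  related (f - f') (g - g') (k - k').
Proof.
move=> [h hE [U J]] [h' hE' [U' J']]; exists (h - h'); first exact: equivariantB.
have E : f - f' - opull proj (k - k') - odiff (h - h') =
    (f - opull proj k - odiff h) - (f' - opull proj k' - odiff h').
  by rewrite opullB odiffB (sub_interchange f) sub_interchange.
rewrite /related_by E; split; first exact: vanishB.
by rewrite opullB J J' -odiffB stepB.
Qed.

(** The extension by zero [u] of [odiff (step g)] satisfies the cocycle condition only on small
    simplices. Its coboundary vanishes on these, so by excision it is also the coboundary of some
    [e] that vanishes on them; [u - e] is closed and has the same restrictions as [u]. *)
Lemma related_right n g k : equivariant g -> odiff g = 0 -> equivariant k -> odiff k = 0 ->
  exists f, [/\ equivariant f, odiff f = 0 & @related n f g k].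
Proof.
move=> gE gZ kE kZ.
have [u [uE uw uU]] := oextend s0 (odiff_equivariant (step_equivariant gE))
  (@diff_step_below n g) (diff_step_above gZ).
have duU := vanish_odiff uU.
have duV : vanish off_base (odiff u) by apply: vanish_off; rewrite -opull_diff uw odiffK.
have [e [eE de eU eV]] := @excision R G B N oS near_base off_base n.+2 (odiff u)
  (@near_base_open R G B X p s0) (@off_base_open R G B X p s0) (@near_off_cover R G B X p s0)
  (odiff_equivariant uE) (odiffK u) duU duV.
have ue : u - e + opull proj k - opull proj k - odiff 0 = u - e.
  by rewrite addrK odiff0 subr0.
exists (u - e + opull proj k); split.
- by apply: equivariantD; [exact: equivariantB|exact: opull_equivariant].
- by rewrite odiffD odiffB de subrr opull_diff kZ opull0 addr0.
exists 0; first exact: equivariant0.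
rewrite /related_by ue; split; first exact: vanishB.
rewrite opullB uw [X in _ - X](_ : _ = 0) ?subr0 //.
by apply: vanishT; apply: opull_vanish eV => H w _; exact: chart_off_base.
Qed.

(** After normalization near the base, the class in the chart is that of a cocycle [z] vanishing at
    both ends of the line. Its primitive can be made to vanish below; [g] is what obstructs the same
    above, read off at level 2. Subtracting [step g] removes the obstruction, and the remaining
    primitive extends by zero. *)
Lemma related_left n f : equivariant f -> odiff f = 0 ->
  exists g k, [/\ equivariant g, odiff g = 0, equivariant k, odiff k = 0 & @related n f g k].
Proof.
move=> fE fZ; set k := opull incl f.
have kE : equivariant k by exact: opull_equivariant.
have kZ : odiff k = 0 by rewrite opull_diff fZ opull0.
set f1 := f - opull proj k.
have f1E : equivariant f1 by apply: equivariantB => //; exact: opull_equivariant.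
have f1Z : odiff f1 = 0 by rewrite odiffB fZ opull_diff kZ opull0 subrr.
have f1i : opull incl f1 = 0 by rewrite opullB proj_incl subrr.
have [|b [bE [y yE yb] bU]] := vanish_near_base f1E f1i; first by rewrite f1Z; exact: vanish0.
set z := opull chart (f1 - b).
have zE : equivariant z by apply: opull_equivariant; exact: equivariantB.
have zZ : odiff z = 0 by rewrite opull_diff odiffB f1Z -yb odiffK subrr opull0.
have [zB zA] := chart_vanish bU.
have [y1 [y1E dy1 y1B]] := primitive_below zE zZ zB.
have [|y2 [y2E dy2 y2B y2A]] := straighten_above y1E; first by rewrite dy1.
set g := opull (oslice oX (2 : R)) y1 in y2A.
have gE : equivariant g by exact: opull_equivariant.
(* The level 2 lies above, where [z], the coboundary of [y1], vanishes. *)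
have gZ : odiff g = 0 by rewrite opull_diff dy1 slice_above.
have [||u [uE uw uU]] := oextend s0 (equivariantB y2E (step_equivariant gE)).
- apply: vanishB; last exact: step_below.
  by rewrite -(subrK y1 y2); exact: vanishD.
(* Above, both [y2] and [step g] agree with the pullback of [g] from [X]. *)
- rewrite -(subrK (opull (ofst R oX) g) y2) -addrA; apply: vanishD => //.
  by rewrite -opprB; apply/vanishN/step_above.
exists g, k; split=> //; exists (y + u); first exact: equivariantD.
have E : f - opull proj k - odiff (y + u) = (f1 - b) - odiff u.
  by rewrite odiffD yb opprD addrA.
rewrite /related_by E; split; first by apply: vanishB => //; exact: vanish_odiff.
rewrite opullB -/z -opull_diff uw odiffB dy2 dy1 opprB addrCA subrr addr0 //.
Qed.

(** If [g] is the coboundary of [g'], then [odiff (step g')] and [step g] differ only near the jump.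
    The difference extends by zero to some [u], and [v + odiff u] vanishes on all small simplices,
    so excision applies to it. In the lowest degree [g] is zero and excision applies to [v]
    itself. *)
Lemma bound_step n (v : ocochain N oS n.+1) (g : ocochain N oX n) : equivariant v -> odiff v = 0 ->
  vanish near_base v -> opull chart v = odiff (step g) -> equivariant g -> obound g -> obound v.
Proof.
have exc (u : ocochain N oS n.+1) : equivariant u -> odiff u = 0 -> vanish near_base u ->
    opull chart u = 0 -> exists2 e : ocochain N oS n, equivariant e & odiff e = u.
  move=> uE uZ uU uJ.
  have [e [eE de _ _]] := @excision R G B N oS near_base off_base n.+1 u
    (@near_base_open R G B X p s0) (@off_base_open R G B X p s0) (@near_off_cover R G B X p s0)
    uE uZ uU (vanish_off uJ).
  by exists e.
move=> vE vZ vU vJ gE gB; have gZ := obound_diff gB.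
case: n v g exc vE vZ vU vJ gE gB gZ => [|n] v g exc vE vZ vU vJ gE gB gZ.
  by apply: exc => //; rewrite vJ gB step0 odiff0.
case: gB => g' g'E g'g.
have [||u [uE uw uU]] := oextend s0 (equivariantB (odiff_equivariant (step_equivariant g'E))
  (step_equivariant gE)).
- by apply: vanishB; [exact: diff_step_below|exact: step_below].
- have h1 := vanish_odiff (@step_above _ g'); rewrite odiffB opull_diff g'g in h1.
  have h2 := @step_above _ g.
  by have := vanishB h1 h2; rewrite sub_interchange subrr subr0.
have [| | | |e eE ef] := exc (v + odiff u).
- by apply: equivariantD => //; exact: odiff_equivariant.
- by rewrite odiffD vZ odiffK addr0.
- by apply: vanishD => //; exact: vanish_odiff.
- by rewrite opullD vJ -opull_diff uw odiffB odiffK sub0r subrr.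
exists (e - u); first exact: equivariantB.
by rewrite odiffB ef addrK.
Qed.

(** From left to right, a primitive of [f] restricts to a primitive of [k]; in the chart it is
    compared with [step g], and the difference is a cocycle on the line times [X] that is zero at
    one end and [- g] at the other. The converse rests on [bound_step]. *)
Lemma related_bound n f g k : equivariant f -> odiff f = 0 -> equivariant g -> odiff g = 0 ->
  equivariant k -> odiff k = 0 -> @related n f g k -> obound f <-> obound g /\ obound k.
Proof.
move=> fE fZ gE gZ kE kZ [h hE [U J]]; set f1 := f - _ - _ in U J.
have f1E : equivariant f1.
  apply/equivariantB/odiff_equivariant => //; apply: equivariantB => //; exact: opull_equivariant.
have f1Z : odiff f1 = 0.
  by rewrite /f1 !odiffB odiffK fZ opull_diff kZ opull0 !subrr.
split=> [[f' f'E f'f]|[gB kB]].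
  pose u := f' - h; have uE : equivariant u by exact: equivariantB.
  have f1u : f1 = odiff u - opull proj k by rewrite /f1 odiffB f'f addrAC.
  have ku : k = odiff (opull incl u).
    have := incl_near U; rewrite f1u opullB proj_incl opull_diff.
    by move/eqP; rewrite subr_eq0 => /eqP.
  split; last by exists (opull incl u) => //; exact: opull_equivariant.
  pose h1 := u - opull proj (opull incl u).
  have h1E : equivariant h1 by apply: equivariantB => //; do 2 apply: opull_equivariant.
  have h1i : opull incl h1 = 0 by rewrite opullB proj_incl subrr.
  have dh1 : odiff h1 = f1 by rewrite odiffB opull_diff -ku.
  (* The cochain [h1] need not be closed; it suffices that its coboundary [f1] vanishes near the
     base. *)
  have [|b [bE bB bU]] := vanish_near_base h1E h1i; first by rewrite dh1.
  have [xB xA] := chart_vanish bU.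
  set x := opull chart (h1 - b) in xA xB.
  have xE : equivariant (x - step g).
    apply/equivariantB/step_equivariant => //; apply: opull_equivariant; exact: equivariantB.
  have dx : odiff (x - step g) = 0.
    by rewrite odiffB opull_diff odiffB (obound_diff bB) subr0 dh1 J subrr.
  (* The homotopy from the level -2 to the level 2 compares the restrictions 0 and [- g] of the
     cocycle [x - step g]. *)
  have c0 H w : ocross p (-2) 2 H (w, zero) = oslice oX (-2 : R) H w.
    by rewrite /= /mkcts /= subr0 mul1r mul0r addr0.
  have c1 H w : ocross p (-2) 2 H (w, one) = oslice oX (2 : R) H w.
    by rewrite /= /mkcts /= subrr mul0r mul1r add0r.
  have e0 : opull (oslice oX (-2 : R)) (x - step g) = 0.
    by apply: slice_below; apply: vanishB => //; exact: step_below.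
  have e1 : opull (oslice oX (2 : R)) (x - step g) = - g.
    by rewrite opullB slice_step slice_above // sub0r.
  move: (x - step g) xE dx e0 e1 => v vE dv e0 e1.
  clear - vE dv e0 e1 c0 c1; case: n g v vE dv e0 e1 => [|n] g v vE dv e0 e1 /=.
    have := ohomotopyP0 c0 c1 v; rewrite e0 e1 dv opull0 oprism0 subr0.
    by move/eqP; rewrite eq_sym oppr_eq0 => /eqP.
  exists (- oprism (opull (ocross p (-2) 2) v)); first exact/equivariantN/ohomotopy_equivariant.
  have := ohomotopyP c0 c1 v; rewrite e0 e1 dv opull0 oprism0 addr0 subr0 => E.
  by rewrite odiffN E opprK.
have [e eE ef1] := bound_step f1E f1Z U J gE gB.
case: kB => k' k'E k'k; exists (e + opull proj k' + h).
  by apply: equivariantD => //; apply: equivariantD => //; exact: opull_equivariant.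
by rewrite !odiffD ef1 opull_diff k'k /f1 addrAC !subrK.
Qed.

(** In degree 0 all correction terms are absent: minus the pullback of its restriction, [f] vanishes
    near the base, then along the whole line by [primitive_below], and points are small
    simplices. *)
Lemma related0 (f : ocochain N oS 0) : equivariant f -> odiff f = 0 ->
  f = opull proj (opull incl f).
Proof.
move=> fE fZ; apply/eqP; rewrite -subr_eq0; apply/eqP; set f1 := _ - _.
have f1E : equivariant f1 by apply: equivariantB => //; do 2 apply: opull_equivariant.
have f1Z : odiff f1 = 0 by rewrite odiffB fZ !opull_diff fZ !opull0 subrr.
have f1i : opull incl f1 = 0 by rewrite opullB proj_incl subrr.
have [|b [bE /= b0 bU]] := vanish_near_base f1E f1i; first by rewrite f1Z; exact: vanish0.
rewrite b0 subr0 in bU.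
have [zB _] := chart_vanish bU.
have zZ : odiff (opull chart f1) = 0 by rewrite opull_diff f1Z opull0.
have z0 := primitive_below (opull_equivariant _ f1E) zZ zB.
exact: (excision (@near_base_open R G B X p s0) (@off_base_open R G B X p s0)
  (@near_off_cover R G B X p s0) f1E f1Z bU (vanish_off z0)).
Qed.
End suspension_isomorphism.

(** * Cohomology *)

(** Additivity applied to differences turns the condition on zero classes into the equivalence of
    equalities on both sides ([req]). The map on quotients can then be picked by choice; its
    additivity is verified on related representatives afterwards. *)
Lemma relation_iso (Z1 Z2 Q1 Q2 : zmodType) (p1 : {additive Z1 -> Q1}) (p2 : {additive Z2 -> Q2})
    (r : Z1 -> Z2 -> Prop) :
  (forall q, exists z, p1 z = q) -> (forall q, exists z, p2 z = q) ->
  (forall a b a' b', r a b -> r a' b' -> r (a - a') (b - b')) ->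
  (forall a, exists b, r a b) -> (forall b, exists a, r a b) ->
  (forall a b, r a b -> p1 a = 0 <-> p2 b = 0) ->
  exists phi : {additive Q1 -> Q2}, bijective phi.
Proof.
move=> s1 s2 rB tl tr r0.
have req a b a' b' : r a b -> r a' b' -> p1 a = p1 a' <-> p2 b = p2 b'.
  move=> ab ab'; have [h1 h2] := r0 _ _ (rB _ _ _ _ ab ab').
  by split=> /eqP; rewrite -subr_eq0 -raddfB => /eqP h; apply/eqP;
    rewrite -subr_eq0 -raddfB; apply/eqP; [exact: h1|exact: h2].
have ex q : exists y, exists2 ab : Z1 * Z2, r ab.1 ab.2 & p1 ab.1 = q /\ p2 ab.2 = y.
  have [a aq] := s1 q; have [b ab] := tl a.
  by exists (p2 b); exists (a, b).
have [f fE] := choice ex.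
have fP a b : r a b -> f (p1 a) = p2 b.
  by move=> ab; have [[a' b'] ab' [/= e <-]] := fE (p1 a); apply/(req _ _ _ _ ab' ab).
have fB : zmod_morphism f.
  move=> x y; have [[a b] /= ab [<- _]] := fE x; have [[a' b'] /= ab' [<- _]] := fE y.
  by rewrite -raddfB (fP _ _ (rB _ _ _ _ ab ab')) raddfB (fP _ _ ab) (fP _ _ ab').
pose phi : {additive Q1 -> Q2} := HB.pack f (GRing.isZmodMorphism.Build Q1 Q2 f fB).
exists phi.
have ex2 y : exists x, f x = y.
  have [b <-] := s2 y; have [a ab] := tr b; exists (p1 a); exact: fP.
have [g gE] := choice ex2.
have fI x y : f x = f y -> x = y.
  have [[a b] /= ab [<- _]] := fE x; have [[a' b'] /= ab' [<- _]] := fE y.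
  by rewrite (fP _ _ ab) (fP _ _ ab') => h; apply/(req _ _ _ _ ab ab').
by exists g => [x|y]; [apply: fI; rewrite gE|exact: gE].
Qed.

(** * From equivariant cochains of diagrams to Bredon cohomology *)

Section realizations.
Context (R : realType) (G : groupType) (B : gspace G) (N : eq_local_system R B).

(** Bredon complexes of pulled back systems and of the system on the base reach the diagram cochains
    by different conversions; this interface treats them alike. *)
Record realization (C : cochains) (Y : ospace B) := Realization {
  rz :> forall n, C n -> ocochain N Y n;
  rzB : forall n (x y : C n), rz (x - y) = rz x - rz y;
  rz_inj : forall n, injective (@rz n);
  rz_equivariant : forall n (x : C n), equivariant (rz x);
  rz_surj : forall n (f : ocochain N Y n), equivariant f -> exists x, rz x = f;
  rz_diff : forall n (x : C n), rz (cochain_diff C n x) = odiff (rz x) }.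

Section theory.
Context (C : cochains) (Y : ospace B) (r : realization C Y).

Lemma rz0 n : r n 0 = 0.
Proof. by rewrite -[in LHS](subrr (0 : C n)) rzB subrr. Qed.

Definition class n : {additive subz (@cocycle C n) -> cohomology C n} :=
  \pi_(Quotient.quot (@coboundary C n)).

Lemma class_surj (n : nat) (q : cohomology C n) : exists z, class n z = q.
Proof. by exists (repr (q : Quotient.quot (@coboundary C n))); exact: reprK. Qed.

Lemma rz_cocycle n (z : subz (@cocycle C n)) : odiff (r n (val z)) = 0.
Proof. by rewrite -rz_diff; have /eqP -> := valP z; exact: rz0. Qed.

Lemma class_eq0 n (z : subz (@cocycle C n)) : class n z = 0 <-> obound (r n (val z)).
Proof.
have -> : (class n z = 0) <-> z \in @coboundary C n.
  rewrite -[z in X in _ <-> X]subr0 Quotient.idealrBE -[0](raddf0 (class n)).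
  by split=> [h|/eqP h]; [apply/eqP|].
have -> : (z \in @coboundary C n) <-> is_coboundary (val z) by split=> /asboolP.
move: (val z) => {z}; case: n => [|n] x /=.
  by split=> [->|x0]; [exact: rz0|apply: (@rz_inj _ _ r); rewrite x0 rz0].
split=> [[u _ <-]|[f fE fx]]; first by exists (r n u); [exact: rz_equivariant|rewrite rz_diff].
have [u uf] := rz_surj r fE.
by exists u => //; apply: (@rz_inj _ _ r); rewrite rz_diff uf.
Qed.

Lemma cocycle_exists n (f : ocochain N Y n) : equivariant f -> odiff f = 0 ->
  exists z : subz (@cocycle C n), r n (val z) = f.
Proof.
move=> fE fZ; have [x xf] := rz_surj r fE.
have xZ : x \in @cocycle C n.
  by apply/eqP; apply: (@rz_inj _ _ r); rewrite rz_diff xf fZ rz0.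
by exists (exist (fun x => x \in @cocycle C n) x xZ).
Qed.
End theory.

Section isomorphism.
Context (X : gspace G) (p : gmap X B) (s0 : circle R).
Context (CS CX CB : cochains) (rS : realization CS (ofix (susp_proj p s0))).
Context (rX : realization CX (ofix p)) (rB : realization CB (obase B)).

Lemma suspension_iso (m : nat) :
  exists phi : {additive cohomology CS m.+1 -> (cohomology CX m * cohomology CB m.+1)%type},
    bijective phi.
Proof.
pose cl (z : subz (@cocycle CX m) * subz (@cocycle CB m.+1)) :
  (cohomology CX m * cohomology CB m.+1)%type := (class _ m z.1, class _ m.+1 z.2).
have clB : zmod_morphism cl by move=> x y; rewrite /cl !raddfB.
pose p2 : {additive _ -> _} := HB.pack cl (GRing.isZmodMorphism.Build _ _ cl clB).
apply: (relation_iso (p1 := class CS m.+1) (p2 := p2)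
  (r := fun a b => related (rS _ (val a)) (rX _ (val b.1)) (rB _ (val b.2)))).
- exact: class_surj.
- move=> [q1 q2]; have [z1 z1q] := class_surj q1; have [z2 z2q] := class_surj q2.
  by exists (z1, z2); rewrite /= /cl z1q z2q.
- move=> a [b1 b2] a' [b1' b2'] /= h h'; rewrite !(raddfB, rzB).
  exact: relatedB.
- move=> a; have [g [k [gE gZ kE kZ fgk]]] := related_left (rz_equivariant rS (val a)) (rz_cocycle rS a).
  have [z1 z1g] := cocycle_exists rX gE gZ; have [z2 z2k] := cocycle_exists rB kE kZ.
  by exists (z1, z2); rewrite z1g z2k.
- move=> [b1 b2]; have [f [fE fZ fgk]] := related_right s0 (rz_equivariant rX (val b1))
    (rz_cocycle rX b1) (rz_equivariant rB (val b2)) (rz_cocycle rB b2).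
  by have [z zf] := cocycle_exists rS fE fZ; exists z; rewrite zf.
- move=> a [b1 b2] /= ab; apply: (iff_trans (class_eq0 rS a)).
  apply: (iff_trans (related_bound (rz_equivariant rS (val a)) (rz_cocycle rS a)
    (rz_equivariant rX (val b1)) (rz_cocycle rX b1)
    (rz_equivariant rB (val b2)) (rz_cocycle rB b2) ab)).
  have [h1 h1'] := class_eq0 rX b1; have [h2 h2'] := class_eq0 rB b2.
  split=> [[/h1' e1 /h2' e2]|[e1 e2]]; first by rewrite /cl /= e1 e2.
  by split; [exact: h1|exact: h2].
Qed.

(** In degree 0 the relation is simply that [f] is the pullback of [k], and by [related0] every
    cocycle has this form. The factor ['rV[int]_0] is the zero group that stands for cohomology in
    degree -1. *)
Lemma suspension_iso0 :
  exists phi : {additive cohomology CS 0 -> ('rV[int]_0 * cohomology CB 0)%type}, bijective phi.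
Proof.
pose cl (z : subz (@cocycle CB 0)) : ('rV[int]_0 * cohomology CB 0)%type := (0, class _ 0 z).
have clB : zmod_morphism cl.
  by move=> x y; rewrite /cl raddfB; congr (_, _); rewrite subrr.
pose p2 : {additive _ -> _} := HB.pack cl (GRing.isZmodMorphism.Build _ _ cl clB).
apply: (relation_iso (p1 := class CS 0) (p2 := p2)
  (r := fun a b => rS _ (val a) = opull (oproj (susp_proj p s0)) (rB _ (val b)))).
- exact: class_surj.
- move=> [q1 q2]; have [z2 z2q] := class_surj q2.
  by exists z2; rewrite /= /cl z2q; congr (_, _); apply/rowP => -[].
- by move=> a b a' b' ab ab'; rewrite !(raddfB, rzB) ab ab' opullB.
- move=> a; have := related0 (rz_equivariant rS (val a)) (rz_cocycle rS a).
  set k := opull (oincl _ _) _ => fk.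
  have kE : equivariant k by apply: opull_equivariant; exact: rz_equivariant.
  have kZ : odiff k = 0 by rewrite opull_diff rz_cocycle opull0.
  by have [z zk] := cocycle_exists rB kE kZ; exists z; rewrite zk.
- move=> b; have [||z zf] := @cocycle_exists _ _ rS 0 (opull (oproj (susp_proj p s0)) (rB _ (val b))).
  + exact/opull_equivariant/rz_equivariant.
  + by rewrite opull_diff rz_cocycle opull0.
  by exists z.
- move=> a b ab; apply: (iff_trans (class_eq0 rS a)); have [h h'] := class_eq0 rB b.
  rewrite ab; split=> [/= e|[/h /= e]]; last by rewrite /= e opull0.
  have e' : obound (rB 0%N (val b)).
    by rewrite /= -(proj_incl p s0 (rB _ (val b))) e opull0.
  by rewrite /cl /= (h' e').
Qed.
End isomorphism.

Lemma els_map_irrelevance (H K : groupClosed G) a (Ha : subconj a H K) (x : fixpts B K)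
    (y : fixpts B H) (e e' : y = fix_act B Ha x) (m : N K x) : els_map N e m = els_map N e' m.
Proof. by rewrite (Prop_irrelevance e e'). Qed.

Section pullback.
Context (Y : gspace G) (q : gmap Y B).

Lemma equivariant_pullback n (f : fix_cochains (pullback q N) n) :
  f \in @equivariant_cochain R G Y (pullback q N) n <-> equivariant (f : ocochain N (ofix q) n).
Proof.
split=> [/asboolP fE|fE]; [|apply/asboolP] => H K a Ha s; apply: (etrans (fE H K a Ha s));
  exact: (@els_map_irrelevance H K a Ha (gmap_fix q K (s (vtx0 R n)))
    (gmap_fix q H (fix_act Y Ha (s (vtx0 R n))))).
Qed.

Definition pullback_val n (x : bredon_cochain (pullback q N) n) : ocochain N (ofix q) n := val x.

Lemma pullback_valB n (x y : bredon_cochain (pullback q N) n) :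
  pullback_val (x - y) = pullback_val x - pullback_val y.
Proof. exact: ocochainP. Qed.

Lemma pullback_val_diff n (x : bredon_cochain (pullback q N) n) :
  pullback_val (bredon_diff x) = odiff (pullback_val x).
Proof. exact: ocochainP. Qed.

Lemma pullback_val_surj n (f : ocochain N (ofix q) n) : equivariant f ->
  exists x, pullback_val x = f.
Proof.
move=> /equivariant_pullback fE.
by exists (exist (fun g => g \in @equivariant_cochain R G Y (pullback q N) n) f fE).
Qed.

Lemma pullback_val_equivariant n (x : bredon_cochain (pullback q N) n) :
  equivariant (pullback_val x).
Proof. by apply/equivariant_pullback; exact: valP x. Qed.

Definition realize_pullback : realization (bredon_complex (pullback q N)) (ofix q) :=
  @Realization (bredon_complex (pullback q N)) (ofix q) pullback_val pullback_valB
    (fun n => val_inj) pullback_val_equivariant pullback_val_surj pullback_val_diff.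
End pullback.

Lemma equivariant_base n (f : fix_cochains N n) :
  f \in @equivariant_cochain R G B N n <-> equivariant (f : ocochain N (obase B) n).
Proof.
split=> [/asboolP fE|fE]; [|apply/asboolP] => H K a Ha s; apply: (etrans (fE H K a Ha s));
  exact: (@els_map_irrelevance H K a Ha (s (vtx0 R n)) (fix_act B Ha (s (vtx0 R n)))).
Qed.

Definition base_val n (x : bredon_cochain N n) : ocochain N (obase B) n := val x.

Lemma base_valB n (x y : bredon_cochain N n) : base_val (x - y) = base_val x - base_val y.
Proof. exact: ocochainP. Qed.

Lemma base_val_diff n (x : bredon_cochain N n) : base_val (bredon_diff x) = odiff (base_val x).
Proof.
apply: functional_extensionality_dep => H; symmetry; exact: coboundary_pull_id.
Qed.

Lemma base_val_surj n (f : ocochain N (obase B) n) : equivariant f -> exists x, base_val x = f.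
Proof.
move=> /equivariant_base fE.
by exists (exist (fun g => g \in @equivariant_cochain R G B N n) f fE).
Qed.

Lemma base_val_equivariant n (x : bredon_cochain N n) : equivariant (base_val x).
Proof. by apply/equivariant_base; exact: valP x. Qed.

Definition realize_base : realization (bredon_complex N) (obase B) :=
  @Realization (bredon_complex N) (obase B) base_val base_valB
    (fun n => val_inj) base_val_equivariant base_val_surj base_val_diff.
End realizations.

Theorem proposition3p12 (R : realType) (G : groupType) (pi : og_group G)
    (K : em_space R pi) (M : pi_module pi) (N : eq_local_system R K)
    (NM : given_by_module M N) (X : gspace G) (p : gmap X K) (s0 : circle R) (n : int) :
  exists phi : {additive
      bredon_cohomology (pullback (susp_proj p s0) N) n ->
      (bredon_cohomology (pullback p N) (n - 1) * bredon_cohomology N n)%type},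
    bijective phi.
Proof.
case: n => [[|m]|m].
- exact: (suspension_iso0 (realize_pullback N (susp_proj p s0)) (realize_base N)).
- have -> : m.+1%:Z - 1 = m%:Z by rewrite -addn1 PoszD addrK.
  exact: (suspension_iso (realize_pullback N (susp_proj p s0)) (realize_pullback N p) (realize_base N)).
(* In negative degrees all three groups are the trivial group ['rV[int]_0]. *)
- have -> : Negz m - 1 = Negz m.+1 by rewrite !NegzE -opprD -PoszD addn1.
  exists (\0 : {additive _ -> _}).
  exists (fun=> 0) => [x|[x y]]; first exact: (esym (thinmx0 (x : 'rV[int]_0))).
  exact: (esym (congr2 pair (thinmx0 (x : 'rV[int]_0)) (thinmx0 (y : 'rV[int]_0)))).
Qed.
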